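(* Let $\Omega=(0,\infty)^2$ and let $F:\mathbb S^2\times\mathbb R^2\times\mathbb R\times\overline\Omega\to\mathbb R$ be continuous and satisfy: (i) there is a constant $\mu>0$ such that for each $(X,p,x)\in\mathbb S^2\times\mathbb R^2\times\Omega$ the function $u\mapsto F(X,p,u,x)-\mu u$ is nondecreasing on $\mathbb R$; (ii) there is a constant $L>0$ such that for every $(X,p),(Y,q)\in\mathbb S^2\times\mathbb R^2$ and $(u,x)\in\mathbb R\times\Omega$, $|F(X,p,u,x)-F(Y,q,u,x)|\le L(|X-Y|+|p-q|)$; (iii) there is a modulus $\omega$ such that for any $X,Y\in\mathbb S^2$, $x,y\in\Omega$, $(p,u)\in\mathbb R^2\times\mathbb R$ and $\alpha>0$, if $$-\alpha\begin{pmatrix} I_2&0\\0&I_2\end{pmatrix}\le\begin{pmatrix}X&0\\0&-Y\end{pmatrix}\le\alpha\begin{pmatrix}I_2&-I_2\\-I_2&I_2\end{pmatrix},$$ then $F(X,p,u,x)-F(Y,p,u,y)\ge-\omega\big(\alpha|x-y|^2+|x-y|(|p|+1)\big)$. For $i=1,2$ let $h_i:\mathbb R\to\mathbb R$ be convex with $h_i'(t)\ge 0$ for a.e. $t\in\mathbb R$ and $\operatorname{ess\,lim}_{t\to\infty}h_i'(t)=\alpha_i\in[0,1)$, and set $H_1(p)=-p_1+h_1(p_2)$, $H_2(p)=-p_2+h_2(p_1)$ for $p\in\mathbb R^2$. Let $a=(a_1,a_2)\in\mathbb R^2$ be the (unique) point with $h_1(a_2)=a_1$, $h_2(a_1)=a_2$,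 and put $\tilde h_1(t)=-a_1+h_1(t+a_2)$, $\tilde h_2(t)=-a_2+h_2(t+a_1)$. Assume that there are vectors $v_0,v_1,v_2\in\mathbb R^2$ such that $(v_0,v_1,v_2)$ is admissible for $(\tilde h_1,\tilde h_2)$ and the slope condition holds for $(\tilde h_1,\tilde h_2)$ and $(v_0,v_1,v_2)$ (both notions are defined in the context). Let $v,w:\overline\Omega\to\mathbb R$ be bounded on $\overline\Omega$, where $v$ is an upper semicontinuous viscosity subsolution and $w$ is a lower semicontinuous viscosity supersolution of $$F(D^2u,Du,u,x)=0\ \text{ in }\Omega,\qquad H_1(Du)=0\ \text{ on }\partial_1\Omega,\qquad H_2(Du)=0\ \text{ on }\partial_2\Omega .$$ Then $v\le w$ on $\overline\Omega$.
   Context: Notation: $\mathbb S^2$ is the space of real symmetric $2\times2$ matrices with norm $|X|=\max\{|X\xi|: |\xi|=1\}$; $X\le Y$ means $Y-X$ is positive semidefinite; $I_2$ is the unit matrix. A modulus is a continuous nondecreasing function $\omega:[0,\infty)\to[0,\infty)$ with $\omega(0)=0$. $\partial_1\Omega=\{x: x_1=0,\ x_2\ge0\}$, $\partial_2\Omega=\{x: x_1\ge0,\ x_2=0\}$. $e_1,e_2$ is the standard basis of $\mathbb R^2$. Viscosity sub/supersolutions: an upper semicontinuous $u:\overline\Omega\to\mathbb R$ is a viscosity subsolution if, whenever $\varphi\in C^2(\overline\Omega)$ and $u-\varphi$ has a local maximum relative to $\overline\Omega$ at $\hat x\in\overline\Omega$, then $F(D^2\varphi(\hat x),D\varphi(\hat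 x),u(\hat x),\hat x)\le0$ if $\hat x\in\Omega$, and $\min\{H_i(D\varphi(\hat x)),F(D^2\varphi(\hat x),D\varphi(\hat x),u(\hat x),\hat x)\}\le0$ for each $i\in\{1,2\}$ with $\hat x\in\partial_i\Omega$. A lower semicontinuous $u$ is a viscosity supersolution if, whenever $u-\varphi$ has a local minimum relative to $\overline\Omega$ at $\hat x$, then $F(\ldots)\ge0$ if $\hat x\in\Omega$, and $\max\{H_i(D\varphi(\hat x)),F(\ldots)\}\ge0$ for each $i$ with $\hat x\in\partial_i\Omega$. Admissible vectors and slope condition. Let $k_1,k_2:\mathbb R\to\mathbb R$ be convex with $k_i'\ge0$ a.e., $\operatorname{ess\,lim}_{t\to\infty}k_i'(t)\in[0,1)$ and $k_i(0)=0$. A triple $(v_0,v_1,v_2)$ of vectors in $\mathbb R^2$ is admissible for $(k_1,k_2)$ if $v_0\cdot e_1>0$, $v_0\cdot e_2>0$, $v_1\cdot(-e_1)>0$, $v_1\cdot e_2>0$, $v_2\cdot e_1>0$, $v_2\cdot(-e_2)>0$; $\operatorname{ess\,inf}_{t\ge0}v_1\cdot(k_1'(t),1)>0$, $\operatorname{ess\,inf}_{t\le0}v_1\cdot(-1,-k_2'(t))>0$; $\operatorname{ess\,inf}_{t\ge0}v_2\cdot(1,k_2'(t))>0$, $\operatorname{ess\,inf}_{t\le0}v_2\cdot(-k_1'(t),-1)>0$. For such a triple and $\lambda>0$: $x_{PQ}^\lambda$ and $x_{PR}^\lambda$ are the unique points where the line $v_0\cdot x=\lambda$ meets the curves $x_1=k_1(x_2)$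 and $x_2=k_2(x_1)$, respectively; with $\lambda_1=v_1\cdot x_{PQ}^\lambda$ and $\lambda_2=v_2\cdot x_{PR}^\lambda$, $x_{QS}^\lambda$ is the unique point in $(-\infty,0]^2$ where the line $v_1\cdot x=\lambda_1$ meets the curve $x_2=k_2(x_1)$, and $x_{RS}^\lambda$ is the unique point in $(-\infty,0]^2$ where the line $v_2\cdot x=\lambda_2$ meets the curve $x_1=k_1(x_2)$. The slope condition for $(k_1,k_2)$ and $(v_0,v_1,v_2)$ is: there exists a constant $0<\gamma<1$ such that for each $\lambda>0$ the slope of the line passing through $x_{QS}^\lambda$ and $x_{RS}^\lambda$ lies in $[-1/\gamma,-\gamma]$. *)

(* Defs.v *)
From HB Require Import structures.
From mathcomp Require Import all_boot all_order all_algebra.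
From mathcomp Require Import all_classical all_reals all_analysis.
From mathcomp Require Import ess_sup_inf.

Set Implicit Arguments.
Unset Strict Implicit.
Unset Printing Implicit Defensive.

Import Order.TTheory GRing.Theory Num.Theory.
Import numFieldNormedType.Exports.

Local Open Scope classical_set_scope.
Local Open Scope ring_scope.

(* Points and vectors of the plane are row vectors; with 'I_2 = {0, 1}, the
   coordinates x_1, x_2 of the mathematical text are x 0 0 and x 0 1. *)

Definition vec2 (R : realType) (a b : R) : 'rV[R]_2 :=
  \row_i (if i == 0 then a else b).

Definition dot (R : realType) (n : nat) (x y : 'rV[R]_n) : R :=
  \sum_i x 0 i * y 0 i.

(* The norm `|x| that the library puts on matrices is the maximum norm, so the
   Euclidean norm and the operator norm it induces are spelled out. *)
Definition enorm (R : realType) (n : nat) (x : 'rV[R]_n) : R :=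
  Num.sqrt (dot x x).

(* xi *m X^T is the row vector encoding X xi. *)
Definition opnorm (R : realType) (n : nat) (X : 'M[R]_n) : R :=
  sup [set enorm (xi *m X^T) | xi in [set xi : 'rV[R]_n | enorm xi = 1]].

(* Intended for symmetric matrices. *)
Definition loewner_le (R : realType) (n : nat) (X Y : 'M[R]_n) : Prop :=
  forall xi : 'rV[R]_n, 0 <= (xi *m (Y - X) *m xi^T) 0 0.

Definition modulus (R : realType) (omega : R -> R) : Prop :=
  [/\ {within `[0, +oo[, continuous omega},
      {in `[0, +oo[ &, {homo omega : s t / s <= t}},
      (forall t, 0 <= t -> 0 <= omega t)
    & omega 0 = 0].

Section quadrant.
Variable R : realType.

Definition Omega : set 'rV[R]_2 := [set x | 0 < x 0 0 /\ 0 < x 0 1].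
Definition bdry1 : set 'rV[R]_2 := [set x | x 0 0 = 0 /\ 0 <= x 0 1].
Definition bdry2 : set 'rV[R]_2 := [set x | 0 <= x 0 0 /\ x 0 1 = 0].

End quadrant.
Arguments Omega : clear implicits.
Arguments bdry1 : clear implicits.
Arguments bdry2 : clear implicits.

Section viscosity.
Variable R : realType.
Implicit Types (A U : set 'rV[R]_2) (u phi : 'rV[R]_2 -> R).

(* Semicontinuity relative to A; the values of u off A are irrelevant. *)
Definition usc_on A u : Prop := forall x, A x ->
  forall c, u x < c -> \forall y \near within A (nbhs x), u y < c.
Definition lsc_on A u : Prop := forall x, A x ->
  forall c, c < u x -> \forall y \near within A (nbhs x), c < u y.

Definition local_max_on A u (x : 'rV[R]_2) : Prop :=
  A x /\ \forall y \near within A (nbhs x), u y <= u x.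
Definition local_min_on A u (x : 'rV[R]_2) : Prop :=
  A x /\ \forall y \near within A (nbhs x), u x <= u y.

Definition partial (i : 'I_2) phi : 'rV[R]_2 -> R :=
  fun x => 'D_(delta_mx 0 i) phi x.
Definition grad phi (x : 'rV[R]_2) : 'rV[R]_2 := \row_i partial i phi x.
Definition hessian phi (x : 'rV[R]_2) : 'M[R]_2 :=
  \matrix_(i, j) partial j (partial i phi) x.

(* For U open. *)
Definition C1_on U phi : Prop := forall i x, U x ->
  derivable phi x (delta_mx 0 i) /\ {for x, continuous (partial i phi)}.
Definition C2_on U phi : Prop :=
  C1_on U phi /\ forall i, C1_on U (partial i phi).

(* C^2 up to the boundary: twice continuously differentiable on some open
   neighbourhood of the closed set A. *)
Definition C2_closed A phi : Prop :=
  exists U, [/\ open U, A `<=` U & C2_on U phi].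

Variables (F : 'M[R]_2 -> 'rV[R]_2 -> R -> 'rV[R]_2 -> R)
          (H1 H2 : 'rV[R]_2 -> R).

Definition viscosity_subsolution u : Prop :=
  usc_on (closure (Omega R)) u /\
  forall phi xhat, C2_closed (closure (Omega R)) phi ->
    local_max_on (closure (Omega R)) (fun x => u x - phi x) xhat ->
    let p := grad phi xhat in
    let Fhat := F (hessian phi xhat) p (u xhat) xhat in
    [/\ Omega R xhat -> Fhat <= 0,
        bdry1 R xhat -> Num.min (H1 p) Fhat <= 0
      & bdry2 R xhat -> Num.min (H2 p) Fhat <= 0].

Definition viscosity_supersolution u : Prop :=
  lsc_on (closure (Omega R)) u /\
  forall phi xhat, C2_closed (closure (Omega R)) phi ->
    local_min_on (closure (Omega R)) (fun x => u x - phi x) xhat ->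
    let p := grad phi xhat in
    let Fhat := F (hessian phi xhat) p (u xhat) xhat in
    [/\ Omega R xhat -> 0 <= Fhat,
        bdry1 R xhat -> 0 <= Num.max (H1 p) Fhat
      & bdry2 R xhat -> 0 <= Num.max (H2 p) Fhat].

End viscosity.

Section slope.
Variable R : realType.
Implicit Types (k : R -> R) (v : 'rV[R]_2).

Definition ess_lim_pinfty (f : R -> R) (l : R) : Prop :=
  forall e, 0 < e -> \forall T \near +oo,
    \forall t \ae (@lebesgue_measure R), T < t -> `|f t - l| < e.

Definition ess_inf_ge0 (f : R -> R) : \bar R :=
  ess_infr (mrestr (@lebesgue_measure R) (measurable_itv `[0, +oo[)) f.
Definition ess_inf_le0 (f : R -> R) : \bar R :=
  ess_infr (mrestr (@lebesgue_measure R) (measurable_itv `]-oo, 0])) f.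

(* To be used with k1, k2 convex, so that the derivatives k1', k2', written
   here with the total operator derive1, exist almost everywhere. *)
Definition admissible k1 k2 v0 v1 v2 : Prop :=
  let e1 := vec2 1 0 in let e2 := vec2 0 1 in
  [/\ 0 < dot v0 e1 /\ 0 < dot v0 e2,
      0 < dot v1 (- e1) /\ 0 < dot v1 e2,
      0 < dot v2 e1 /\ 0 < dot v2 (- e2),
      (0 < ess_inf_ge0 (fun t => dot v1 (vec2 (derive1 k1 t) 1)))%E /\
      (0 < ess_inf_le0 (fun t => dot v1 (vec2 (- 1) (- derive1 k2 t))))%E
    & (0 < ess_inf_ge0 (fun t => dot v2 (vec2 1 (derive1 k2 t))))%E /\
      (0 < ess_inf_le0 (fun t => dot v2 (vec2 (- derive1 k1 t) (- 1))))%E].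

(* For an admissible triple and l > 0 each of the four sets below is a
   singleton, and get returns its element. *)
Definition xPQ k1 v0 (l : R) : 'rV[R]_2 :=
  get [set x : 'rV[R]_2 | dot v0 x = l /\ x 0 0 = k1 (x 0 1)].
Definition xPR k2 v0 (l : R) : 'rV[R]_2 :=
  get [set x : 'rV[R]_2 | dot v0 x = l /\ x 0 1 = k2 (x 0 0)].
Definition xQS k1 k2 v0 v1 (l : R) : 'rV[R]_2 :=
  get [set x : 'rV[R]_2 | [/\ x 0 0 <= 0 /\ x 0 1 <= 0,
    dot v1 x = dot v1 (xPQ k1 v0 l) & x 0 1 = k2 (x 0 0)]].
Definition xRS k1 k2 v0 v2 (l : R) : 'rV[R]_2 :=
  get [set x : 'rV[R]_2 | [/\ x 0 0 <= 0 /\ x 0 1 <= 0,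
    dot v2 x = dot v2 (xPR k2 v0 l) & x 0 0 = k1 (x 0 1)]].

(* If x 0 0 = y 0 0 this is 0, which lies in no interval [- 1 / g, - g] with
   g > 0: a vertical or undefined line violates the slope condition. *)
Definition line_slope (x y : 'rV[R]_2) : R :=
  (y 0 1 - x 0 1) / (y 0 0 - x 0 0).

Definition slope_condition k1 k2 v0 v1 v2 : Prop :=
  exists g : R, [/\ 0 < g, g < 1 & forall l : R, 0 < l ->
    line_slope (xQS k1 k2 v0 v1 l) (xRS k1 k2 v0 v2 l) \in `[- (1 / g), - g]].

End slope.

(* Main.v *)
From HB Require Import structures.
Require Import Defs.
From mathcomp Require Import all_boot all_order all_algebra.
From mathcomp Require Import all_classical all_reals all_analysis.
From mathcomp Require Import ess_sup_inf.
From mathcomp Require Import ring lra.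

Set Implicit Arguments.
Unset Strict Implicit.
Unset Printing Implicit Defensive.

Import Order.TTheory GRing.Theory Num.Theory.
Import numFieldNormedType.Exports.
Local Open Scope classical_set_scope.
Local Open Scope ring_scope.

(* Variables are doubled with a penalty adapted to the boundary operators.
   Writing k_1, k_2 for the nonlinearities translated so that k_i(0) = 0, both
   are nondecreasing and al-Lipschitz with al < 1, and the semiconcave function
     psi(z) = min_y (|y_1| + |y_2|)^2 / 2 + k_1(y_2) (z_1 - y_1)
                    + k_2(y_1) (z_2 - y_2) + M / 2 |z - y|^2
   has quadratic growth and a slope g with 0 <= g_1 - k_1(g_2) <= C z_1 for
   z_1 >= 0 and C z_1 <= g_1 - k_1(g_2) <= 0 for z_1 <= 0, and likewise for the
   other coordinate: up to small errors, its slopes have the sign that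
   contradicts the boundary conditions.  The penalty d (zeta(x_1) + zeta(x_2)),
   zeta(t) = t + 2 / (1 + t), provides compactness and, as zeta'(0) = - 1, makes
   these signs strict.

   Second order information at the maximum of the difference V - W of the sup-
   and inf-convolutions comes from approximate jets instead of Alexandrov's
   theorem.  Sliding paraboloids touch V - W at so many points that, by counting
   cells of a grid, at some scale the contact points are dense in a square.  There
   V and W have matching slopes and second differences bounded on both sides;
   choosing the square so that a second difference of V is nearly extremal, the
   rescaled V is close to a limit that splits as in a Liouville theorem, so V is
   close to a quadratic polynomial, and paraboloids slid against V and W give
   jets with a common Hessian Y.  With T = Y / A the matrices
   A (T -+ 3/4 T^2 + 1/4 T^3) then satisfy the matrix inequality of (iii). *)

(** * Midpoint concavity and a Liouville theorem *)

(** The l1 norm in psi produces the signs. For y_1 > 0 the function (|y_1| + |y_2|)^2 / 2 has slope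
    N = |y_1| + |y_2| in y_1, whatever y_2 is, so g_1 is close to N, while |g_2| is at most about N
    and k_1(g_2) at most about al N < N. At the kink y_1 = 0 the tilted quadratic takes over and g_1
    - k_1(y_2) = M z_1 exactly. The penalty enters twice, as Psi(x - y) + Psi(y - z), one
    convolution for each function. The middle point y may leave the quadrant; the boundary sign is
    then read off the other penalty. A square dense with contact points gives only two-sided bounds
    on second differences, that is, C^{1,1} information. Extremality supplies the missing rigidity:
    a limit attaining the largest second difference at one scale attains it at all smaller ones, so
    that zooming in leaves an explicit polynomial plus an unknown function of the second variable
    alone, for which an extremal second difference is chosen once more. Counting can replace measure
    theory because separated slopes have separated contact points. *)

Section midconcave.
Variable R : realType.
Implicit Types f : R -> R.

Definition midconcave f := forall t s, f (t + s) + f (t - s) <= 2 * f t.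

(* If m is the infimum of f on [-1, 1], halving gives m >= m / 2 - e / 2. *)
Lemma midconcave_small f (B e : R) : midconcave f ->
  (forall t, -1 <= t <= 1 -> - B <= f t) ->
  f 0 = 0 -> - e <= f 1 -> - e <= f (-1) ->
  forall t, -1 <= t <= 1 -> - e <= f t <= e.
Proof.
move=> fc fB f0 f1 fm1.
have e0 : 0 <= e.
  by have := fc 0 1; rewrite f0 add0r sub0r mulr0 => h; lra.
suff lo t : -1 <= t <= 1 -> - e <= f t.
  move=> t tI; apply/andP; split; first exact: lo.
  have := fc 0 t; rewrite f0 add0r sub0r mulr0 => h.
  have := lo (- t); have : -1 <= - t <= 1 by lra.
  by move=> /[swap] /[apply]; lra.
pose m := inf [set f t | t in [set t | -1 <= t <= 1]].
have hi : has_inf [set f t | t in [set t : R | -1 <= t <= 1]].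
  split; first by exists (f 0), 0 => //=; lra.
  by exists (- B) => _ [s /fB + <-].
have mle s : -1 <= s <= 1 -> m <= f s.
  by move=> sI; apply: ge_inf; [exact: hi.2|exists s].
have half s : -1 <= s <= 1 -> m <= 0 -> (m - e) / 2 <= f s.
  move=> sI m0; have [s2|s2] := lerP s (-2^-1).
    have := fc s (s + 1); have := mle (s + (s + 1)); rewrite (_ : s - (s + 1) = -1); last by ring.
    by move=> /(_ ltac:(lra)); lra.
  have [s3|s3] := lerP s (2^-1).
    have := fc s s; have := mle (s + s); rewrite subrr f0.
    by move=> /(_ ltac:(lra)); lra.
  have := fc s (1 - s); have := mle (s - (1 - s)); rewrite (_ : s + (1 - s) = 1); last by ring.
  by move=> /(_ ltac:(lra)); lra.
have m0 : m <= 0 by rewrite -f0; apply: mle; lra.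
have : (m - e) / 2 <= m.
  by apply: lb_le_inf; [exact: hi.1|move=> _ [s /= sI <-]; exact: half].
move=> mm tI; have := mle _ tI; lra.
Qed.

(* delta s = f (t0 + s) + f (t0 - s) - 2 f t0 is nonpositive and satisfies
   delta (2 s) <= 2 delta s, so it vanishes once it is bounded below. *)
Lemma midconcave_bounded f (t0 B : R) : midconcave f ->
  (forall s, - B <= f (t0 + s) + f (t0 - s) - 2 * f t0) ->
  forall s, f (t0 + s) + f (t0 - s) = 2 * f t0.
Proof.
move=> fc fB s.
pose d s := f (t0 + s) + f (t0 - s) - 2 * f t0.
have d2 u : d (2 * u) <= 2 * d u.
  have := fc (t0 + u) u; have := fc (t0 - u) u.
  rewrite /d (_ : t0 + u + u = t0 + 2 * u); last by ring.
  rewrite (_ : t0 - u - u = t0 - 2 * u); last by ring.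
  rewrite (_ : t0 + u - u = t0); last by ring.
  rewrite (_ : t0 - u + u = t0); last by ring.
  lra.
have dn n : d (2 ^+ n * s) <= 2 ^+ n * d s.
  elim: n => [|n IH]; first by rewrite expr0 !mul1r.
  by rewrite exprS -!mulrA (le_trans (d2 _)) // ler_pM2l.
apply/eqP; rewrite eq_le fc /= -subr_ge0 -/(d s) leNgt; apply/negP => ds.
have [n] : exists n, B / (- d s) < 2 ^+ n.
  have /archi_boundP : 0 <= `|B / (- d s)| by [].
  set n := Num.bound _ => nB; exists n.
  apply: (le_lt_trans (ler_norm _)); apply: (lt_trans nB).
  by rewrite -natrX ltr_nat ltn_expl.
rewrite ltr_pdivrMr ?oppr_gt0// => nB.
by have := dn n; have := fB (2 ^+ n * s); rewrite -/(d _); lra.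
Qed.

(** After subtraction of the affine interpolant at [0] and [1], the remainder [g] is additive and
    vanishes at the integers. It is therefore periodic and bounded on the whole line, and a bounded
    additive function is zero. *)
Lemma midaffine_affine f (B : R) :
  (forall t s, f (t + s) + f (t - s) = 2 * f t) ->
  (forall t, -1 <= t <= 1 -> `|f t| <= B) ->
  forall t, f t = f 0 + t * (f 1 - f 0).
Proof.
move=> fa fB t.
pose g t := f t - f 0 - t * (f 1 - f 0).
have gm u : g (2 * u) = 2 * g u.
  have := fa u u; rewrite /g subrr (_ : u + u = 2 * u); last by ring.
  lra.
have gadd u w : g (u + w) = g u + g w.
  have := fa ((u + w) / 2) ((u - w) / 2).
  rewrite (_ : (u + w) / 2 + _ = u); last by field.
  rewrite (_ : (u + w) / 2 - _ = w); last by field.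
  have := gm ((u + w) / 2); rewrite (_ : 2 * _ = u + w); last by field.
  rewrite /g; lra.
have g1 : g 1 = 0 by rewrite /g; ring.
have g0 : g 0 = 0 by rewrite /g; ring.
have gN u : g (- u) = - g u by have := gadd u (- u); rewrite subrr g0; lra.
have gn (n : nat) : g n%:R = 0.
  by elim: n => [|n IH]; rewrite ?g0// -natr1 gadd IH g1 addr0.
have gz (n : int) : g n%:~R = 0.
  case: n => n; first by rewrite -pmulrn gn.
  by rewrite NegzE mulrNz -pmulrn gN gn oppr0.
have gB u : `|g u| <= 4 * B.
  rewrite (_ : u = (Num.floor u)%:~R + (u - (Num.floor u)%:~R)); last by ring.
  rewrite gadd gz add0r; set w := u - _.
  have w0 : 0 <= w by rewrite subr_ge0 floor_le_tmp.
  have w1 : w <= 1.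
    by rewrite lerBlDl; have := floorD1_gt u; rewrite intrD => /ltW.
  have := fB w ltac:(lra); have := fB 0 ltac:(lra); have := fB 1 ltac:(lra).
  rewrite /g !ler_norml; nra.
have gmul u (n : nat) : g (n%:R * u) = n%:R * g u.
  elim: n => [|n IH]; first by rewrite !mul0r g0.
  by rewrite -natr1 !mulrDl !mul1r gadd IH.
suff : g t = 0 by rewrite /g; lra.
apply/eqP; rewrite -normr_le0 leNgt; apply/negP => gt0.
have B0 : 0 <= B by apply: le_trans (fB 0 _); rewrite ?normr_ge0//; lra.
have /archi_boundP : 0 <= 4 * B / `|g t| by rewrite divr_ge0 ?mulr_ge0 ?ler0n// ltW.
set n := Num.bound _; rewrite ltr_pdivrMr// => nB.
by have := gB (n%:R * t); rewrite gmul normrM normr_nat; lra.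
Qed.
End midconcave.

Section liouville.
Variable R : realType.
Implicit Types T : R -> R -> R.

(** With [f b t = T t b - M / 2 * t ^+ 2], the axis condition makes [f 0] odd, and an odd midconcave
    function is midaffine. The bounds on differences in [b] spread this to the other lines: first
    each [f b] is affine, then so is its slope [be b] as a function of [b]. *)
Lemma liouville_quadratic T (M K : R) :
  (forall b, midconcave (fun t => T t b - M / 2 * t ^+ 2)) ->
  (forall t b s, - (K * s ^+ 2) <= T t (b + s) + T t (b - s) - 2 * T t b
                   <= K * s ^+ 2) ->
  (forall t b, `|T t b| <= K * (t ^+ 2 + b ^+ 2)) ->
  (forall s, T s 0 + T (- s) 0 = M * s ^+ 2) ->
  exists b0 b1, forall t b, T t b = M / 2 * t ^+ 2 + (b0 + b1 * b) * t + T 0 b.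
Proof.
move=> TC TS TB Tax.
have T0 : T 0 0 = 0.
  by apply/eqP; rewrite -normr_le0; have := TB 0 0; rewrite expr0n/=; lra.
pose f b t := T t b - M / 2 * t ^+ 2.
have f0 t0 s : f 0 (t0 + s) + f 0 (t0 - s) = 2 * f 0 t0.
  have odd t : f 0 (- t) = - f 0 t by have := Tax t; rewrite /f sqrrN; lra.
  apply/eqP; rewrite eq_le (TC 0 t0 s)/=.
  have := TC 0 (- t0) s; rewrite -!/(f _ _).
  rewrite (_ : - t0 + s = - (t0 - s)); last by ring.
  rewrite (_ : - t0 - s = - (t0 + s)); last by ring.
  by rewrite !odd; lra.
(* [f b + f (- b)] stays within [K * b ^+ 2] of [2 * f 0], whose second differences vanish. Both
   summands have nonpositive second differences, so neither of these can drop below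
   [- 4 * (K * b ^+ 2)]. *)
have fb b t0 s : f b (t0 + s) + f b (t0 - s) = 2 * f b t0.
  apply: (@midconcave_bounded _ _ t0 (4 * (K * b ^+ 2))) => [|u]; first exact: TC.
  have := TC (- b) t0 u; rewrite -!/(f _ _).
  have := TS (t0 + u) 0 b; have := TS (t0 - u) 0 b; have := TS t0 0 b.
  by have := f0 t0 u; rewrite /f !add0r; lra.
have K0 : 0 <= K.
  by have := TS 0 0 1; rewrite expr1n mulr1; lra.
have fa b : forall t, f b t = f b 0 + t * (f b 1 - f b 0).
  apply: (@midaffine_affine _ _ (K * (1 + b ^+ 2) + `|M|)) => // t t1.
  have t2 : t ^+ 2 <= 1 by nra.
  have := TB t b; have := sqr_ge0 t; rewrite /f => t20 H.
  apply: (le_trans (ler_normB _ _)); apply: lerD; first by nra.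
  rewrite normrM (ger0_norm t20) normrM (ger0_norm (_ : 0 <= 2^-1)) ?invr_ge0//.
  have := normr_ge0 M; nra.
pose be b := f b 1 - f b 0.
have be_mid b s : be (b + s) + be (b - s) = 2 * be b.
  set d := be (b + s) + be (b - s) - 2 * be b.
  suff : d = 0 by rewrite /d; lra.
  (* The second difference of [T t] in [b] grows like [t * d], yet it is bounded uniformly in
     [t]. *)
  have dt t : `|t * d| <= 2 * (K * s ^+ 2).
    have := TS t b s; have := TS 0 b s.
    have := fa (b + s) t; have := fa (b - s) t; have := fa b t.
    rewrite ler_norml /d /be /f expr0n/= => h1 h2 h3 h4 h5.
    have -> : t * (T 1 (b + s) - M / 2 * 1 ^+ 2 - (T 0 (b + s) - M / 2 * 0) +
     (T 1 (b - s) - M / 2 * 1 ^+ 2 - (T 0 (b - s) - M / 2 * 0)) -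
     2 * (T 1 b - M / 2 * 1 ^+ 2 - (T 0 b - M / 2 * 0))) =
     (T t (b + s) + T t (b - s) - 2 * T t b) - (T 0 (b + s) + T 0 (b - s) - 2 * T 0 b) by lra.
    lra.
  apply/eqP; rewrite -normr_le0 leNgt; apply/negP => d0.
  have := dt ((2 * (K * s ^+ 2) + 1) / d).
  by rewrite divfK -?normr_gt0// ler_norml; lra.
exists (be 0), (be 1 - be 0) => t b.
have -> : be 0 + (be 1 - be 0) * b = be b.
  rewrite (@midaffine_affine _ be (4 * (4 * K + `|M|)) _ _ b) ?[b * _]mulrC// => u u1.
  have u2 : u ^+ 2 <= 1 by nra.
  have := TB 1 u; have := TB 0 u; have := sqr_ge0 u.
  rewrite /be /f expr0n expr1n/= !ler_norml.
  have := ler_norm M; have := ler_norm (- M); rewrite normrN; nra.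
by have := fa b t; rewrite /be /f expr0n/=; lra.
Qed.

(** Take [x] and [s] whose normalized second difference is within [eta] of the supremum [m] over all
    points and scales. Subtracting the parabola with leading coefficient [m / 2] leaves a midconcave
    function that is almost nonnegative at the centre and both ends, so [midconcave_small]
    applies. *)
Lemma near_parabola (f : R -> R) (K eta : R) : 0 < eta ->
  (forall b s, - (K * s ^+ 2) <= f (b + s) + f (b - s) - 2 * f b <= K * s ^+ 2) ->
  (forall r : R, exists B : R, forall b, `|b| <= r -> - B <= f b) ->
  exists x s c p m, 0 < s /\
    forall b, `|b - x| <= s ->
      `|f b - (c + p * (b - x) + m / 2 * (b - x) ^+ 2)| <= eta * s ^+ 2.
Proof.
move=> eta0 f2 fB.
pose Q := [set (f (u.1 + u.2) + f (u.1 - u.2) - 2 * f u.1) / u.2 ^+ 2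
          | u in [set u : R * R | 0 < u.2]].
have Qsup : has_sup Q.
  split; first by eexists; exists (0, 1) => //=; rewrite ltr01.
  exists K => _ [[b s] /= s0 <-].
  by rewrite ler_pdivrMr ?exprn_gt0//; have := f2 b s; lra.
have [_ [[x s] /= s0 <-]] := sup_adherent eta0 Qsup.
set m := sup Q => xm.
have Qm b u : 0 < u -> f (b + u) + f (b - u) - 2 * f b <= m * u ^+ 2.
  move=> u01; rewrite -ler_pdivrMr ?exprn_gt0//.
  by apply: ub_le_sup; [exact: Qsup.2|exists (b, u)].
have {}Qm b u : f (b + u) + f (b - u) - 2 * f b <= m * u ^+ 2.
  have [u0|u0|->] := ltgtP u 0.
  - by have := Qm b (- u); rewrite oppr_gt0 opprK sqrrN => /(_ u0); lra.
  - exact: Qm.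
  - by rewrite addr0 subr0 expr0n/=; lra.
exists x, s, (f x), ((f (x + s) - f (x - s)) / (2 * s)), m; split; first by [].
have s20 : 0 < s ^+ 2 by rewrite exprn_gt0.
have s_neq0 : s != 0 by rewrite gt_eqF.
(* This slope makes [g 1 = g (-1)], so that near extremality, which controls only their sum, bounds
   each of them. *)
pose p := (f (x + s) - f (x - s)) / 2.
pose g u := f (x + s * u) - f x - u * p - m / 2 * (s * u) ^+ 2.
have gE : forall t, -1 <= t <= 1 -> - (eta * s ^+ 2) <= g t <= eta * s ^+ 2.
  have [B fB'] := fB (`|x| + s).
  have g1 : - (eta * s ^+ 2) <= f (x + s) + f (x - s) - 2 * f x - m * s ^+ 2.
    by move: xm; rewrite /= ltr_pdivlMr// => xm; lra.
  have h0 : 0 <= eta * s ^+ 2 by rewrite mulr_ge0 ?ltW.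
  apply: (@midconcave_small _ _ (B + `|f x| + `|p| + `|m / 2| * s ^+ 2)).
  - move=> t u; have := Qm (x + s * t) (s * u).
    rewrite /g (_ : x + s * t + s * u = x + s * (t + u)); last by ring.
    rewrite (_ : x + s * t - s * u = x + s * (t - u)); last by ring.
    by lra.
  - move=> t t1.
    have /fB' : `|x + s * t| <= `|x| + s.
      by apply: (le_trans (ler_normD _ _)); rewrite lerD2l normrM gtr0_norm// ler_piMr ?(ltW s0)// ler_norml.
    rewrite /g.
    have : `|t * p| <= `|p| by rewrite normrM ler_piMl// ler_norml.
    have : `|m / 2 * (s * t) ^+ 2| <= `|m / 2| * s ^+ 2.
      rewrite normrM; apply: ler_wpM2l => //; rewrite ger0_norm ?sqr_ge0// exprMn ler_piMr ?(ltW s20)//.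
      nra.
    rewrite !(ler_norml (m / 2 * _)) !(ler_norml (t * p)).
    by have := ler_norm (f x); lra.
  - by rewrite /g mulr0 addr0 expr0n/=; lra.
  - by rewrite /g /p mulr1; lra.
  - rewrite /g /p (_ : x + s * -1 = x - s); last by ring.
    rewrite (_ : (s * -1) ^+ 2 = s ^+ 2); last by ring.
    lra.
move=> b bs; have := gE ((b - x) / s).
rewrite /g (_ : s * ((b - x) / s) = b - x); last by field.
rewrite (_ : x + (b - x) = b); last by ring.
rewrite ler_norml.
have -> : (b - x) / s * p = (f (x + s) - f (x - s)) / (2 * s) * (b - x) by rewrite /p; field.
move: bs; rewrite ler_norml ler_pdivlMr// ler_pdivrMr// mulN1r mul1r => -> /(_ isT).
by lra.
Qed.
End liouville.

(** * Ultralimits *)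

Section ultralimits.
Variable R : realType.

(** An ultrafilter gives limits to all bounded sequences at once, so no subsequences have to be
    extracted. The limit is the supremum of the levels that [U]-almost all terms reach. *)
Lemma ultralimit (U : set_system nat) (u : nat -> R) (B : R) :
  UltraFilter U -> (forall n, `|u n| <= B) ->
  exists l : R, forall e : R, 0 < e -> U [set n | `|u n - l| <= e].
Proof.
move=> UU uB.
pose Q := [set x : R | U [set n | x <= u n]].
have Q0 : Q (- B).
  by rewrite /Q/=; apply: filterE => n; have := uB n; rewrite ler_norml => /andP[].
have QB x : Q x -> x <= B.
  move=> /filter_ex[n /= xn]; apply: (le_trans xn).
  by have := uB n; rewrite ler_norml => /andP[].
have hQ : has_sup Q by split; [exists (- B)|exists B => x /QB].
exists (sup Q) => e e0.
have [x Qx xe] := sup_adherent e0 hQ.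
have [Qe|] := in_ultra_setVsetC [set n | sup Q + e <= u n] UU.
  have : Q (sup Q + e) by [].
  by move=> /(ub_le_sup hQ.2); rewrite gerDl leNgt e0.
move=> H; apply: filterS2 Qx H => n /= xn /negP.
rewrite -ltNge => ue; rewrite ler_norml; lra.
Qed.

Lemma free_ultrafilter : exists U : set_system nat,
  UltraFilter U /\ forall N, U [set n | (N <= n)%N].
Proof.
have [U [UU sU]] := ultraFilterLemma eventually_filter.
by exists U; split=> // N; apply: sU; exact: nbhs_infty_ge.
Qed.

Definition lipschitz_on_boxes (T : R -> R -> R) (C : R -> R) := forall rho t b t' b',
  `|t| <= rho -> `|b| <= rho -> `|t'| <= rho -> `|b'| <= rho ->
  `|T t b - T t' b'| <= C rho * (`|t - t'| + `|b - b'|).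

Lemma grid_approx (rho d : R) : 0 < rho -> 0 < d -> exists m (p : 'I_m -> R),
  (forall i, `|p i| <= rho) /\ forall t, `|t| <= rho -> exists i, `|t - p i| <= d.
Proof.
move=> rho0 d0.
have /archi_boundP : 0 <= 2 * rho / d by rewrite divr_ge0 ?mulr_ge0 ?ltW.
set N := Num.bound _; rewrite ltr_pdivrMr// => Nd.
have N0 : (0 < N)%N by rewrite lt0n; apply/eqP => N0; move: Nd; rewrite N0 mul0r; lra.
have N0' : 0 < N%:R :> R by rewrite ltr0n.
pose h := 2 * rho / N%:R.
have h0 : 0 < h by rewrite divr_gt0 ?mulr_gt0.
have hN : N%:R * h = 2 * rho by rewrite /h mulrC divfK// gt_eqF.
have hd : h <= d by rewrite /h ler_pdivrMr// (mulrC d) ltW.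
exists N.+1, (fun i => - rho + i%:R * h); split=> [i|t t_rho].
  have iN : (i%:R : R) <= N%:R by rewrite ler_nat -ltnS.
  have i0 : 0 <= (i%:R : R) by [].
  by rewrite ler_norml; nra.
have t0 : 0 <= (t + rho) / h by rewrite divr_ge0 ?(ltW h0)//; move: t_rho; rewrite ler_norml; lra.
have /andP[k1 k2] := truncn_itv t0.
set k := Num.truncn _ in k1 k2.
have kN : (k < N.+1)%N.
  rewrite ltnS -(ler_nat R); apply: (le_trans k1).
  by rewrite ler_pdivrMr// hN; move: t_rho; rewrite ler_norml; lra.
exists (Ordinal kN) => /=.
move: k1 k2; rewrite ler_pdivlMr// ltr_pdivrMr// -natr1 ler_norml. move: (k%:R : R) => kr k1 k2; apply/andP; split. lra. lra.
Qed.

(** Arzela-Ascoli along an ultrafilter: pointwise limits inherit the common Lipschitz bounds, and a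
    finite grid turns pointwise convergence into uniform convergence on boxes. *)
Lemma ultralimit_fun (U : set_system nat) (T : nat -> R -> R -> R) (K : R) (C : R -> R) :
  UltraFilter U -> 
  (forall n t b, `|T n t b| <= K * (t ^+ 2 + b ^+ 2)) ->
  (forall n, lipschitz_on_boxes (T n) C) ->
  exists S : R -> R -> R,
    [/\ forall t b, `|S t b| <= K * (t ^+ 2 + b ^+ 2),
        lipschitz_on_boxes S C,
        forall t b (e : R), 0 < e -> U [set n | `|T n t b - S t b| <= e] &
        forall rho e : R, 0 < e -> U [set n | forall t b, `|t| <= rho -> `|b| <= rho ->
          `|T n t b - S t b| <= e]].
Proof.
move=> UU TK TC.
have /choice[S' S'P] : forall x : R * R, exists l, forall e : R, 0 < e ->
    U [set n | `|T n x.1 x.2 - l| <= e].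
  by move=> x; apply: ultralimit => n; exact: TK.
pose S t b := S' (t, b).
have SP t b (e : R) : 0 < e -> U [set n | `|T n t b - S t b| <= e] by move=> /(S'P (t, b)).
have SC : lipschitz_on_boxes S C.
  move=> rho t b t' b' h1 h2 h3 h4; apply/ler_addgt0Pl => e e0.
  have e2 : 0 < e / 2 by rewrite divr_gt0.
  have [n [/= n1 n2]] := filter_ex (filterI (SP t b _ e2) (SP t' b' _ e2)).
  have := TC n _ _ _ _ _ h1 h2 h3 h4.
  by move: n1 n2; rewrite !ler_norml; lra.
exists S; split=> //.
- move=> t b; apply/ler_addgt0Pl => e e0.
  have [n /= n1] := filter_ex (SP t b _ e0).
  by have := TK n t b; move: n1; rewrite !ler_norml; lra.
- move=> rho e e0; have [rho0|rho0] := ltP 0 rho; last first.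
    apply: filterS (SP 0 0 _ e0) => n /= h t b t0 b0.
    have /normr0_eq0 -> : `|t| = 0 by apply/eqP; rewrite eq_le normr_ge0 andbT (le_trans t0).
    by have /normr0_eq0 -> : `|b| = 0 by apply/eqP; rewrite eq_le normr_ge0 andbT (le_trans b0).
  pose c := `|C rho| + 1.
  have c0 : 0 < c by rewrite ltr_wpDl.
  have [m [p [pr pd]]] := grid_approx rho0 (divr_gt0 e0 (mulr_gt0 (ltr0n _ 8) c0)).
  have e2 : 0 < e / 2 by rewrite divr_gt0.
  have : U [set n | forall ij : 'I_m * 'I_m, `|T n (p ij.1) (p ij.2) - S (p ij.1) (p ij.2)| <= e / 2].
    by apply: filter_forall => -[i j]; exact: SP.
  apply: filterS => n /= H t b tr br.
  have [i ti] := pd t tr; have [j bj] := pd b br.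
  have := TC n _ _ _ _ _ tr br (pr i) (pr j).
  have := SC _ _ _ _ _ tr br (pr i) (pr j).
  have := H (i, j).
  have : C rho * (`|t - p i| + `|b - p j|) <= e / 4.
    apply: (@le_trans _ _ (c * (`|t - p i| + `|b - p j|))).
      by rewrite ler_wpM2r ?addr_ge0// /c; have := ler_norm (C rho); lra.
    rewrite (_ : e / 4 = c * (e / (8 * c) + e / (8 * c))); last by field; rewrite gt_eqF.
    by rewrite ler_pM2l// lerD.
  by rewrite /= !ler_norml; lra.
Qed.
End ultralimits.

(** * Blow-up limits with an extremal second difference *)

Section tangents.
Variable R : realType.

Lemma limit_le (U : set_system nat) (u : nat -> R) (l c : R) : UltraFilter U ->
  (forall e : R, 0 < e -> U [set n | `|u n - l| <= e]) ->
  (forall e : R, 0 < e -> U [set n | u n <= c + e]) -> l <= c.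
Proof.
move=> UU ul uc; apply/ler_addgt0Pl => e e0.
have e2 : 0 < e / 2 by rewrite divr_gt0.
have [n /= [+ n2]] := filter_ex (filterI (ul _ e2) (uc _ e2)).
by rewrite ler_norml; lra.
Qed.

Lemma limit_comb (U : set_system nat) (u v w : nat -> R) (lu lv lw : R) : UltraFilter U ->
  (forall e : R, 0 < e -> U [set n | `|u n - lu| <= e]) ->
  (forall e : R, 0 < e -> U [set n | `|v n - lv| <= e]) ->
  (forall e : R, 0 < e -> U [set n | `|w n - lw| <= e]) ->
  forall e : R, 0 < e -> U [set n | `|(u n + v n - 2 * w n) - (lu + lv - 2 * lw)| <= e].
Proof.
move=> UU ul vl wl e e0; have e4 : 0 < e / 4 by rewrite divr_gt0.
apply: filterS3 (ul _ e4) (vl _ e4) (wl _ e4) => n /=.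
by rewrite !ler_norml; lra.
Qed.

(* Blow-up: an ultralimit S of the T n attains the extremal second difference M
   at scale 1, hence at all scales s <= 1 by midconcavity; zooming in at 0 gives
   a limit Z attaining it at all scales, to which liouville_quadratic applies. *)
Lemma quadratic_tangent (T : nat -> R -> R -> R) (M K c : R) :
  (forall n t b, `|T n t b| <= K * (t ^+ 2 + b ^+ 2)) ->
  (forall n, lipschitz_on_boxes (T n) (fun rho => c * rho)) ->
  (forall n t b s, - (K * s ^+ 2) <= T n t (b + s) + T n t (b - s) - 2 * T n t b) ->
  (forall t b s e : R, 0 < e -> exists N : nat, forall n : nat, (N <= n)%N ->
    T n t (b + s) + T n t (b - s) - 2 * T n t b <= K * s ^+ 2 + e) ->
  (forall t b s e : R, 0 < e -> exists N : nat, forall n : nat, (N <= n)%N ->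
    T n (t + s) b + T n (t - s) b - 2 * T n t b <= M * s ^+ 2 + e) ->
  (forall e : R, 0 < e -> exists N : nat, forall n : nat, (N <= n)%N ->
    M - e <= T n 1 0 + T n (-1) 0) ->
  forall eta : R, 0 < eta -> exists x s c0 p1 p2 y11 y12 y22 : R, 0 < s /\
    forall N : nat, exists n : nat, (N <= n)%N /\ forall t b : R, `|t| <= s -> `|b - x| <= s ->
      `|T n t b - (c0 + p1 * t + p2 * (b - x) + (y11 * t ^+ 2 + 2 * y12 * t * (b - x)
         + y22 * (b - x) ^+ 2) / 2)| <= eta * s ^+ 2.
Proof.
move=> TK TC Tlo Thi TM TM1 eta eta0.
have [U [UU Ufree]] := free_ultrafilter.
have ev (P : nat -> Prop) : (exists N, forall n, (N <= n)%N -> P n) -> U [set n | P n].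
  by move=> [N NP]; apply: filterS (Ufree N) => n /=; exact: NP.
have [S [SK SC Spt Sbox]] := ultralimit_fun UU TK TC.
have S00 : S 0 0 = 0.
  by apply/eqP; rewrite -normr_le0; have := SK 0 0; rewrite expr0n/= addr0 mulr0.
have S2 t b s : - (K * s ^+ 2) <= S t (b + s) + S t (b - s) - 2 * S t b <= K * s ^+ 2.
  have l := limit_comb UU (Spt t (b + s)) (Spt t (b - s)) (Spt t b).
  apply/andP; split; last by apply: (limit_le UU l) => e /(Thi t b s)/ev.
  rewrite lerNl; apply: (@limit_le U (fun n => - (T n t (b + s) + T n t (b - s) - 2 * T n t b))) => e e0.
    by apply: filterS (l _ e0) => n /=; rewrite -opprD normrN.
  by apply: filterE => n /=; have := Tlo n t b s; lra.
have SM t b s : S (t + s) b + S (t - s) b - 2 * S t b <= M * s ^+ 2.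
  have l := limit_comb UU (Spt (t + s) b) (Spt (t - s) b) (Spt t b).
  by apply: (limit_le UU l) => e /(TM t b s)/ev.
have S1 : S 1 0 + S (-1) 0 = M.
  apply/eqP; rewrite eq_le; apply/andP; split.
    by have := SM 0 0 1; rewrite add0r sub0r S00 expr1n; lra.
  have l := limit_comb UU (Spt 1 0) (Spt (-1) 0) (Spt 0 0).
  rewrite -lerN2; apply: (@limit_le U (fun n => - (T n 1 0 + T n (-1) 0 - 2 * T n 0 0))) => e e0.
    by apply: filterS (l _ e0) => n /=; rewrite S00 !ler_norml; lra.
  apply: filterS (ev _ (TM1 _ e0)) => n /=.
  by have := TK n 0 0; rewrite expr0n/= addr0 mulr0 normr_le0 => /eqP ->; lra.
have mc (Z : R -> R -> R) : (forall t b s, Z (t + s) b + Z (t - s) b - 2 * Z t b <= M * s ^+ 2) ->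
    forall b, midconcave (fun t => Z t b - M / 2 * t ^+ 2).
  by move=> ZM b t s; have := ZM t b s; lra.
have Sax s : 0 <= s <= 1 -> S s 0 + S (- s) 0 = M * s ^+ 2.
  move=> s01; pose f t := S t 0 + S (- t) 0 - M * t ^+ 2.
  have fmc : midconcave f.
    move=> t u; have := SM t 0 u; have := SM (- t) 0 u; rewrite /f.
    rewrite (_ : - t + u = - (t - u)); last by ring.
    rewrite (_ : - t - u = - (t + u)); last by ring.
    by lra.
  (* The conclusion of [midconcave_small] for [e = 0]: the zeros of [f] at [-1], [0] and [1] force
     it to vanish in between. *)
  suff : - 0 <= f s <= 0 by rewrite oppr0 -eq_le eq_sym /f => /eqP; lra.
  apply: (@midconcave_small _ _ (2 * `|K| + `|M|)) => //.
  - move=> t t1; have t2 : t ^+ 2 <= 1 by nra.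
    have t0 := sqr_ge0 t.
    have := SK t 0; have := SK (- t) 0; rewrite sqrrN expr0n/= addr0 /f !ler_norml.
    have : K * t ^+ 2 <= `|K|.
      by apply: (le_trans (ler_norm _)); rewrite normrM (ger0_norm t0) ler_piMr.
    have : M * t ^+ 2 <= `|M|.
      by apply: (le_trans (ler_norm _)); rewrite normrM (ger0_norm t0) ler_piMr.
    by lra.
  - by rewrite /f oppr0 S00 expr0n/=; lra.
  - by rewrite /f expr1n; lra.
  - by rewrite /f opprK sqrrN expr1n; lra.
  - by lra.
pose h j : R := 2^-1 ^+ j.
have h0 j : 0 < h j by rewrite exprn_gt0.
have h_neq0 j : h j != 0 by rewrite gt_eqF.
pose Z' j t b := S (h j * t) (h j * b) / h j ^+ 2.
have Z'K j t b : `|Z' j t b| <= K * (t ^+ 2 + b ^+ 2).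
  rewrite normrM normfV (ger0_norm (sqr_ge0 (h j))) ler_pdivrMr ?exprn_gt0//.
  by apply: (le_trans (SK _ _)); rewrite !exprMn; lra.
have Z'C j : lipschitz_on_boxes (Z' j) (fun rho => c * rho).
  move=> rho t b t' b' h1 h2 h3 h4.
  have hb x : `|x| <= rho -> `|h j * x| <= h j * rho.
    by move=> ?; rewrite normrM (gtr0_norm (h0 j)) ler_pM2l.
  rewrite -mulrBl normrM normfV (ger0_norm (sqr_ge0 (h j))) ler_pdivrMr ?exprn_gt0//.
  apply: (le_trans (SC _ _ _ _ _ (hb _ h1) (hb _ h2) (hb _ h3) (hb _ h4))).
  by rewrite -!mulrBr !normrM (gtr0_norm (h0 j)); lra.
have [Z [ZK ZC Zpt Zbox]] := ultralimit_fun UU Z'K Z'C.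
have sc j x y : h j * (x + y) = h j * x + h j * y by rewrite mulrDr.
have sd j x y : h j * (x - y) = h j * x - h j * y by rewrite mulrBr.
have h20 j : 0 < h j ^+ 2 by rewrite exprn_gt0.
have comb j (x y z : R) : x / h j ^+ 2 + y / h j ^+ 2 - 2 * (z / h j ^+ 2) = (x + y - 2 * z) / h j ^+ 2.
  by field.
have Z2 t b s : - (K * s ^+ 2) <= Z t (b + s) + Z t (b - s) - 2 * Z t b <= K * s ^+ 2.
  have l := limit_comb UU (Zpt t (b + s)) (Zpt t (b - s)) (Zpt t b).
  have H j : - (K * s ^+ 2) <= Z' j t (b + s) + Z' j t (b - s) - 2 * Z' j t b <= K * s ^+ 2.
    rewrite /Z' comb ler_pdivlMr// ler_pdivrMr// sc sd.
    by have := S2 (h j * t) (h j * b) (h j * s); rewrite exprMn; lra.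
  apply/andP; split; last by apply: (limit_le UU l) => e e0; apply: filterE => n /=; have := H n; lra.
  rewrite lerNl; apply: (@limit_le U (fun n => - (Z' n t (b + s) + Z' n t (b - s) - 2 * Z' n t b))) => e e0.
    by apply: filterS (l _ e0) => n /=; rewrite -opprD normrN.
  by apply: filterE => n /=; have := H n; lra.
have ZM t b s : Z (t + s) b + Z (t - s) b - 2 * Z t b <= M * s ^+ 2.
  have l := limit_comb UU (Zpt (t + s) b) (Zpt (t - s) b) (Zpt t b).
  apply: (limit_le UU l) => e e0; apply: filterE => j /=.
  rewrite /Z' comb sc sd; apply: (@le_trans _ _ (M * s ^+ 2)); last by lra.
  rewrite ler_pdivrMr//; apply: (le_trans (SM _ _ _)); rewrite exprMn; lra.
have Zax s : Z s 0 + Z (- s) 0 = M * s ^+ 2.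
  have Z00 : Z 0 0 = 0.
    by apply/eqP; rewrite -normr_le0; have := ZK 0 0; rewrite expr0n/= addr0 mulr0.
  wlog s0 : s / 0 <= s.
    move=> H; have [|s0] := leP 0 s; first exact: H.
    by have := H (- s); rewrite opprK sqrrN addrC; apply; lra.
  apply/eqP; rewrite eq_le; apply/andP; split.
    by have := ZM 0 0 s; rewrite add0r sub0r Z00; lra.
  have l := limit_comb UU (Zpt s 0) (Zpt (- s) 0) (Zpt 0 0).
  rewrite -lerN2; apply: (@limit_le U (fun n => - (Z' n s 0 + Z' n (- s) 0 - 2 * Z' n 0 0))) => e e0.
    by apply: filterS (l _ e0) => n /=; rewrite Z00 !ler_norml; lra.
  have [J Js] : exists J, forall j, (J <= j)%N -> h j * s <= 1.
    have /archi_boundP s1 := s0; exists (Num.bound s) => j sj.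
    rewrite /h exprVn mulrC ler_pdivrMr ?exprn_gt0// mul1r.
    apply: (le_trans (ltW s1)); rewrite -natrX ler_nat.
    by rewrite (leq_trans sj)// ltnW// ltn_expl.
  apply: filterS (Ufree J) => j /= /Js hs.
  have : 0 <= h j * s <= 1 by rewrite hs andbT mulr_ge0 ?(ltW (h0 j)).
  move=> /Sax; rewrite /Z' mulrN !mulr0 S00 mul0r mulr0 subr0 -mulrDl => ->.
  by rewrite exprMn mulrCA mulrAC divff ?gt_eqF// mul1r; lra.
have [b0 [b1 Zq]] := liouville_quadratic (mc _ ZM) Z2 ZK Zax.
have [||x [s [c1 [p [m [s0 Zx]]]]]] := @near_parabola _ (Z 0) K (eta / 4) _ (Z2 0).
- by rewrite divr_gt0.
- move=> r; exists (`|K| * r ^+ 2) => b br.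
  have := ZK 0 b; rewrite expr0n/= add0r ler_norml => /andP[+ _]; apply: le_trans.
  rewrite lerN2.
  have : b ^+ 2 <= r ^+ 2 by rewrite -(real_normK (num_real b)) ler_pXn2r// nnegrE (le_trans _ br).
  have := ler_norm K; have := sqr_ge0 b; have := normr_ge0 K; nra.
have s20 : 0 < s ^+ 2 by rewrite exprn_gt0.
pose rho := `|x| + s.
have rho0 : 0 < rho by rewrite ltr_wpDl.
(* Three errors of relative size [eta / 4] are added: [Z 0] against its parabola, the zoomed [S]
   against [Z], and [T n] against [S]. *)
have e1 : 0 < eta / 4 * s ^+ 2 by rewrite mulr_gt0 ?divr_gt0.
have [j /= Zj] := filter_ex (Zbox rho _ e1).
have e2 : 0 < eta / 4 * s ^+ 2 * h j ^+ 2 by rewrite mulr_gt0.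
exists (h j * x), (h j * s), (h j ^+ 2 * c1), (h j * (b0 + b1 * x)), (h j * p), M, b1, m.
split; first by rewrite mulr_gt0.
move=> N; have [n /= [Tn Nn]] := filter_ex (filterI (Sbox (h j * rho) _ e2) (Ufree N)).
exists n; split=> // t b ts bs.
have [t' t't] : exists t', t = h j * t' by exists (t / h j); field.
have [b' b'b] : exists b', b = h j * b' by exists (b / h j); field.
subst t b.
move: ts bs; rewrite -mulrBr !normrM (gtr0_norm (h0 j)) !ler_pM2l// => ts bs.
have tr : `|t'| <= rho by rewrite (le_trans ts)// lerDr.
have br : `|b'| <= rho.
  by rewrite -(subrK x b') addrC (le_trans (ler_normD _ _))// lerD2l.
have := Tn (h j * t') (h j * b').
rewrite !normrM (gtr0_norm (h0 j)) !ler_pM2l// => /(_ tr br).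
have := Zj _ _ tr br; have := Zx _ bs; rewrite /Z'.
set X := S _ _; set Y := T _ _ _; set D := Z 0 b' - _ => hD hX hY.
have {}hX : `|X - h j ^+ 2 * Z t' b'| <= h j ^+ 2 * (eta / 4 * s ^+ 2).
  rewrite (_ : X - _ = h j ^+ 2 * (X / h j ^+ 2 - Z t' b')); last by field.
  by rewrite normrM (gtr0_norm (h20 j)) ler_pM2l.
have {}hD : `|h j ^+ 2 * D| <= h j ^+ 2 * (eta / 4 * s ^+ 2).
  by rewrite normrM (gtr0_norm (h20 j)) ler_pM2l.
rewrite (_ : _ - _ = (Y - X) + (X - h j ^+ 2 * Z t' b') + h j ^+ 2 * D); last first.
  by rewrite /D (Zq t' b'); field.
apply: (le_trans (ler_normD _ _)); have := ler_normD (Y - X) (X - h j ^+ 2 * Z t' b').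
by rewrite exprMn; have := mulr_gt0 (h20 j) e1; lra.
Qed.
End tangents.

(** * Contact points of sliding paraboloids *)

Section counting.
Variable R : realType.

Definition cell (N k : nat) (x : R) : nat := Num.truncn (x * N%:R ^+ k).

Lemma cell_itv N k x : (0 < N)%N -> 0 <= x ->
  (cell N k x)%:R <= x * N%:R ^+ k < (cell N k x).+1%:R.
Proof. by move=> N0 x0; apply: truncn_itv; rewrite mulr_ge0 ?exprn_ge0. Qed.

Lemma cell_divn N k x : (0 < N)%N -> 0 <= x -> cell N k x = (cell N k.+1 x %/ N)%N.
Proof.
move=> N0 x0; have /andP[a1 a2] := cell_itv k N0 x0.
have /andP[b1 b2] := cell_itv k.+1 N0 x0.
have NR : 0 < N%:R :> R by rewrite ltr0n.
apply/eqP; rewrite eq_sym eqn_leq leq_divRL// -ltnS ltn_divLR//.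
rewrite -!(ltr_nat R) -!(ler_nat R) !natrM; apply/andP; split.
  by apply: (le_lt_trans b1); rewrite exprSr mulrA ltr_pM2r.
have : (cell N k x)%:R * N%:R < (cell N k.+1 x).+1%:R :> R.
  by apply: le_lt_trans b2; rewrite exprSr mulrA ler_pM2r.
by rewrite -natrM ltr_nat ltnS => h; rewrite ?natrM -?natrM ?ler_nat.
Qed.

(** An occupied cell has [N ^ 2] children, at least one of them empty, so from one level to the next
    the number of occupied cells grows by a factor of at most [N ^ 2 - 1]. At level [m] this number
    is the cardinal of [T]. *)
Lemma no_full_cell_count (N m : nat) (T : finType) (X Y : T -> R) : (0 < N)%N ->
  (forall t, 0 <= X t < 1) -> (forall t, 0 <= Y t < 1) ->
  (forall k t, (k < m)%N -> exists i j, [/\ (i < N)%N, (j < N)%N & forall t',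
     ~ (cell N k.+1 (X t') = N * cell N k (X t) + i /\
        cell N k.+1 (Y t') = N * cell N k (Y t) + j)%N]) ->
  (forall t t', cell N m (X t) = cell N m (X t') -> cell N m (Y t) = cell N m (Y t') -> t = t') ->
  (#|T| <= (N ^ 2 - 1) ^ m)%N.
Proof.
move=> N0 X01 Y01 nofull inj.
pose c k t := (cell N k (X t), cell N k (Y t)).
pose A k := undup [seq c k t | t <- enum T].
have memA k t : c k t \in A k by rewrite mem_undup map_f// mem_enum.
have Am : size (A m) = #|T|.
  rewrite /A undup_id; first by rewrite size_map cardE.
  by rewrite map_inj_in_uniq ?enum_uniq// => t t' _ _ [/inj h /h].
rewrite -Am; have : (m <= m)%N by [].
elim: {-2}m => [_|k IH km].
  have c0 x : 0 <= x < 1 -> cell N 0 x = 0%N.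
    move=> /andP[x0 x1]; apply/eqP; rewrite -leqn0 -ltnS -(ltr_nat R).
    by have /andP[h _] := cell_itv 0 N0 x0; apply: (le_lt_trans h); rewrite mulr1.
  rewrite expn0 (@uniq_leq_size _ (A 0%N) [:: (0, 0)%N]) ?undup_uniq// => a.
  by rewrite mem_undup => /mapP[t _ ->]; rewrite /c !c0// inE.
pose ch (a : nat * nat) := [seq (N * a.1 + ij.1, N * a.2 + ij.2)%N |
   ij <- [seq (i, j) | i <- iota 0 N, j <- iota 0 N]].
pose chA a := [seq b <- ch a | b \in A k.+1].
have sub : {subset A k.+1 <= flatten [seq chA a | a <- A k]}.
  move=> b bA; move: (bA); rewrite mem_undup => /mapP[t _ bt].
  apply/flattenP; exists (chA (c k t)); first by rewrite map_f.
  rewrite mem_filter bA; apply/mapP.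
  have [X0 _] := andP (X01 t); have [Y0 _] := andP (Y01 t).
  exists (cell N k.+1 (X t) %% N, cell N k.+1 (Y t) %% N)%N.
    by apply: allpairs_f; rewrite mem_iota ltn_pmod.
  by rewrite bt /c/= (cell_divn k N0 X0) (cell_divn k N0 Y0) mulnC -divn_eq mulnC -divn_eq.
have chlt a : a \in A k -> (size (chA a) <= N ^ 2 - 1)%N.
  rewrite mem_undup => /mapP[t _ ->].
  have [i [j [iN jN ij]]] := nofull k t km.
  have sch : size (ch (c k t)) = (N ^ 2)%N by rewrite size_map size_allpairs size_iota mulnn.
  rewrite leq_subRL ?expn_gt0 ?N0// -sch -(count_predC (mem (A k.+1)) (ch _)) size_filter.
  rewrite addnC leq_add2l -has_count; apply/hasP.
  exists (N * cell N k (X t) + i, N * cell N k (Y t) + j)%N.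
    by apply/mapP; exists (i, j) => //; apply: allpairs_f; rewrite mem_iota.
  rewrite /= mem_undup; apply/negP => /mapP[t' _ [e1 e2]].
  by apply: (ij t'); split.
apply: (leq_trans (uniq_leq_size (undup_uniq _) sub)).
rewrite size_flatten expnS; apply: (@leq_trans ((N ^ 2 - 1) * size (A k))).
  rewrite /shape sumnE !big_map.
  apply: (@leq_trans (\sum_(a <- A k) (N ^ 2 - 1))).
    by rewrite [leqLHS]big_seq [leqRHS]big_seq; apply: leq_sum => a /chlt.
  by rewrite big_const_seq count_predT iter_addn addn0.
by rewrite leq_mul2l IH ?orbT// ltnW.
Qed.

(* The number of cells would be at most (N^2 - 1)^m if none were full, which is
   eventually smaller than c^2 N^(2 m). *)
Lemma geometric_small (N : nat) (c : R) : (0 < N)%N -> 0 < c -> exists m : nat,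
  ((N ^ 2 - 1) ^ m)%N%:R < c * (N%:R ^+ m) ^+ 2.
Proof.
move=> N0 c0.
have N20 : 0 < (N%:R : R) ^+ 2 by rewrite exprn_gt0 ?ltr0n.
pose z : R := (N ^ 2 - 1)%N%:R / N%:R ^+ 2.
have z0 : 0 <= z by rewrite divr_ge0// ltW.
have z1 : z < 1.
  by rewrite ltr_pdivrMr// mul1r -natrX ltr_nat ltn_subrL expn_gt0 N0.
have zc : z ^+ n @[n --> \oo] --> (0 : R) by apply: cvg_expr; rewrite ger0_norm.
have [m _ mc] := cvgr0_norm_lt _ zc c c0.
exists m; have := mc m (leqnn m).
rewrite /= ger0_norm ?exprn_ge0// /z expr_div_n ltr_pdivrMr ?exprn_gt0 ?ltr0n//.
by rewrite -exprM mulnC exprM natrX.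
Qed.
End counting.

(** * Maxima on boxes and semiconvex functions *)

Section semiconvex.
Variable R : realType.
Implicit Types f V W : R -> R -> R.

(** Without a maximum, every point has a neighbourhood in the box on which [f] lies below some value
    of [f]. The upper level sets generate a filter, and compactness, used as near covering for it,
    yields one point of the box whose value exceeds every value on the box, its own included. *)
Lemma box_max f (a b c d : R) : a <= b -> c <= d ->
  (forall x1 x2 m, a <= x1 <= b -> c <= x2 <= d -> f x1 x2 < m -> exists2 r : R, 0 < r &
     forall y1 y2, a <= y1 <= b -> c <= y2 <= d -> `|y1 - x1| < r -> `|y2 - x2| < r ->
       f y1 y2 < m) ->
  exists x1 x2, [/\ a <= x1 <= b, c <= x2 <= d &
    forall y1 y2, a <= y1 <= b -> c <= y2 <= d -> f y1 y2 <= f x1 x2].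
Proof.
move=> ab cd fusc.
pose B := `[a, b] `*` `[c, d].
have cB : compact B by apply: compact_setX; exact: segment_compact.
have B_ (x : R * R) : B x <-> a <= x.1 <= b /\ c <= x.2 <= d by rewrite /B/= !in_itv.
apply: contrapT => nomax.
have big (x : R * R) : B x -> exists y : R * R, B y /\ f x.1 x.2 < f y.1 y.2.
  move=> /B_[x1 x2]; apply: contrapT => nbig; apply: nomax; exists x.1, x.2; split=> // y1 y2 h1 h2.
  by rewrite leNgt; apply/negP => h; apply: nbig; exists (y1, y2); split=> //; exact/B_.
have B0 : B (a, c) by apply/B_ => /=; rewrite !lexx ab cd.
pose F : set_system (R * R) := [set S | exists2 x : R * R, B x &
  forall y : R * R, B y -> f x.1 x.2 <= f y.1 y.2 -> S y].
have FF : Filter F.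
  split; first by exists (a, c).
  - move=> S S' [x Bx xS] [y By yS'].
    have [xy|yx] := leP (f x.1 x.2) (f y.1 y.2).
      by exists y => // z Bz yz; split; [apply: xS => //; exact: le_trans yz|exact: yS'].
    by exists x => // z Bz xz; split; [exact: xS|apply: yS' => //; apply: le_trans xz; exact: ltW].
  - by move=> S S' SS' [x Bx xS]; exists x => // y By xy; apply/SS'/xS.
have [|z Bz /(_ z Bz (lexx _) z Bz Bz)] := (@compact_near_coveringP _ B).1 cB _ F (fun y x => B x -> f x.1 x.2 < f y.1 y.2) FF.
  move=> x Bx; have [y [By xy]] := big x Bx.
  have [x1 x2] := (B_ x).1 Bx; have [r r0 Hr] := fusc _ _ _ x1 x2 xy.
  exists (ball x r, [set z | B z /\ f y.1 y.2 <= f z.1 z.2]).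
    by split => /=; [exact: nbhsx_ballx|exists y].
  move=> [u z] /= [[xu1 xu2] [Bz yz]] /B_[u1 u2]; apply: lt_le_trans yz.
  by apply: Hr => //; rewrite distrC.
by rewrite ltxx.
Qed.

(** Equivalent to convexity of V + K |.|^2. The form with supporting paraboloids hands over the
    slopes that the contact arguments compare. *)
Definition semiconvex (K : R) V := forall x1 x2, exists p1 p2, forall y1 y2,
  V x1 x2 + p1 * (y1 - x1) + p2 * (y2 - x2) - K * ((y1 - x1) ^+ 2 + (y2 - x2) ^+ 2) <= V y1 y2.

Lemma semiconvex_continuous (K : R) V x1 x2 (e : R) : 0 <= K -> semiconvex K V -> 0 < e ->
  exists2 r, 0 < r & forall y1 y2, `|y1 - x1| < r -> `|y2 - x2| < r ->
    `|V y1 y2 - V x1 x2| < e.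
Proof.
move=> K0 VK e0.
have [p1 [p2 px]] := VK x1 x2.
pose B := `|V (x1 + 1) x2| + `|V (x1 - 1) x2| + `|V x1 (x2 + 1)| + `|V x1 (x2 - 1)|.
have [B1 B2] : V (x1 + 1) x2 <= B /\ V (x1 - 1) x2 <= B.
  have := ler_norm (V (x1 + 1) x2); have := ler_norm (V (x1 - 1) x2).
  have := normr_ge0 (V (x1 + 1) x2); have := normr_ge0 (V (x1 - 1) x2).
  by rewrite /B; have := normr_ge0 (V x1 (x2 + 1)); have := normr_ge0 (V x1 (x2 - 1)); split; lra.
have [B3 B4] : V x1 (x2 + 1) <= B /\ V x1 (x2 - 1) <= B.
  have := ler_norm (V x1 (x2 + 1)); have := ler_norm (V x1 (x2 - 1)).
  have := normr_ge0 (V (x1 + 1) x2); have := normr_ge0 (V (x1 - 1) x2).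
  by rewrite /B; have := normr_ge0 (V x1 (x2 + 1)); have := normr_ge0 (V x1 (x2 - 1)); split; lra.
pose P := `|p1| + `|p2|.
have P0 : 0 <= P by rewrite addr_ge0.
have B0 : 0 <= B by rewrite !addr_ge0.
have bnd (q d m : R) : `|d| <= m -> - (`|q| * m) <= q * d <= `|q| * m.
  by move=> dm; rewrite -ler_norml normrM ler_wpM2l.
pose A := B + `|V x1 x2| + P + 5 * K.
have AE : A = B + `|V x1 x2| + P + 5 * K by [].
have A0 : 0 <= A by rewrite !addr_ge0// mulr_ge0.
pose L := 4 * A + P + 2 * K + 1.
have L0 : 0 < L by rewrite /L; lra.
exists (Num.min 4^-1 (e / L)) => [|y1 y2]; first by rewrite lt_min divr_gt0// invr_gt0 ltr0n.
rewrite !lt_min => /andP[d1 e1] /andP[d2 e2].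
pose d := Num.max `|y1 - x1| `|y2 - x2|.
have [m1 m2] : `|y1 - x1| <= d /\ `|y2 - x2| <= d by rewrite /d !le_max !lexx orbT.
have d4 : d < 4^-1 by rewrite gt_max d1 d2.
have : d < e / L by rewrite gt_max e1 e2.
rewrite ltr_pdivlMr// => dL.
have d0 : 0 <= d by apply: le_trans m1.
have d40 : 0 <= 4^-1 :> R by rewrite invr_ge0.
have sq u : `|u| <= d -> 0 <= u ^+ 2 <= d / 4.
  move=> ud; rewrite sqr_ge0 -(real_normK (num_real u)) expr2/=.
  by apply: (le_trans (ler_pM _ _ ud ud)) => //; rewrite ler_wpM2l// ltW.
have sK u1 u2 : `|u1| <= d -> `|u2| <= d -> K * (u1 ^+ 2 + u2 ^+ 2) <= K * (d / 2).
  move=> /sq/andP[_ h1] /sq/andP[_ h2]; apply: ler_wpM2l => //; move: h1 h2; clear; lra.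
have lo : V x1 x2 - P * d - K * (d / 2) <= V y1 y2.
  have := px y1 y2; have := bnd p1 _ _ m1; have := bnd p2 _ _ m2; have := sK _ _ m1 m2.
  by rewrite /P; clear; lra.
have [q1 [q2 qy]] := VK y1 y2.
have [n1 n2] : `|x1 - y1| <= d /\ `|x2 - y2| <= d by rewrite ![`|_ - y1|]distrC ![`|_ - y2|]distrC.
have [q1d q2d] : `|q1| * d <= `|q1| / 4 /\ `|q2| * d <= `|q2| / 4 by split; rewrite ler_wpM2l// ltW.
have Kd : K * (d / 2) <= K by rewrite ler_piMr//; move: d4; clear; lra.
have Vy : - `|V x1 x2| - P - K <= V y1 y2.
  have Pd : P * d <= P by rewrite ler_piMr//; move: d4; clear; lra.
  by have := ler_norm (- V x1 x2); rewrite normrN; move: lo Pd Kd; clear; lra.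
have step (u1 u2 s1 s2 : R) : `|u1| <= d -> `|u2| <= d -> `|s1| + `|s2| <= 1 ->
    K * ((u1 + s1) ^+ 2 + (u2 + s2) ^+ 2) <= 4 * K.
  move=> h1 h2 s12; rewrite mulrC; apply: ler_wpM2r => //.
  have le2 (u s : R) : `|u| <= d -> `|s| <= 1 -> (u + s) ^+ 2 <= 2.
    move=> hu hs; apply: (@le_trans _ _ ((5 / 4) ^+ 2)); last by clear; lra.
    rewrite -(real_normK (num_real (u + s))) ler_pXn2r// ?nnegrE//.
    by apply: (le_trans (ler_normD _ _)); move: hu hs d4; clear; lra.
  have := le2 u1 s1 h1; have := le2 u2 s2 h2; move: s12 (normr_ge0 s1) (normr_ge0 s2); clear; lra.
(* The paraboloid supporting [V] at [y] is tested at the four points at distance 1 from [x] along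
   the axes. As [y] is within 1/4 of [x], the offset costs a quarter of the slopes, which is
   absorbed when the bounds on [q1] and [q2] are added. *)
have qbnd (q s1 s2 : R) : q = q1 * s1 + q2 * s2 -> `|s1| + `|s2| <= 1 ->
    V (x1 + s1) (x2 + s2) <= B -> q <= A + (`|q1| + `|q2|) / 4.
  move=> -> s12 VB; have := qy (x1 + s1) (x2 + s2).
  rewrite [x1 + _ - y1]addrAC [x2 + _ - y2]addrAC AE.
  have := bnd q1 _ _ n1; have := bnd q2 _ _ n2; have := step _ _ _ _ n1 n2 s12.
  by move: q1d q2d Vy VB; clear; lra.
have Q4A : `|q1| + `|q2| <= 4 * A.
  have h1 : `|q1| <= A + (`|q1| + `|q2|) / 4.
    rewrite ler_norml lerNl; apply/andP; split.
      by apply: (@qbnd _ (-1) 0); rewrite ?addr0 ?normrN ?normr1 ?normr0 ?addr0//; ring.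
    by apply: (@qbnd _ 1 0); rewrite ?addr0 ?normr1 ?normr0 ?addr0//; ring.
  have h2 : `|q2| <= A + (`|q1| + `|q2|) / 4.
    rewrite ler_norml lerNl; apply/andP; split.
      by apply: (@qbnd _ 0 (-1)); rewrite ?addr0 ?normrN ?normr1 ?normr0 ?add0r//; ring.
    by apply: (@qbnd _ 0 1); rewrite ?addr0 ?normr1 ?normr0 ?add0r//; ring.
  by move: h1 h2; clear; lra.
have Qd : (`|q1| + `|q2|) * d <= 4 * A * d by rewrite ler_wpM2r.
have hi : V y1 y2 <= V x1 x2 + 4 * A * d + K * (d / 2).
  have := qy x1 x2; have := bnd q1 _ _ n1; have := bnd q2 _ _ n2; have := sK _ _ n1 n2.
  by move: Qd; clear; lra.
have PKA : 0 <= P * d /\ 0 <= A * d /\ 0 <= K * d by rewrite !mulr_ge0.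
by rewrite ltr_norml; rewrite /L in dL; move: lo hi dL d0 PKA; clear; lra.
Qed.
End semiconvex.

Section contact.
Variables (R : realType) (V W : R -> R -> R) (K kap z1 z2 : R).
Hypotheses (K0 : 0 < K) (VK : semiconvex K V) (WK : semiconvex K (fun x y => - W x y)).
Hypothesis kap0 : 0 < kap.
Hypothesis zmax : forall y1 y2, V y1 y2 - W y1 y2 <=
  V z1 z2 - W z1 z2 - kap * ((y1 - z1) ^+ 2 + (y2 - z2) ^+ 2).

(** The touching functions are affine: the paraboloid of the classical argument sits in the strict
    maximum assumed at [z], which is later produced by adding a square to [W]. *)
Definition contact (q1 q2 e1 e2 : R) := forall y1 y2,
  V y1 y2 - W y1 y2 <= V e1 e2 - W e1 e2 + q1 * (y1 - e1) + q2 * (y2 - e2).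

Definition contact_set (q0 e1 e2 : R) :=
  exists q1 q2, [/\ `|q1| <= q0, `|q2| <= q0 & contact q1 q2 e1 e2].

Lemma contact_set_le q0 q0' e1 e2 : q0 <= q0' -> contact_set q0 e1 e2 -> contact_set q0' e1 e2.
Proof.
by move=> h [q1 [q2 [a b c]]]; exists q1, q2; split=> //; exact: le_trans h.
Qed.

Lemma strict_max_near (q0 q1 q2 y1 y2 : R) : `|q1| <= q0 -> `|q2| <= q0 ->
  V z1 z2 - W z1 z2 <= V y1 y2 - W y1 y2 + q1 * (z1 - y1) + q2 * (z2 - y2) ->
  `|y1 - z1| <= 2 * q0 / kap /\ `|y2 - z2| <= 2 * q0 / kap.
Proof.
move=> q1q q2q H.
have q00 : 0 <= q0 by apply: le_trans q1q.
have {}H : kap * (`|y1 - z1| ^+ 2 + `|y2 - z2| ^+ 2) <= q0 * (`|y1 - z1| + `|y2 - z2|).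
  rewrite !real_normK ?num_real//.
  have b (q d : R) : `|q| <= q0 -> - (q0 * `|d|) <= q * d.
    by move=> qq; rewrite lerNl (le_trans (ler_norm _))// normrN normrM ler_wpM2r.
  by have := zmax y1 y2; have := b _ (y1 - z1) q1q; have := b _ (y2 - z2) q2q; lra.
suff key (u v : R) : 0 <= u -> 0 <= v -> kap * (u ^+ 2 + v ^+ 2) <= q0 * (u + v) -> u * kap <= 2 * q0.
  rewrite !ler_pdivlMr//; split; first exact: (key _ `|y2 - z2|).
  by apply: (key _ `|y1 - z1|) => //; rewrite addrC [_ + `|y1 - z1|]addrC.
move=> u0 v0 {}H; rewrite leNgt; apply/negP => h.
have {}u0 : 0 < u.
  by rewrite lt_neqAle u0 andbT; apply/eqP => u00; move: h; rewrite -u00 mul0r; lra.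
have [uv|vu] := leP u v.
  have hv : 2 * q0 < kap * v by apply: (lt_le_trans h); rewrite mulrC ler_pM2l.
  have v1 : 0 < v by apply: lt_le_trans uv.
  have : 2 * q0 * v < kap * v * v by rewrite ltr_pM2r.
  have := sqr_ge0 u; have : q0 * u <= q0 * v by rewrite ler_wpM2l.
  nra.
have : 2 * q0 * u < u * kap * u by rewrite ltr_pM2r.
have := sqr_ge0 v; have : q0 * v <= q0 * u by rewrite ler_wpM2l// ltW.
nra.
Qed.

Lemma contact_near (q0 q1 q2 e1 e2 : R) : `|q1| <= q0 -> `|q2| <= q0 -> contact q1 q2 e1 e2 ->
  `|e1 - z1| <= 2 * q0 / kap /\ `|e2 - z2| <= 2 * q0 / kap.
Proof. by move=> q1q q2q /(_ z1 z2) H; apply: strict_max_near H. Qed.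

Lemma contact_exists (q0 q1 q2 : R) : `|q1| <= q0 -> `|q2| <= q0 ->
  exists e1 e2, contact q1 q2 e1 e2.
Proof.
move=> q1q q2q.
have q00 : 0 <= q0 by apply: le_trans q1q.
pose rho := 2 * q0 / kap + 1.
have rho0 : 0 < rho by rewrite ltr_wpDl// divr_ge0 ?mulr_ge0// ltW.
pose f y1 y2 := V y1 y2 - W y1 y2 - q1 * y1 - q2 * y2.
have box (z y : R) : z - rho <= y <= z + rho <-> `|y - z| <= rho by rewrite ler_norml; split; lra.
have [|||e1 [e2 [e1r e2r emax]]] := @box_max _ f (z1 - rho) (z1 + rho) (z2 - rho) (z2 + rho).
- by lra.
- by lra.
- move=> x1 x2 m _ _ fm.
  pose d := (m - f x1 x2) / 4.
  have d0 : 0 < d by rewrite divr_gt0// subr_gt0.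
  have [r r0 Vr] := semiconvex_continuous x1 x2 (ltW K0) VK d0.
  have [s s0 Ws] := semiconvex_continuous x1 x2 (ltW K0) WK d0.
  pose c := q0 + 1.
  have c0 : 0 < c by rewrite /c; lra.
  exists (Num.min (Num.min r s) (d / c)) => [|y1 y2 _ _]; first by rewrite !lt_min r0 s0 divr_gt0.
  rewrite !lt_min => /andP[/andP[a1 a2] a3] /andP[/andP[b1 b2] b3].
  have := Vr _ _ a1 b1; have := Ws _ _ a2 b2.
  have qd (q u : R) : `|q| <= q0 -> `|u| < d / c -> `|q * u| <= d.
    rewrite ltr_pdivlMr// normrM => qq ud.
    have := normr_ge0 q; have := normr_ge0 u; rewrite /c in ud; nra.
  have := qd _ _ q1q a3; have := qd _ _ q2q b3.
  by rewrite !ler_norml !ltr_norml /f; rewrite /d /f; lra.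
exists e1, e2 => y1 y2.
suff : f y1 y2 <= f e1 e2 by rewrite /f; lra.
have [/andP[h1 h2]|] := boolP ((`|y1 - z1| <= rho) && (`|y2 - z2| <= rho)).
  by apply: emax; exact/box.
have zbox (z : R) : `|z - z| <= rho by rewrite subrr normr0 ltW.
have := emax z1 z2 ((box _ _).2 (zbox _)) ((box _ _).2 (zbox _)).
move=> ze; apply: contraNT; rewrite -ltNge => ey.
have [] := @strict_max_near q0 q1 q2 y1 y2 q1q q2q.
  by move: ze ey; rewrite /f; lra.
by rewrite /rho => h1 h2; apply/andP; split; lra.
Qed.

(** If [p] and [r] support [V] and [- W] at [e], then [V - W] lies above a paraboloid of slope
    [p + r] and below a plane of slope [q], with equality at [e]. Hence [r = q - p]. *)
Lemma contact_slopes q1 q2 e1 e2 : contact q1 q2 e1 e2 -> exists p1 p2, forall y1 y2,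
  V e1 e2 + p1 * (y1 - e1) + p2 * (y2 - e2) - K * ((y1 - e1) ^+ 2 + (y2 - e2) ^+ 2) <= V y1 y2
  /\ - W e1 e2 + (q1 - p1) * (y1 - e1) + (q2 - p2) * (y2 - e2)
      - K * ((y1 - e1) ^+ 2 + (y2 - e2) ^+ 2) <= - W y1 y2.
Proof.
move=> ce; have [p1 [p2 pV]] := VK e1 e2; have [r1 [r2 rW]] := WK e1 e2.
have small (c : R) : (forall s, c * s <= 2 * K * s ^+ 2) -> c = 0.
  move=> h; have := h (c / (4 * K)).
  have -> : 2 * K * (c / (4 * K)) ^+ 2 = c * (c / (4 * K)) / 2 by field; rewrite gt_eqF.
  have cc : c * (c / (4 * K)) = c ^+ 2 / (4 * K) by rewrite expr2 mulrA.
  rewrite cc => h'; have : c ^+ 2 / (4 * K) <= 0 by lra.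
  rewrite ler_pdivrMr ?mulr_gt0// mul0r => h2.
  by apply/eqP; rewrite -sqrf_eq0 eq_le h2 sqr_ge0.
have E1 : p1 + r1 - q1 = 0.
  apply: small => s; have := pV (e1 + s) e2; have := rW (e1 + s) e2; have := ce (e1 + s) e2.
  by rewrite (_ : e1 + s - e1 = s); [lra|ring].
have E2 : p2 + r2 - q2 = 0.
  apply: small => s; have := pV e1 (e2 + s); have := rW e1 (e2 + s); have := ce e1 (e2 + s).
  by rewrite (_ : e2 + s - e2 = s); [lra|ring].
exists p1, p2 => y1 y2; split; first exact: pV.
by rewrite (_ : q1 - p1 = r1) 1?(_ : q2 - p2 = r2); [exact: rW|lra|lra].
Qed.

(** The bound from above comes from [W]: contact puts [V] below [W] plus an affine function, and
    semiconvexity of [- W] puts [W] below a paraboloid. *)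
Lemma contact_pinched q1 q2 e1 e2 : contact q1 q2 e1 e2 -> exists p1 p2, forall y1 y2,
  `|V y1 y2 - V e1 e2 - p1 * (y1 - e1) - p2 * (y2 - e2)| <=
     K * ((y1 - e1) ^+ 2 + (y2 - e2) ^+ 2).
Proof.
move=> ce; have [p1 [p2 p]] := contact_slopes ce; exists p1, p2 => y1 y2.
by have [h1 h2] := p y1 y2; have := ce y1 y2; rewrite ler_norml; lra.
Qed.

(** Discrete substitute for the area formula in Jensen's lemma. Combining both contacts gives (q -
    q').(y - e') <= 2 K |y - e|^2, tested at distance [d] from [e'] along each axis; there |y - e|^2
    is at most 4 d^2 + d^2, whence the factor 10. *)
Lemma contact_lipschitz (q1 q2 e1 e2 q1' q2' e1' e2' d : R) :
  contact q1 q2 e1 e2 -> contact q1' q2' e1' e2' ->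
  `|e1 - e1'| <= d -> `|e2 - e2'| <= d -> 0 < d ->
  `|q1 - q1'| <= 10 * K * d /\ `|q2 - q2'| <= 10 * K * d.
Proof.
move=> ce ce' d1 d2 d0.
have [p1 [p2 p]] := contact_slopes ce.
have H y1 y2 : (q1 - q1') * (y1 - e1') + (q2 - q2') * (y2 - e2') <=
    2 * K * ((y1 - e1) ^+ 2 + (y2 - e2) ^+ 2).
  by have [h1 h2] := p y1 y2; have := ce' y1 y2; have := ce e1' e2'; lra.
have sq u : `|u| <= d -> u ^+ 2 <= d ^+ 2 by rewrite ler_norml => ud; nra.
have sq2 u w : `|u| <= d -> `|w| <= d -> (w - u) ^+ 2 <= 4 * d ^+ 2.
  by rewrite !ler_norml => ud wd; nra.
have key (c : R) : c * d <= 10 * K * d ^+ 2 -> - c * d <= 10 * K * d ^+ 2 -> `|c| <= 10 * K * d.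
  by move=> h1 h2; rewrite ler_norml; apply/andP; split; rewrite -(ler_pM2r d0); lra.
have dd : `|d| <= d by rewrite gtr0_norm.
have dN : `|- d| <= d by rewrite normrN gtr0_norm.
split; apply: key.
- have := H (e1' + d) e2'; have := ler_wpM2l (ltW K0) (sq2 _ _ d1 dd).
  by have := ler_wpM2l (ltW K0) (sq _ d2); lra.
- have := H (e1' - d) e2'; have := ler_wpM2l (ltW K0) (sq2 _ _ d1 dN).
  by have := ler_wpM2l (ltW K0) (sq _ d2); lra.
- have := H e1' (e2' + d); have := ler_wpM2l (ltW K0) (sq2 _ _ d2 dd).
  by have := ler_wpM2l (ltW K0) (sq _ d1); lra.
- have := H e1' (e2' - d); have := ler_wpM2l (ltW K0) (sq2 _ _ d2 dN).
  by have := ler_wpM2l (ltW K0) (sq _ d1); lra.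
Qed.
End contact.

Section dense.
Variable R : realType.

Lemma subcell_near (N k c : nat) (u : R) : (0 < N)%N -> c%:R <= u < c%:R + 1 ->
  exists2 i, (i < N)%N & forall x : R, 0 <= x -> cell N k.+1 x = (N * c + i)%N ->
    `|x * N%:R ^+ k - u| <= N%:R^-1.
Proof.
move=> N0 /andP[cu uc].
have NR : 0 < N%:R :> R by rewrite ltr0n.
have a0 : 0 <= (u - c%:R) * N%:R by rewrite mulr_ge0 ?subr_ge0.
have /andP[i1 i2] := truncn_itv a0; set i := Num.truncn _ in i1 i2.
exists i => [|x x0 xi].
  rewrite -(ltr_nat R); apply: (le_lt_trans i1).
  by rewrite -[ltRHS]mul1r ltr_pM2r//; lra.
have /andP[] := cell_itv k.+1 N0 x0; rewrite xi -natr1 natrD natrM exprSr mulrA.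
rewrite -natr1 in i2; move=> x1 x2.
by rewrite ler_norml; apply/andP; split; rewrite -(ler_pM2r NR) ?mulNr mulVf ?gt_eqF//; lra.
Qed.

Variables (V W : R -> R -> R) (K kap z1 z2 : R).
Hypotheses (K0 : 0 < K) (VK : semiconvex K V) (WK : semiconvex K (fun x y => - W x y)).
Hypothesis kap0 : 0 < kap.
Hypothesis zmax : forall y1 y2, V y1 y2 - W y1 y2 <=
  V z1 z2 - W z1 z2 - kap * ((y1 - z1) ^+ 2 + (y2 - z2) ^+ 2).

(* A lattice of slopes q yields about (kap / K)^2 N^(2 m) contact points lying in
   distinct N-adic cells of level m, so some cell has all its N^2 children hit. *)
Lemma dense_contacts (q0 nu : R) : 0 < q0 -> 1 <= nu -> exists e1 e2 r : R,
  [/\ contact_set V W q0 e1 e2, 0 < r, r * nu <= 1 &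
   forall y1 y2, `|y1 - e1| <= nu * r -> `|y2 - e2| <= nu * r ->
     exists e1' e2', [/\ contact_set V W q0 e1' e2', `|e1' - y1| <= r / nu & `|e2' - y2| <= r / nu]].
Proof.
move=> q00 nu1.
have nu0 : 0 < nu by apply: lt_le_trans nu1.
(* Contacts with slopes of size at most [q] lie within [2 * q / kap] of [z] in each coordinate, so a
   square of side [S = 5 * q / kap] contains them all; the second bound on [q] gives
   [S * nu <= 1]. *)
pose q := Num.min q0 (kap / (5 * nu)).
have q_gt0 : 0 < q by rewrite lt_min q00 divr_gt0// mulr_gt0.
have qq0 : q <= q0 by rewrite ge_min lexx.
pose S := 5 * q / kap.
have S0 : 0 < S by rewrite divr_gt0// mulr_gt0.
have SqE : S * kap = 5 * q by rewrite divfK// gt_eqF.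
have S1 : S * nu <= 1.
  have : q <= kap / (5 * nu) by rewrite ge_min lexx orbT.
  rewrite ler_pdivlMr ?mulr_gt0// => h.
  by rewrite -(ler_pM2r kap0) mulrAC SqE; lra.
have [N [N0 N8]] : exists N : nat, (0 < N)%N /\ 8 * nu ^+ 2 <= N%:R.
  have /archi_boundP h : 0 <= 8 * nu ^+ 2 by rewrite mulr_ge0 ?sqr_ge0.
  exists (Num.bound (8 * nu ^+ 2)); split; last exact: ltW.
  rewrite -(ltr_nat R); apply: le_lt_trans h; by rewrite mulr_ge0 ?sqr_ge0.
have NR : 0 < N%:R :> R by rewrite ltr0n.
(* Two contacts in one cell of level [m] have slopes within 10 K S / N^m of each other. With this
   [c] that is half the mesh [sg], so distinct lattice slopes occupy distinct cells. *)
pose c := kap / (100 * K).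
have c0 : 0 < c by rewrite divr_gt0// mulr_gt0.
have [m mc] := geometric_small N0 (exprn_gt0 2 c0).
pose sg := q / (c * N%:R ^+ m).
have Nm0 : 0 < N%:R ^+ m :> R by rewrite exprn_gt0.
have cN0 : 0 < c * N%:R ^+ m by exact: mulr_gt0.
have sg0 : 0 < sg by rewrite divr_gt0.
pose J := (Num.truncn (c * N%:R ^+ m)).+1.
have /andP[J1 J2] : J.-1%:R <= c * N%:R ^+ m < J%:R.
  by apply: truncn_itv; rewrite mulr_ge0// ltW.
have lat (a : 'I_J) : `|a%:R * sg| <= q.
  have sga : 0 <= a%:R * sg by rewrite mulr_ge0// ltW.
  rewrite (ger0_norm sga); apply: (@le_trans _ _ (J.-1%:R * sg)).
    by rewrite ler_pM2r// ler_nat -ltnS.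
  rewrite /sg mulrCA -[leRHS]mulr1 ler_pM2l//.
  by rewrite ler_pdivrMr// mul1r.
have /choice[e eP] : forall t : 'I_J * 'I_J, exists e : R * R,
    contact V W (t.1%:R * sg) (t.2%:R * sg) e.1 e.2.
  move=> t; have [e1 [e2 H]] := contact_exists K0 VK WK kap0 zmax (lat t.1) (lat t.2).
  by exists (e1, e2).
have eE t : contact_set V W q0 (e t).1 (e t).2.
  by apply: (contact_set_le qq0); exists (t.1%:R * sg), (t.2%:R * sg); split; [exact: lat|exact: lat|exact: eP].
pose X t := ((e t).1 - z1) / S + 2^-1.
pose Y t := ((e t).2 - z2) / S + 2^-1.
have near t : 0 <= X t < 1 /\ 0 <= Y t < 1.
  have [] := contact_near kap0 zmax (lat t.1) (lat t.2) (eP t).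
  have h (w : R) : `|w| <= 2 * q / kap -> 0 <= w / S + 2^-1 < 1.
    rewrite ler_pdivlMr// => wq.
    have : `|w / S| <= 2 / 5.
      rewrite normrM normfV (gtr0_norm S0) ler_pdivrMr//.
      by rewrite -(ler_pM2r kap0); lra.
    by rewrite ler_norml; lra.
  by move=> /h ? /h.
pose full := exists k t, forall i j, (i < N)%N -> (j < N)%N -> exists t',
   (cell N k.+1 (X t') = N * cell N k (X t) + i /\ cell N k.+1 (Y t') = N * cell N k (Y t) + j)%N.
have [|nofull] := pselect full; last first.
  exfalso.
  have : (#|{: 'I_J * 'I_J}| <= (N ^ 2 - 1) ^ m)%N.
    apply: (@no_full_cell_count R _ _ _ X Y) => //.
    - by move=> t; case: (near t).
    - by move=> t; case: (near t).
    - move=> k t km; apply: contrapT => nij; apply: nofull; exists k, t => i j iN jN.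
      apply: contrapT => nt; apply: nij; exists i, j; split=> // t' ht'.
      by apply: nt; exists t'.
    - move=> t t' Xt Yt.
      have cl (x y : R) : 0 <= x -> 0 <= y -> cell N m x = cell N m y -> `|x - y| * N%:R ^+ m <= 1.
        move=> x0 y0 xy; have /andP[] := cell_itv m N0 x0; have /andP[] := cell_itv m N0 y0.
        rewrite -xy -natr1 => h1 h2 h3 h4; rewrite -(gtr0_norm Nm0) -normrM ler_norml; lra.
      have [/andP[x0 _] /andP[y0 _]] := near t; have [/andP[x0' _] /andP[y0' _]] := near t'.
      have {Xt}:= cl _ _ x0 x0' Xt; have {Yt} := cl _ _ y0 y0' Yt.
      pose d := S / N%:R ^+ m.
      have d0 : 0 < d by rewrite divr_gt0.
      have ed (u v : R) : `|(u / S + 2^-1) - (v / S + 2^-1)| * N%:R ^+ m <= 1 -> `|u - v| <= d.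
        rewrite (_ : _ - (_ + _) = (u - v) / S); last by clear -K0 VK WK kap0 zmax; lra.
        rewrite normrM normfV (gtr0_norm S0) /d ler_pdivlMr// mulrAC ler_pdivrMr//.
        by rewrite mul1r.
      move=> /ed; rewrite opprB addrA subrK => d2 /ed; rewrite opprB addrA subrK => d1.
      have [] := contact_lipschitz K0 VK WK (eP t) (eP t') d1 d2 d0.
      have dsg : 10 * K * d < sg.
        rewrite /sg ltr_pdivlMr// /d (_ : 10 * K * (S / N%:R ^+ m) * (c * N%:R ^+ m) = q / 2); last first.
          by rewrite /c /S; field; rewrite !gt_eqF.
        by lra.
      have key (a b : 'I_J) : `|a%:R * sg - b%:R * sg| <= 10 * K * d -> a = b.
        move=> h; have {}h : `|a%:R - b%:R| < 1 :> R.
          rewrite -(ltr_pM2r sg0) mul1r; apply: le_lt_trans dsg.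
          by rewrite -{1}(gtr0_norm sg0) -normrM mulrBl.
        apply/val_inj/eqP => /=; move: h; rewrite ltr_norml eqn_leq => /andP[h1 h2].
        apply/andP; split; rewrite -ltnS -(ltr_nat R) -natr1; move: h1 h2; clear -K0 VK WK kap0 zmax; lra.
      by move=> /key E1 /key E2; rewrite (surjective_pairing t) (surjective_pairing t') E1 E2.
  rewrite card_prod card_ord => cardJ.
  have : J%:R ^+ 2 <= (((N ^ 2 - 1) ^ m)%N%:R : R) by rewrite expr2 -natrM ler_nat.
  rewrite leNgt => /negP; apply; apply: (lt_trans mc).
  by rewrite -exprMn ltr_pXn2r// nnegrE// ltW.
move=> [k [t Hfull]].
pose l := S / N%:R ^+ k.
have l0 : 0 < l by rewrite divr_gt0 ?exprn_gt0.
pose c1 := cell N k (X t); pose c2 := cell N k (Y t).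
pose P z (u : R) := z + l * u - S / 2.
have near_pt u1 u2 : c1%:R <= u1 < c1%:R + 1 -> c2%:R <= u2 < c2%:R + 1 ->
    exists e1 e2, [/\ contact_set V W q0 e1 e2, `|e1 - P z1 u1| <= l / N%:R & `|e2 - P z2 u2| <= l / N%:R].
  move=> /(subcell_near k N0)[i iN Hi] /(subcell_near k N0)[j jN Hj].
  have [t' [t1 t2]] := Hfull i j iN jN.
  have [/andP[x0 _] /andP[y0 _]] := near t'.
  exists (e t').1, (e t').2; split; first exact: eE.
  - have := Hi _ x0 t1; rewrite -(ler_pM2l l0) => h.
    rewrite (_ : (e t').1 - P z1 u1 = l * (X t' * N%:R ^+ k - u1)); first by rewrite normrM (gtr0_norm l0).
    by rewrite /P /X /l; field; rewrite !gt_eqF ?exprn_gt0.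
  - have := Hj _ y0 t2; rewrite -(ler_pM2l l0) => h.
    rewrite (_ : (e t').2 - P z2 u2 = l * (Y t' * N%:R ^+ k - u2)); first by rewrite normrM (gtr0_norm l0).
    by rewrite /P /Y /l; field; rewrite !gt_eqF ?exprn_gt0.
have lN : l / N%:R <= l / 8 / nu ^+ 2.
  by rewrite -mulrA ler_pM2l// -invfM lef_pV2 ?posrE ?mulr_gt0 ?exprn_gt0.
have nu21 : 1 <= nu ^+ 2 by rewrite exprn_ege1.
have lN8 : l / N%:R <= l / 8.
  by apply: (le_trans lN); rewrite ler_pdivrMr ?exprn_gt0// ler_peMr// divr_ge0// ltW.
have [||e1 [e2 [eC e1c e2c]]] := near_pt (c1%:R + 2^-1) (c2%:R + 2^-1).
- by clear -K0 VK WK kap0 zmax; lra.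
- by clear -K0 VK WK kap0 zmax; lra.
(* [nu * r] is a quarter of the side [l] of the full cell and the contact is within [l / 8] of its
   centre, so the square considered stays inside the cell. Each of its points has a contact within
   [l / N], at most [r / nu] since [N] is at least [8 * nu ^+ 2]. *)
pose r := l / (4 * nu).
have nur : nu * r = l / 4 by rewrite /r; field; rewrite gt_eqF.
have lS : l <= S.
  by rewrite /l ler_pdivrMr ?exprn_gt0// -{1}(mulr1 S) ler_pM2l// exprn_ege1// ler1n.
exists e1, e2, r; split=> //.
- by rewrite divr_gt0// mulr_gt0.
- by rewrite mulrC nur; nra.
rewrite nur => y1 y2 y1e y2e.
have inP (z y e' : R) (cc : nat) : `|y - e'| <= l / 4 -> `|e' - P z (cc%:R + 2^-1)| <= l / N%:R ->
    exists2 u, cc%:R <= u < cc%:R + 1 & y = P z u.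
  move=> ye' e'P; exists ((y - z + S / 2) / l); last by rewrite /P; field; rewrite gt_eqF.
  rewrite ler_pdivlMr// ltr_pdivrMr//.
  move: ye' e'P lN8 l0; rewrite /P !ler_norml; clear -K0 VK WK kap0 zmax; lra.
have [u1 u1c ->] := inP _ _ _ _ y1e e1c; have [u2 u2c ->] := inP _ _ _ _ y2e e2c.
have [e1' [e2' [? h1 h2]]] := near_pt _ _ u1c u2c.
have lr : l / N%:R <= r / nu.
  apply: (le_trans lN); rewrite /r (_ : l / (4 * nu) / nu = 2 * (l / 8 / nu ^+ 2)); last by field; rewrite gt_eqF.
  have : 0 < l / 8 / nu ^+ 2 by apply: divr_gt0; [exact: divr_gt0|exact: exprn_gt0].
  by clear -K0 VK WK kap0 zmax; lra.
by exists e1', e2'; split=> //; exact: le_trans lr.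
Qed.
End dense.

(** * Approximate jets at a maximum *)

Section rescaling_bounds.
Variable R : realType.

Lemma norm_sum_bounds (t b u1 u2 t' b' rho : R) : rho = `|t| + `|b| + `|u1| + `|u2| + 1 ->
  `|t'| <= `|t| + 1 -> `|b'| <= `|b| + 1 ->
  [/\ 0 < rho,
      [/\ `|t + u1| <= rho, `|b + u2| <= rho, `|t' + u1| <= rho & `|b' + u2| <= rho],
      [/\ `|t - u1| <= rho, `|b - u2| <= rho, `|t' - u1| <= rho & `|b' - u2| <= rho] &
      [/\ `|t| <= rho, `|b| <= rho, `|t'| <= rho & `|b'| <= rho]].
Proof.
have := normr_ge0 t; have := normr_ge0 b; have := normr_ge0 u1; have := normr_ge0 u2.
move=> u20 u10 b0 t0 -> td bd.
by split; [|split|split|split]; try lra;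
  apply: (le_trans (ler_normD _ _)); rewrite ?normrN; lra.
Qed.

Lemma small_ratio (K rho eps nu : R) : 0 < eps -> 0 < nu -> 80 * K * rho / eps <= nu ->
  10 * K * rho * ((1 + 1) / nu) <= eps / 4.
Proof. by move=> e0 n0; rewrite ler_pdivrMr// mulrA ler_pdivrMr//; lra. Qed.
End rescaling_bounds.

Section near_quadratic.
Variable R : realType.

(** Testing a supporting paraboloid one step [rho] away along each axis bounds its slopes by 8 K
    rho, as 5 + 2 + 1 = 8; its quadratic part adds the remaining 2 K rho. *)
Lemma semiconvex_lipschitz (K : R) (T : R -> R -> R) : semiconvex K T ->
  (forall t b, `|T t b| <= K * (t ^+ 2 + b ^+ 2)) ->
  lipschitz_on_boxes T (fun rho => 10 * K * rho).
Proof.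
move=> TK TB.
have K0 : 0 <= K.
  by have := TB 1 0; have := normr_ge0 (T 1 0); rewrite expr1n expr0n/= addr0 mulr1; lra.
suff half (rho t b t' b' : R) : `|t| <= rho -> `|b| <= rho -> `|t'| <= rho -> `|b'| <= rho -> 0 < rho ->
    T t b - T t' b' <= 10 * K * rho * (`|t - t'| + `|b - b'|).
  move=> rho t b t' b' h1 h2 h3 h4; have [rho0|rho0] := ltP 0 rho.
    rewrite ler_norml; have := half _ _ _ _ _ h1 h2 h3 h4 rho0.
    by have := half _ _ _ _ _ h3 h4 h1 h2 rho0; rewrite (distrC t') (distrC b'); lra.
  have z (u : R) : `|u| <= rho -> u = 0.
    by move=> ur; apply/normr0_eq0/eqP; rewrite eq_le normr_ge0 andbT (le_trans ur).
  by rewrite (z _ h1) (z _ h2) (z _ h3) (z _ h4) !subrr normr0 addr0 mulr0.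
move=> h1 h2 h3 h4 rho0.
have [p1 [p2 p]] := TK t b.
have sq (u : R) : `|u| <= rho -> 0 <= u ^+ 2 <= rho ^+ 2.
  by rewrite ler_norml sqr_ge0/= => ur; nra.
have sq2 (u : R) : `|u| <= rho -> (u + rho) ^+ 2 <= 4 * rho ^+ 2 /\ (u - rho) ^+ 2 <= 4 * rho ^+ 2.
  by rewrite ler_norml => ur; split; nra.
have up (u v m : R) : u ^+ 2 + v ^+ 2 <= m -> - (K * m) <= T u v <= K * m.
  by rewrite -ler_norml => h; apply: (le_trans (TB _ _)); rewrite ler_wpM2l.
have s1 := sq _ h1; have s2 := sq _ h2; have [s3 s4] := sq2 _ h1; have [s5 s6] := sq2 _ h2.
have /andP[Tlo _] := up t b (2 * rho ^+ 2) ltac:(lra).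
have /andP[_ T1] := up (t + rho) b (5 * rho ^+ 2) ltac:(lra).
have /andP[_ T2] := up (t - rho) b (5 * rho ^+ 2) ltac:(lra).
have /andP[_ T3] := up t (b + rho) (5 * rho ^+ 2) ltac:(lra).
have /andP[_ T4] := up t (b - rho) (5 * rho ^+ 2) ltac:(lra).
have P1 : `|p1| <= 8 * K * rho.
  have := p (t + rho) b; have := p (t - rho) b; rewrite subrr ![t + _ - t]addrAC subrr !add0r.
  by move=> h5 h6; rewrite ler_norml; apply/andP; split; rewrite -(ler_pM2r rho0); move: h5 h6 Tlo T1 T2; clear; lra.
have P2 : `|p2| <= 8 * K * rho.
  have := p t (b + rho); have := p t (b - rho); rewrite subrr ![b + _ - b]addrAC subrr !add0r.
  by move=> h5 h6; rewrite ler_norml; apply/andP; split; rewrite -(ler_pM2r rho0); move: h5 h6 Tlo T3 T4; clear; lra.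
have := p t' b'.
have b1 (q d : R) : `|q| <= 8 * K * rho -> - (8 * K * rho * `|d|) <= q * d.
  by move=> h; rewrite lerNl (le_trans (ler_norm _))// normrN normrM ler_wpM2r.
have := b1 _ (t' - t) P1; have := b1 _ (b' - b) P2.
have b2 (u w : R) : `|u| <= rho -> `|w| <= rho -> K * (u - w) ^+ 2 <= 2 * K * rho * `|u - w|.
  move=> ur wr; rewrite -(real_normK (num_real (u - w))).
  have : `|u - w| <= 2 * rho by rewrite (le_trans (ler_normB _ _))//; move: ur wr; clear; lra.
  move=> h; have := ler_wpM2r (normr_ge0 (u - w)) h; rewrite -expr2 => /(ler_wpM2l K0); clear; lra.
have := b2 _ _ h3 h1; have := b2 _ _ h4 h2.
rewrite (distrC t') (distrC b'); clear; lra.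
Qed.

Variables (V W : R -> R -> R) (K kap z1 z2 : R).
Hypotheses (K0 : 0 < K) (VK : semiconvex K V) (WK : semiconvex K (fun x y => - W x y)).
Hypothesis kap0 : 0 < kap.
Hypothesis zmax : forall y1 y2, V y1 y2 - W y1 y2 <=
  V z1 z2 - W z1 z2 - kap * ((y1 - z1) ^+ 2 + (y2 - z2) ^+ 2).

(** In units of [r], contacts are [1 / nu]-dense in a square of half side [nu], so as [nu] grows the
    rescaled contacts fill the plane; [r * nu <= 1] makes the scale itself shrink. *)
Definition dense_at (q0 nu e1 e2 r : R) :=
  [/\ contact_set V W q0 e1 e2, 0 < r, r * nu <= 1 &
   forall y1 y2, `|y1 - e1| <= nu * r -> `|y2 - e2| <= nu * r ->
     exists e1' e2', [/\ contact_set V W q0 e1' e2', `|e1' - y1| <= r / nu & `|e2' - y2| <= r / nu]].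

(** Lowering the density from [nu] to [mu] buys freedom in the centre and the scale. This near
    invariance lets an extremal second difference dominate those at all other points and scales. *)
Lemma dense_at_recenter (q0 nu mu e1 e2 r e1' e2' s : R) : dense_at q0 nu e1 e2 r ->
  0 < mu -> 0 < nu -> 0 < s -> contact_set V W q0 e1' e2' ->
  `|e1' - e1| + r * (mu * s) <= nu * r -> `|e2' - e2| + r * (mu * s) <= nu * r ->
  s * mu <= nu -> mu <= s * nu -> dense_at q0 mu e1' e2' (s * r).
Proof.
move=> [_ r0 rnu dns] mu0 nu0 s0 ce' d1 d2 smu mus; split=> //.
- by rewrite mulr_gt0.
- by apply: le_trans rnu; rewrite mulrAC mulrC ler_pM2l.
move=> y1 y2 y1e y2e.
have tri (e y e' : R) : `|e' - e| + r * (mu * s) <= nu * r -> `|y - e'| <= mu * (s * r) -> `|y - e| <= nu * r.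
  move=> h1 h2; rewrite -(subrK e' y) -addrA (le_trans (ler_normD _ _))//; lra.
have [e1'' [e2'' [c h1 h2]]] := dns _ _ (tri _ _ _ d1 y1e) (tri _ _ _ d2 y2e).
have le : r / nu <= s * r / mu.
  by rewrite ler_pdivrMr// mulrAC ler_pdivlMr// mulrAC (mulrC r) ler_pM2r.
by exists e1'', e2''; split=> //; exact: le_trans le.
Qed.

(** [S n] is the largest normalized second difference in the first direction over configurations of
    density [nu n], and [M] is the infimum of the [S n]. Rescaling nearly optimal configurations
    gives functions [T n] whose second difference at the origin and scale 1 is almost [M], while
    recentering shows that those elsewhere are asymptotically at most [M]: the setting of
    [quadratic_tangent]. *)
Lemma near_quadratic (q0 eta : R) : 0 < q0 -> 0 < eta -> exists e1 e2 r c p1 p2 y11 y12 y22 : R,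
  [/\ contact_set V W q0 e1 e2, 0 < r, r <= eta &
   forall h1 h2 : R, `|h1| <= r -> `|h2| <= r ->
     `|V (e1 + h1) (e2 + h2) - (c + p1 * h1 + p2 * h2
        + (y11 * h1 ^+ 2 + 2 * y12 * h1 * h2 + y22 * h2 ^+ 2) / 2)| <= eta * r ^+ 2].
Proof.
move=> q00 eta0.
pose nu (n : nat) : R := n.+1%:R.
have nu1 n : 1 <= nu n by rewrite ler1n.
have nu0 n : 0 < nu n by rewrite ltr0n.
have nu_large (a : R) : exists N : nat, forall n, (N <= n)%N -> a <= nu n.
  have /archi_boundP h : 0 <= `|a| by [].
  exists (Num.bound `|a|) => n Nn; apply: (le_trans (ler_norm a)); apply: (le_trans (ltW h)).
  by rewrite ler_nat ltnW.
clearbody nu.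
pose Fs n := [set x : R * R * R | dense_at q0 (nu n) x.1.1 x.1.2 x.2].
pose D2 (e1 e2 r : R) := (V (e1 + r) e2 + V (e1 - r) e2 - 2 * V e1 e2) / r ^+ 2.
pose Q n := [set D2 x.1.1 x.1.2 x.2 | x in Fs n].
have pinch e1 e2 : contact_set V W q0 e1 e2 -> exists p1 p2, forall y1 y2,
    `|V y1 y2 - V e1 e2 - p1 * (y1 - e1) - p2 * (y2 - e2)| <= K * ((y1 - e1) ^+ 2 + (y2 - e2) ^+ 2).
  by move=> [q1 [q2 [_ _ /(contact_pinched K0 VK WK)]]].
have V2 e1 e2 u1 u2 : contact_set V W q0 e1 e2 ->
    V (e1 + u1) (e2 + u2) + V (e1 - u1) (e2 - u2) - 2 * V e1 e2 <= 2 * K * (u1 ^+ 2 + u2 ^+ 2).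
  move=> /pinch[p1 [p2 p]]; have := p (e1 + u1) (e2 + u2); have := p (e1 - u1) (e2 - u2).
  rewrite !ler_norml (_ : e1 - u1 - e1 = - u1); last by ring.
  rewrite (_ : e2 - u2 - e2 = - u2); last by ring.
  rewrite (_ : e1 + u1 - e1 = u1); last by ring.
  rewrite (_ : e2 + u2 - e2 = u2); last by ring.
  lra.
have Qsup n : has_sup (Q n).
  split.
    have [e1 [e2 [r H]]] := dense_contacts K0 VK WK kap0 zmax q00 (nu1 n).
    by exists (D2 e1 e2 r), (e1, e2, r).
  exists (2 * K) => _ [[[e1 e2] r] /= [ce r0 _ _] <-].
  rewrite /D2 ler_pdivrMr ?exprn_gt0//.
  by have := V2 _ _ r 0 ce; rewrite addr0 subr0 expr0n/= addr0.
pose S n := sup (Q n).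
have Sinf : has_inf (range S).
  split; first by exists (S 0%N), 0%N.
  exists (- (2 * K)) => _ [n _ <-].
  have [e1 [e2 [r H]]] := dense_contacts K0 VK WK kap0 zmax q00 (nu1 n).
  have r0 : 0 < r by case: H.
  apply: (@le_trans _ _ (D2 e1 e2 r)); last first.
    by apply: ub_le_sup; [exact: (Qsup n).2|exists (e1, e2, r)].
  rewrite /D2 ler_pdivlMr ?exprn_gt0//.
  have [p1 [p2 p]] := VK e1 e2; have := p (e1 + r) e2; have := p (e1 - r) e2.
  rewrite (_ : e1 - r - e1 = - r); last by ring.
  rewrite (_ : e1 + r - e1 = r); last by ring.
  lra.
pose M := inf (range S).
have MS n : M <= S n by apply: ge_inf; [exact: Sinf.2|exists n].
have /choice[X XP] : forall n, exists x, Fs n x /\ S n - (nu n)^-1 < D2 x.1.1 x.1.2 x.2.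
  move=> n; have ni : 0 < (nu n)^-1 by rewrite invr_gt0.
  by have [_ [x Fx <-] h] := sup_adherent ni (Qsup n); exists x.
have [e1 [e2 [r [FX XM]]]] : exists e1 e2 r : nat -> R,
    (forall n, dense_at q0 (nu n) (e1 n) (e2 n) (r n)) /\
    (forall n, S n - (nu n)^-1 < D2 (e1 n) (e2 n) (r n)).
  by exists (fun n => (X n).1.1), (fun n => (X n).1.2), (fun n => (X n).2); split=> n; case: (XP n).
have r0 n : 0 < r n by case: (FX n).
have r_neq0 n : r n != 0 by rewrite gt_eqF.
have r20 n : 0 < r n ^+ 2 by rewrite exprn_gt0.
have /choice[p' pP'] : forall n, exists p : R * R, forall y1 y2,
    `|V y1 y2 - V (e1 n) (e2 n) - p.1 * (y1 - e1 n) - p.2 * (y2 - e2 n)| <=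
      K * ((y1 - e1 n) ^+ 2 + (y2 - e2 n) ^+ 2).
  move=> n; have [ce _ _ _] := FX n; have [p1 [p2 P]] := pinch _ _ ce.
  by exists (p1, p2).
have [pa [pb pP]] : exists pa pb : nat -> R, forall n y1 y2,
    `|V y1 y2 - V (e1 n) (e2 n) - pa n * (y1 - e1 n) - pb n * (y2 - e2 n)| <=
      K * ((y1 - e1 n) ^+ 2 + (y2 - e2 n) ^+ 2).
  by exists (fun n => (p' n).1), (fun n => (p' n).2).
pose T n t b := (V (e1 n + r n * t) (e2 n + r n * b) - V (e1 n) (e2 n)
                 - pa n * (r n * t) - pb n * (r n * b)) / r n ^+ 2.
have TB n t b : `|T n t b| <= K * (t ^+ 2 + b ^+ 2).
  rewrite normrM normfV (gtr0_norm (r20 n)) ler_pdivrMr//.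
  have := pP n (e1 n + r n * t) (e2 n + r n * b).
  rewrite (_ : e1 n + r n * t - e1 n = r n * t); last by ring.
  rewrite (_ : e2 n + r n * b - e2 n = r n * b); last by ring.
  by move=> /le_trans; apply; rewrite !exprMn; lra.
have TK n : semiconvex K (T n).
  move=> t b; have [P1 [P2 P]] := VK (e1 n + r n * t) (e2 n + r n * b).
  exists ((P1 - pa n) / r n), ((P2 - pb n) / r n) => t' b'.
  have := P (e1 n + r n * t') (e2 n + r n * b'); rewrite /T ler_pdivlMr//.
  set A := V (e1 n + r n * t) _; set B := V (e1 n + r n * t') _; set C := V (e1 n) _.
  move=> h; apply: le_trans (_ : A + P1 * (e1 n + r n * t' - (e1 n + r n * t)) + P2 * (e2 n + r n * b' - (e2 n + r n * b)) - K * ((e1 n + r n * t' - (e1 n + r n * t)) ^+ 2 + (e2 n + r n * b' - (e2 n + r n * b)) ^+ 2) - C - pa n * (r n * t') - pb n * (r n * b') <= _); last by lra.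
  by rewrite le_eqVlt; apply/orP; left; apply/eqP; field.
have TL n := semiconvex_lipschitz (TK n) (TB n).
have T2 n t b u1 u2 : contact_set V W q0 (e1 n + r n * t) (e2 n + r n * b) ->
    T n (t + u1) (b + u2) + T n (t - u1) (b - u2) - 2 * T n t b <= 2 * K * (u1 ^+ 2 + u2 ^+ 2).
  move=> /(V2 _ _ (r n * u1) (r n * u2)) h.
  rewrite -(ler_pM2r (r20 n)) (_ : _ * r n ^+ 2 = V (e1 n + r n * t + r n * u1) (e2 n + r n * b + r n * u2) + V (e1 n + r n * t - r n * u1) (e2 n + r n * b - r n * u2) - 2 * V (e1 n + r n * t) (e2 n + r n * b)).
    by apply: (le_trans h); rewrite !exprMn; lra.
  by rewrite /T !mulrDr !mulrN !addrA; field.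
(* A second difference has four values counted with multiplicity; moving the centre to a nearby
   contact changes each by at most [eps / 4], by the Lipschitz bound [TL]. Hence the constant 80 = 4
   * 10 * 2. *)
have approx t b u1 u2 (eps : R) : 0 < eps -> exists N : nat, forall n, (N <= n)%N ->
    exists t' b', [/\ contact_set V W q0 (e1 n + r n * t') (e2 n + r n * b'),
      `|t' - t| <= 1, `|b' - b| <= 1 &
      T n (t + u1) (b + u2) + T n (t - u1) (b - u2) - 2 * T n t b <=
      T n (t' + u1) (b' + u2) + T n (t' - u1) (b' - u2) - 2 * T n t' b' + eps].
  move=> eps0.
  pose rho : R := `|t| + `|b| + `|u1| + `|u2| + 1.
  have [N1 HN1] := nu_large rho; have [N2 HN2] := nu_large (80 * K * rho / eps).
  exists (maxn N1 N2) => n; rewrite geq_max => /andP[/HN1 n1 /HN2 n2].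
  have [_ _ _ dns] := FX n.
  have [u10 u20] := (normr_ge0 u1, normr_ge0 u2).
  have [t0 b0] := (normr_ge0 t, normr_ge0 b).
  have [||f1 [f2 [cf f1d f2d]]] := dns (e1 n + r n * t) (e2 n + r n * b).
  - by rewrite addrAC subrr add0r normrM (gtr0_norm (r0 n)) mulrC ler_pM2r//; rewrite /rho in n1; lra.
  - by rewrite addrAC subrr add0r normrM (gtr0_norm (r0 n)) mulrC ler_pM2r//; rewrite /rho in n1; lra.
  have conv (f e u : R) : `|f - (e + r n * u)| <= r n / nu n -> `|(f - e) / r n - u| <= (nu n)^-1.
    move=> h; rewrite (_ : _ - u = (f - (e + r n * u)) / r n); last by field.
    by rewrite normrM normfV (gtr0_norm (r0 n)) ler_pdivrMr// (mulrC (nu n)^-1).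
  have d1 := conv _ _ _ f1d; have d2 := conv _ _ _ f2d.
  have nui : (nu n)^-1 <= 1 by rewrite invf_le1.
  set t' := (f1 - e1 n) / r n in d1; set b' := (f2 - e2 n) / r n in d2.
  exists t', b'; split.
  - by rewrite /t' /b' !(mulrC (r n)) !divfK// !(addrC (e1 n)) !(addrC (e2 n)) !subrK.
  - exact: le_trans nui.
  - exact: le_trans nui.
  have td : `|t'| <= `|t| + 1.
    by rewrite -(subrK t t') addrC (le_trans (ler_normD _ _))// lerD2l (le_trans d1).
  have bd : `|b'| <= `|b| + 1.
    by rewrite -(subrK b b') addrC (le_trans (ler_normD _ _))// lerD2l (le_trans d2).
  have [rho0 [i1 i3 i5 i7] [i2 i4 i6 i8] [i9 i10 i11 i12]] := @norm_sum_bounds _ t b u1 u2 t' b' rho erefl td bd.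
  have := TL n _ _ _ _ _ i1 i3 i5 i7; have := TL n _ _ _ _ _ i2 i4 i6 i8.
  have := TL n _ _ _ _ _ i9 i10 i11 i12.
  rewrite (_ : t + u1 - (t' + u1) = t - t'); last by ring.
  rewrite (_ : b + u2 - (b' + u2) = b - b'); last by ring.
  rewrite (_ : t - u1 - (t' - u1) = t - t'); last by ring.
  rewrite (_ : b - u2 - (b' - u2) = b - b'); last by ring.
  have : 10 * K * rho * (`|t - t'| + `|b - b'|) <= eps / 4.
    apply: le_trans (small_ratio eps0 (lt_le_trans ltr01 (nu1 n)) n2).
    apply: ler_wpM2l; first by rewrite !mulr_ge0// ltW.
    by rewrite (distrC t) (distrC b) mulrDl mul1r lerD.
  rewrite !ler_norml; lra.
have TM t b s (eps : R) : 0 < eps -> exists N : nat, forall n : nat, (N <= n)%N ->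
    T n (t + s) b + T n (t - s) b - 2 * T n t b <= M * s ^+ 2 + eps.
  move=> eps0.
  wlog s0 : s / 0 < s.
    move=> H; have [s0|s0|->] := ltgtP s 0.
    - have [|N HN] := H (- s); first by rewrite oppr_gt0.
      by exists N => n /HN; rewrite opprK sqrrN; lra.
    - exact: H.
    - by exists 0%N => n _; rewrite addr0 subr0 expr0n/=; lra.
  (* The excess of [S m] over [M] gets multiplied by [s ^+ 2]; the other half of [eps] pays for the
     move to a contact. *)
  have ep : 0 < eps / (2 * s ^+ 2) by rewrite divr_gt0// mulr_gt0// exprn_gt0.
  have [_ [m _ <-] Sm] := inf_adherent ep Sinf.
  have [N1 HN1] := approx t b s 0 _ (divr_gt0 eps0 (ltr0n _ 2)).
  have [N2 HN2] := nu_large (`|t| + `|b| + 1 + nu m * s); have [N3 HN3] := nu_large (nu m / s).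
  exists (maxn N1 (maxn N2 N3)) => n; rewrite !geq_max => /and3P[/HN1 n1 /HN2 n2 /HN3 n3].
  have [t' [b' [ce tt bb]]] := n1; rewrite !addr0 !subr0 => /le_trans; apply.
  rewrite ler_pdivrMr// in n3.
  have [t0 b0] := (normr_ge0 t, normr_ge0 b).
  have td : `|t'| <= `|t| + 1.
    by rewrite -(subrK t t') addrC (le_trans (ler_normD _ _))// lerD2l.
  have bd : `|b'| <= `|b| + 1.
    by rewrite -(subrK b b') addrC (le_trans (ler_normD _ _))// lerD2l.
  have Fm : dense_at q0 (nu m) (e1 n + r n * t') (e2 n + r n * b') (s * r n).
    apply: (dense_at_recenter (FX n)) => //.
    - rewrite addrAC subrr add0r normrM (gtr0_norm (r0 n)) -mulrDr mulrC ler_pM2r//.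
      by move: td n2 b0; clear -K0 VK WK kap0 zmax; lra.
    - rewrite addrAC subrr add0r normrM (gtr0_norm (r0 n)) -mulrDr mulrC ler_pM2r//.
      by move: bd n2 t0; clear -K0 VK WK kap0 zmax; lra.
    - by lra.
    - by lra.
  have : D2 (e1 n + r n * t') (e2 n + r n * b') (s * r n) <= S m.
    by apply: ub_le_sup; [exact: (Qsup m).2|exists (e1 n + r n * t', e2 n + r n * b', s * r n)].
  have s20 : 0 < s ^+ 2 by rewrite exprn_gt0.
  have -> : D2 (e1 n + r n * t') (e2 n + r n * b') (s * r n) = (T n (t' + s) b' + T n (t' - s) b' - 2 * T n t' b') / s ^+ 2.
    rewrite /D2 /T !mulrDr !mulrN !addrA (mulrC s); field.
    by rewrite ?r_neq0 ?(gt_eqF s0) ?andbT.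
  rewrite ler_pdivrMr// => h; apply: (@le_trans _ _ (S m * s ^+ 2 + eps / 2)); first by move: h; clear -K0 VK WK kap0 zmax; lra.
  have : S m * s ^+ 2 <= (M + eps / (2 * s ^+ 2)) * s ^+ 2 by rewrite ler_pM2r// ltW.
  have -> : (M + eps / (2 * s ^+ 2)) * s ^+ 2 = M * s ^+ 2 + eps / 2 by field; rewrite gt_eqF.
  clear -K0 VK WK kap0 zmax; lra.
(* Recentering at a contact will halve the radius, so an error of [eta / 4] relative to the old
   squared radius is [eta] relative to the new one. *)
have eta4 : 0 < eta / 4 by rewrite divr_gt0.
have [||||||x [s [c0 [p1 [p2 [y11 [y12 [y22 [s0 H]]]]]]]]] := @quadratic_tangent _ T M (2 * K) (10 * K) _ _ _ _ _ _ _ eta4.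
- by move=> n t b; apply: (le_trans (TB n t b)); have := ler_wpM2l (ltW K0) (addr_ge0 (sqr_ge0 t) (sqr_ge0 b)); lra.
- exact: TL.
- move=> n t b s; have [P1 [P2 P]] := TK n t b; have := P t (b + s); have := P t (b - s).
  rewrite (_ : b - s - b = - s); last by ring.
  rewrite (_ : b + s - b = s); last by ring.
  by lra.
- move=> t b s eps eps0; have [N HN] := approx t b 0 s _ eps0; exists N => n /HN[t' [b' [ce _ _]]].
  rewrite !addr0 !subr0; have := T2 n t' b' 0 s ce; rewrite !addr0 !subr0 expr0n/=; clear -K0 VK WK kap0 zmax; lra.
- exact: TM.
- move=> eps eps0; have [N HN] := nu_large eps^-1; exists N => n /HN h.
  have := XM n; have := MS n.
  have nue : (nu n)^-1 <= eps by rewrite -(invrK eps) lef_pV2 ?posrE ?invr_gt0.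
  have -> : D2 (e1 n) (e2 n) (r n) = T n 1 0 + T n (-1) 0.
    by rewrite /D2 /T !mulr1 !mulr0 !mulrN1 !addr0; field.
  lra.
have [N1 HN1] := nu_large (`|x| + 1); have [N2 HN2] := nu_large (2 / s).
have [N3 HN3] := nu_large (s / eta).
have [n [+ nP]] := H (maxn N1 (maxn N2 N3)).
rewrite !geq_max => /and3P[/HN1 n1 /HN2 n2 /HN3 n3].
rewrite ler_pdivrMr// in n2; rewrite ler_pdivrMr// in n3.
have [_ _ rn dns] := FX n.
have [||f1 [f2 [cf f1d f2d]]] := dns (e1 n) (e2 n + r n * x).
- by rewrite subrr normr0 mulr_ge0// ltW.
- by rewrite addrAC subrr add0r normrM (gtr0_norm (r0 n)) mulrC ler_pM2r//; move: n1; clear -K0 VK WK kap0 zmax; lra.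
have rnu : r n / nu n <= r n * s / 2.
  by rewrite ler_pdivrMr// -mulrA -mulrA ler_pMr//; move: n2; clear -K0 VK WK kap0 zmax; lra.
pose t0 := (f1 - e1 n) / r n; pose b0 := (f2 - e2 n) / r n - x.
exists f1, f2, (r n * s / 2),
  (V (e1 n) (e2 n) + pa n * (f1 - e1 n) + pb n * (f2 - e2 n) + r n ^+ 2 *
    (c0 + p1 * t0 + p2 * b0 + (y11 * t0 ^+ 2 + 2 * y12 * t0 * b0 + y22 * b0 ^+ 2) / 2)),
  (pa n + r n * (p1 + y11 * t0 + y12 * b0)), (pb n + r n * (p2 + y12 * t0 + y22 * b0)),
  y11, y12, y22.
split=> //.
- by rewrite divr_gt0// mulr_gt0.
- have := ler_wpM2l (ltW (r0 n)) n3; have := ler_wpM2r (ltW eta0) rn; have := r0 n; have := eta0; clear -K0 VK WK kap0 zmax; nra.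
move=> h1 h2 h1r h2r.
have := nP ((f1 + h1 - e1 n) / r n) ((f2 + h2 - e2 n) / r n).
have small (u : R) : `|u| <= r n * s -> `|u / r n| <= s.
  by move=> h; rewrite normrM normfV (gtr0_norm (r0 n)) ler_pdivrMr// mulrC.
have -> : `|(f1 + h1 - e1 n) / r n| <= s.
  apply: small; rewrite addrAC (le_trans (ler_normD _ _))//.
  by have := le_trans f1d rnu; move: h1r; clear -K0 VK WK kap0 zmax; lra.
have -> : `|(f2 + h2 - e2 n) / r n - x| <= s.
  rewrite (_ : _ - x = (f2 - (e2 n + r n * x) + h2) / r n); last by field.
  by apply: small; rewrite (le_trans (ler_normD _ _))//; have := le_trans f2d rnu; move: h2r; clear -K0 VK WK kap0 zmax; lra.
move=> /(_ isT isT).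
set QQ := (X in `|T _ _ _ - X|).
rewrite /T ![r n * (_ / _)]mulrC !divfK// ![e1 n + _]addrC ![e2 n + _]addrC !subrK => h.
rewrite (_ : _ - _ = r n ^+ 2 * ((V (f1 + h1) (f2 + h2) - V (e1 n) (e2 n) - pa n * (f1 + h1 - e1 n) - pb n * (f2 + h2 - e2 n)) / r n ^+ 2 - QQ)).
  rewrite normrM (gtr0_norm (r20 n)); apply: (le_trans (ler_wpM2l (ltW (r20 n)) h)).
  by rewrite !exprMn; clear -K0 VK WK kap0 zmax; lra.
by rewrite /QQ /t0 /b0; field.
Qed.
End near_quadratic.

(** * Paraboloids with a common Hessian *)

Section jets.
Variable R : realType.
Implicit Types V W f : R -> R -> R.

Lemma semiconvex_le (K K' : R) V : K <= K' -> semiconvex K V -> semiconvex K' V.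
Proof.
move=> KK' VK x1 x2; have [p1 [p2 p]] := VK x1 x2; exists p1, p2 => y1 y2.
apply: le_trans (p y1 y2); rewrite lerD2l lerN2 ler_wpM2r//.
by rewrite addr_ge0 ?sqr_ge0.
Qed.

Lemma semiconvex_quadratic (K : R) V (e1 e2 c p1 p2 a11 a12 a22 : R) : semiconvex K V ->
  semiconvex (K + `|a11| + `|a12| + `|a22|) (fun h1 h2 => V (e1 + h1) (e2 + h2) +
    (c + p1 * h1 + p2 * h2 + (a11 * h1 ^+ 2 + 2 * a12 * h1 * h2 + a22 * h2 ^+ 2) / 2)).
Proof.
move=> VK x1 x2; have [q1 [q2 q]] := VK (e1 + x1) (e2 + x2).
exists (q1 + p1 + a11 * x1 + a12 * x2), (q2 + p2 + a12 * x1 + a22 * x2) => y1 y2.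
have := q (e1 + y1) (e2 + y2).
rewrite (_ : e1 + y1 - (e1 + x1) = y1 - x1); last by ring.
rewrite (_ : e2 + y2 - (e2 + x2) = y2 - x2); last by ring.
have -> : y1 = x1 + (y1 - x1) by ring.
have -> : y2 = x2 + (y2 - x2) by ring.
rewrite ![x1 + _ - x1]addrAC ![x2 + _ - x2]addrAC !subrr !add0r.
move: (y1 - x1) (y2 - x2) => d1 d2.
have sq (a u : R) : - (`|a| * u ^+ 2) <= a * u ^+ 2.
  by have := ler_wpM2r (sqr_ge0 u) (ler_norm (- a)); rewrite normrN; lra.
have mx (a : R) : - (`|a| * (d1 ^+ 2 + d2 ^+ 2)) <= 2 * a * d1 * d2.
  have := ler_norm a; have := ler_norm (- a); rewrite normrN => h1 h2.
  have := mulr_ge0 (_ : 0 <= `|a| + a) (sqr_ge0 (d1 + d2)).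
  have := mulr_ge0 (_ : 0 <= `|a| - a) (sqr_ge0 (d1 - d2)).
  by move=> /(_ ltac:(lra)) + /(_ ltac:(lra)); lra.
have := sq a11 d1; have := sq a22 d2; have := mx a12.
have p (a u : R) : 0 <= `|a| * u ^+ 2 by rewrite mulr_ge0 ?sqr_ge0.
have := p a11 d1; have := p a11 d2; have := p a22 d1; have := p a22 d2.
have := p a12 d1; have := p a12 d2.
lra.
Qed.

(** On the boundary of the square the upper bound is at most [m - 8 * eta * r ^+ 2], below the value
    at the centre, so the maximum cannot be attained there. *)
Lemma interior_max (K : R) f (m eta r : R) : 0 <= K -> semiconvex K f -> 0 < r -> 0 < eta ->
  m - eta * r ^+ 2 <= f 0 0 ->
  (forall h1 h2, `|h1| <= r -> `|h2| <= r ->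
     f h1 h2 <= m + eta * r ^+ 2 - 9 * eta * (h1 ^+ 2 + h2 ^+ 2)) ->
  exists h1 h2, [/\ `|h1| < r, `|h2| < r &
    forall k1 k2, `|k1| <= r -> `|k2| <= r -> f k1 k2 <= f h1 h2].
Proof.
move=> K0 fK r0 eta0 f0 fr.
have er0 : 0 < eta * r ^+ 2 by rewrite mulr_gt0// exprn_gt0.
have [|||h1 [h2 [h1r h2r hmax]]] := @box_max _ f (- r) r (- r) r.
- by lra.
- by lra.
- move=> x1 x2 d _ _ fd.
  have df0 : 0 < d - f x1 x2 by lra.
  have [s s0 fs] := semiconvex_continuous x1 x2 K0 fK df0.
  exists s => [|y1 y2 _ _ y1s y2s]; first exact: s0.
  by have := fs _ _ y1s y2s; rewrite ltr_norml; lra.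
exists h1, h2.
have := hmax 0 0; have := fr h1 h2; rewrite !ler_norml => /(_ h1r h2r) hi /(_ ltac:(lra) ltac:(lra)) lo.
have sq (u v : R) : - r <= u <= r -> f h1 h2 <= m + eta * r ^+ 2 - 9 * eta * (u ^+ 2 + v ^+ 2) -> `|u| < r.
  move=> ur H; rewrite lt_neqAle ler_norml ur andbT; apply/eqP => uE.
  have uu : u ^+ 2 = r ^+ 2 by rewrite -uE real_normK// num_real.
  by have := mulr_ge0 (ltW eta0) (sqr_ge0 v); rewrite uu in H; lra.
split; [exact: (sq _ h2)|apply: (sq _ h1) => //; lra|].
by move=> k1 k2; rewrite !ler_norml; exact: hmax.
Qed.

Lemma quadratic_form_le (r A y11 y12 y22 : R) : 0 < r ->
  (forall h1 h2, `|h1| <= r -> `|h2| <= r -> (`|h1| = r \/ `|h2| = r) ->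
     `|y11 * h1 ^+ 2 + 2 * y12 * h1 * h2 + y22 * h2 ^+ 2| <= A * (h1 ^+ 2 + h2 ^+ 2)) ->
  forall h1 h2, `|y11 * h1 ^+ 2 + 2 * y12 * h1 * h2 + y22 * h2 ^+ 2| <= A * (h1 ^+ 2 + h2 ^+ 2).
Proof.
move=> r0 H h1 h2.
pose m := Num.max `|h1| `|h2|.
have [m0|m0] := leP m 0.
  have [-> ->] : h1 = 0 /\ h2 = 0.
    by move: m0; rewrite ge_max !normr_le0 => /andP[/eqP -> /eqP ->].
  by rewrite expr0n/= !mulr0 !addr0 normr0 mulr0.
have s0 : 0 < r / m by rewrite divr_gt0.
have nm (u : R) : `|r / m * u| = r * `|u| / m by rewrite normrM (gtr0_norm s0) mulrAC.
have [a1 a2] : `|r / m * h1| <= r /\ `|r / m * h2| <= r.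
  rewrite !nm !ler_pdivrMr// !ler_pM2l//.
  by rewrite /m !le_max !lexx orbT.
have := H (r / m * h1) (r / m * h2) a1 a2.
have -> : y11 * (r / m * h1) ^+ 2 + 2 * y12 * (r / m * h1) * (r / m * h2) + y22 * (r / m * h2) ^+ 2
   = (r / m) ^+ 2 * (y11 * h1 ^+ 2 + 2 * y12 * h1 * h2 + y22 * h2 ^+ 2) by ring.
have -> : A * ((r / m * h1) ^+ 2 + (r / m * h2) ^+ 2) = (r / m) ^+ 2 * (A * (h1 ^+ 2 + h2 ^+ 2)) by ring.
move=> H'; rewrite -(ler_pM2l (exprn_gt0 2 s0)) -{1}(gtr0_norm (exprn_gt0 2 s0)) -normrM; apply: H'.
rewrite !nm; have [h|h] := leP `|h1| `|h2|.
  right; have -> : `|h2| = m by rewrite /m max_r.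
  by rewrite mulfK// gt_eqF.
left; have -> : `|h1| = m by rewrite /m max_l// ltW.
by rewrite mulfK// gt_eqF.
Qed.

(** Only [V] is known to be close to a quadratic. Contact passes the lower bound on to [W], with
    near equality at the centre, so the same quadratic bent slightly downwards touches [W] from
    below as the one bent upwards touches [V] from above. The two touching points are found
    independently, hence [u] and [w] may differ. *)
Lemma approx_jets V W (K z1 z2 eta : R) : 0 < K -> semiconvex K V ->
  semiconvex K (fun x y => - W x y) ->
  (forall y1 y2, V y1 y2 - W y1 y2 <= V z1 z2 - W z1 z2) -> 0 < eta -> eta <= 1 ->
  exists u1 u2 w1 w2 p1 p2 q1 q2 y11 y12 y22 rho : R, 0 < rho /\
  [/\ [/\ `|u1 - z1| <= eta, `|u2 - z2| <= eta, `|w1 - z1| <= eta & `|w2 - z2| <= eta],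
      forall h1 h2, `|h1| <= rho -> `|h2| <= rho -> V (u1 + h1) (u2 + h2) <= V u1 u2
        + p1 * h1 + p2 * h2 + (y11 * h1 ^+ 2 + 2 * y12 * h1 * h2 + y22 * h2 ^+ 2) / 2
        + eta * (h1 ^+ 2 + h2 ^+ 2),
      forall h1 h2, `|h1| <= rho -> `|h2| <= rho -> W w1 w2
        + q1 * h1 + q2 * h2 + (y11 * h1 ^+ 2 + 2 * y12 * h1 * h2 + y22 * h2 ^+ 2) / 2
        - eta * (h1 ^+ 2 + h2 ^+ 2) <= W (w1 + h1) (w2 + h2),
      [/\ `|p1 - q1| <= eta, `|p2 - q2| <= eta & V z1 z2 - W z1 z2 <= V u1 u2 - W w1 w2 + eta] &
      forall h1 h2, `|y11 * h1 ^+ 2 + 2 * y12 * h1 * h2 + y22 * h2 ^+ 2|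
         <= (2 * K + 1) * (h1 ^+ 2 + h2 ^+ 2)].
Proof.
move=> K0 VK WK zmax eta0 eta1.
have [P1 [P2 P]] := VK z1 z2; have [Q1 [Q2 Q]] := WK z1 z2.
pose L := `|P1| + `|P2| + `|Q1| + `|Q2| + 4 * K + 1.
have L1 : 1 <= L.
  have := normr_ge0 P1; have := normr_ge0 P2; have := normr_ge0 Q1; have := normr_ge0 Q2.
  by rewrite /L; lra.
have L0 : 0 < L by lra.
have [d [d0 dL]] : exists d : R, 0 < d /\ d * L = eta.
  by exists (eta / L); rewrite divr_gt0// divfK// gt_eqF.
have deta : d <= eta by rewrite -dL; move: d0 L1; clear; nra.
have [A AE] : exists A, A = 2 * K + 1 by exists (2 * K + 1).
have A1 : 1 <= A by rewrite AE; move: K0; clear; lra.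
have A0 : 0 < A by apply: lt_le_trans A1.
have [kap [kap0 kapE]] : exists kap : R, 0 < kap /\ kap * 16 = eta.
  by exists (eta / 16); rewrite divr_gt0// divfK.
have [et [et0 etE]] : exists et : R, 0 < et /\ et * A * 100 = d.
  exists (d / (100 * A)); split; first by rewrite divr_gt0// mulr_gt0.
  by field; rewrite gt_eqF.
have etd : et * 100 <= d by rewrite -etE; move: et0 A1; clear; nra.
have [q0 [q00 q0E q0le]] : exists q0 : R, [/\ 0 < q0, 2 * q0 / kap = d / 8 & q0 * 256 <= d].
  exists (kap * d / 16); split; [by rewrite divr_gt0// mulr_gt0|by field; rewrite gt_eqF|].
  by move: kapE eta1 kap0 d0; clear; nra.
(* This makes the maximum strict; planes touching [V - W'] are paraboloids touching [V - W]. *)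
pose W' y1 y2 := W y1 y2 + kap * ((y1 - z1) ^+ 2 + (y2 - z2) ^+ 2).
have K'0 : 0 < K + kap by rewrite addr_gt0.
have VK' : semiconvex (K + kap) V by apply: semiconvex_le VK; rewrite lerDl ltW.
have WK' : semiconvex (K + kap) (fun x y => - W' x y).
  move=> x1 x2; have [r1 [r2 r]] := WK x1 x2.
  exists (r1 - 2 * kap * (x1 - z1)), (r2 - 2 * kap * (x2 - z2)) => y1 y2.
  by rewrite /W'; move: (r y1 y2); clear; lra.
have zmax' y1 y2 : V y1 y2 - W' y1 y2 <= V z1 z2 - W' z1 z2 - kap * ((y1 - z1) ^+ 2 + (y2 - z2) ^+ 2).
  by rewrite /W' !subrr expr0n/= addr0 mulr0; move: (zmax y1 y2); clear; lra.
have [e1 [e2 [r [c [p1 [p2 [y11 [y12 [y22 [[s1 [s2 [s1q s2q ce]]] r0 ret H]]]]]]]]]] :=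
  near_quadratic K'0 VK' WK' kap0 zmax' q00 et0.
have [e1z e2z] := contact_near kap0 zmax' s1q s2q ce; rewrite q0E in e1z e2z.
pose B h1 h2 := y11 * h1 ^+ 2 + 2 * y12 * h1 * h2 + y22 * h2 ^+ 2.
have BE h1 h2 : B h1 h2 = y11 * h1 ^+ 2 + 2 * y12 * h1 * h2 + y22 * h2 ^+ 2 by [].
have {}H h1 h2 : `|h1| <= r -> `|h2| <= r ->
    `|V (e1 + h1) (e2 + h2) - (c + p1 * h1 + p2 * h2 + B h1 h2 / 2)| <= et * r ^+ 2 by exact: H.
have n0 : `|0 : R| <= r by rewrite normr0 ltW.
have B0 : B 0 0 = 0 by rewrite /B; ring.
have V0 : `|V e1 e2 - c| <= et * r ^+ 2.
  by have := H 0 0 n0 n0; rewrite B0 !addr0 !mulr0 mul0r !addr0.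
have BA : forall h1 h2, `|B h1 h2| <= A * (h1 ^+ 2 + h2 ^+ 2).
  apply: (quadratic_form_le r0) => h1 h2 h1r h2r hr; rewrite -BE.
  have r2 : r ^+ 2 <= h1 ^+ 2 + h2 ^+ 2.
    have sq (u : R) : `|u| = r -> u ^+ 2 = r ^+ 2 by move=> <-; rewrite real_normK// num_real.
    by case: hr => /sq ->; rewrite ?lerDl ?lerDr sqr_ge0.
  have [P1' [P2' P']] := contact_pinched K'0 VK' WK' ce.
  have := P' (e1 + h1) (e2 + h2); have := P' (e1 - h1) (e2 - h2).
  rewrite (_ : e1 + h1 - e1 = h1); last by ring.
  rewrite (_ : e1 - h1 - e1 = - h1); last by ring.
  rewrite (_ : e2 + h2 - e2 = h2); last by ring.
  rewrite (_ : e2 - h2 - e2 = - h2); last by ring.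
  have := H h1 h2 h1r h2r; have := H (- h1) (- h2); rewrite !normrN => /(_ h1r h2r).
  rewrite (_ : B (- h1) (- h2) = B h1 h2); last by rewrite /B; ring.
  move: V0; rewrite !ler_norml AE => v0 v1 v2 v3 v4.
  have : et * r ^+ 2 <= (h1 ^+ 2 + h2 ^+ 2) / 100.
    apply: (le_trans (ler_wpM2l (ltW et0) r2)); rewrite mulrC; apply: ler_wpM2l; first by rewrite addr_ge0 ?sqr_ge0.
    by move: etd deta eta1; clear; lra.
  have : kap * (h1 ^+ 2 + h2 ^+ 2) <= (h1 ^+ 2 + h2 ^+ 2) / 16.
    rewrite mulrC; apply: ler_wpM2l; first by rewrite addr_ge0 ?sqr_ge0.
    by move: kapE eta1; clear; lra.
  by move: v0 v1 v2 v3 v4 (addr_ge0 (sqr_ge0 h1) (sqr_ge0 h2)); clear; lra.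
have [yy1 yy2] : `|y11| <= A /\ `|y22| <= A.
  have := BA 1 0; have := BA 0 1; rewrite /B !(expr1n, expr0n)/= !(mulr0, mulr1, addr0, add0r).
  by split.
have yy3 : `|y12| <= 2 * A.
  by have := BA 1 1; rewrite /B !expr1n !mulr1; move: yy1 yy2; rewrite !ler_norml; clear; lra.
pose fV h1 h2 := V (e1 + h1) (e2 + h2) + (- c + - p1 * h1 + - p2 * h2 +
  ((- y11 - 18 * et) * h1 ^+ 2 + 2 * - y12 * h1 * h2 + (- y22 - 18 * et) * h2 ^+ 2) / 2).
have fVE h1 h2 : fV h1 h2 = V (e1 + h1) (e2 + h2) - (c + p1 * h1 + p2 * h2 + B h1 h2 / 2) - 9 * et * (h1 ^+ 2 + h2 ^+ 2).
  by rewrite /fV /B; field.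
pose D := V e1 e2 - W' e1 e2.
pose fW h1 h2 := - W' (e1 + h1) (e2 + h2) + (c + (p1 - s1) * h1 + (p2 - s2) * h2 +
  ((y11 - 18 * et) * h1 ^+ 2 + 2 * y12 * h1 * h2 + (y22 - 18 * et) * h2 ^+ 2) / 2).
have fWE h1 h2 : fW h1 h2 = - W' (e1 + h1) (e2 + h2) + (c + p1 * h1 + p2 * h2 + B h1 h2 / 2) - s1 * h1 - s2 * h2 - 9 * et * (h1 ^+ 2 + h2 ^+ 2).
  by rewrite /fW /B; field.
have fV0 : 0 - et * r ^+ 2 <= fV 0 0.
  by rewrite fVE !addr0 B0; move: V0; rewrite ler_norml expr0n/=; clear; lra.
have fW0 : D - et * r ^+ 2 <= fW 0 0.
  by rewrite fWE !addr0 B0 /D; move: V0; rewrite ler_norml expr0n/=; clear; lra.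
have fVK := semiconvex_quadratic e1 e2 (- c) (- p1) (- p2) (- y11 - 18 * et) (- y12) (- y22 - 18 * et) VK'.
have fWK := semiconvex_quadratic e1 e2 c (p1 - s1) (p2 - s2) (y11 - 18 * et) y12 (y22 - 18 * et) WK'.
have [||h1 [h2 [h1r h2r hmax]]] := interior_max _ fVK r0 et0 fV0.
- by rewrite !addr_ge0// ltW.
- by move=> k1 k2 k1r k2r; rewrite -/(fV _ _) fVE; have := H _ _ k1r k2r; rewrite ler_norml; clear; lra.
have [||k1 [k2 [k1r k2r kmax]]] := interior_max _ fWK r0 et0 fW0.
- by rewrite !addr_ge0// ltW.
- move=> g1 g2 g1r g2r; rewrite -/(fW _ _) fWE; have := H _ _ g1r g2r; have := ce (e1 + g1) (e2 + g2).
  rewrite (_ : e1 + g1 - e1 = g1); last by ring.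
  rewrite (_ : e2 + g2 - e2 = g2); last by ring.
  by rewrite ler_norml /D; clear; lra.
have r100 : r * 100 <= d by move: ret etd; clear; lra.
have near (e z h : R) : `|e - z| <= d / 8 -> `|h| < r -> `|e + h - z| <= d / 4.
  by move: r100; rewrite !ler_norml ltr_norml; clear; lra.
have u1z := near _ _ _ e1z h1r; have u2z := near _ _ _ e2z h2r.
have w1z := near _ _ _ e1z k1r; have w2z := near _ _ _ e2z k2r.
pose rho := Num.min (Num.min (r - `|h1|) (r - `|h2|)) (Num.min (r - `|k1|) (r - `|k2|)).
exists (e1 + h1), (e2 + h2), (e1 + k1), (e2 + k2),
  (p1 + y11 * h1 + y12 * h2 + 18 * et * h1), (p2 + y12 * h1 + y22 * h2 + 18 * et * h2),
  (p1 - s1 + y11 * k1 + y12 * k2 - 18 * et * k1 - 2 * kap * (e1 + k1 - z1)),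
  (p2 - s2 + y12 * k1 + y22 * k2 - 18 * et * k2 - 2 * kap * (e2 + k2 - z2)),
  y11, y12, y22, rho.
split; first by rewrite !lt_min !subr_gt0 h1r h2r k1r k2r.
have in_r (a u : R) : `|u| <= rho -> rho <= r - `|a| -> `|a + u| <= r.
  by move=> h1' h2'; rewrite (le_trans (ler_normD _ _))//; move: h1' h2'; clear; lra.
have [rh1 rh2 rk1 rk2] : [/\ rho <= r - `|h1|, rho <= r - `|h2|, rho <= r - `|k1| & rho <= r - `|k2|].
  by split; rewrite /rho !ge_min lexx ?orbT.
have et9 : 0 <= eta - 9 * et - kap by move: etd deta kapE kap0 et0 d0; clear; lra.
split.
- have d4 : d / 4 <= eta by move: deta d0; clear; lra.
  by split; apply: le_trans d4.
- have {}et9 : 0 <= eta - 9 * et by move: et9 kap0; clear; lra.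
  move=> g1 g2 g1r g2r; have := hmax (h1 + g1) (h2 + g2) (in_r _ _ g1r rh1) (in_r _ _ g2r rh2).
  rewrite -!/(fV _ _) !fVE /B -!(addrA e1) -!(addrA e2).
  have := mulr_ge0 et9 (addr_ge0 (sqr_ge0 g1) (sqr_ge0 g2)); clear; lra.
- move=> g1 g2 g1r g2r; have := kmax (k1 + g1) (k2 + g2) (in_r _ _ g1r rk1) (in_r _ _ g2r rk2).
  rewrite -!/(fW _ _) !fWE /B /W' -!(addrA e1) -!(addrA e2).
  have := mulr_ge0 et9 (addr_ge0 (sqr_ge0 g1) (sqr_ge0 g2)); clear; lra.
- have pq (y y' g g' k k' s w : R) : `|y| <= 2 * A -> `|y'| <= 2 * A ->
      `|g| < r -> `|g'| < r -> `|k| < r -> `|k'| < r -> `|s| <= q0 -> `|w| <= d / 4 ->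
      `|y * (g - k) + y' * (g' - k') + 18 * et * (g + k) + s + 2 * kap * w| <= eta.
    move=> yA y'A gr g'r kr k'r sq wd.
    have prod (a b m n : R) : `|a| <= m -> `|b| <= n -> - (m * n) <= a * b <= m * n.
      by move=> am bn; rewrite -ler_norml normrM ler_pM.
    have gk : `|g - k| <= 2 * r by rewrite (le_trans (ler_normB _ _))//; move: gr kr; clear; lra.
    have gk' : `|g' - k'| <= 2 * r by rewrite (le_trans (ler_normB _ _))//; move: g'r k'r; clear; lra.
    have gk2 : `|g + k| <= 2 * r by rewrite (le_trans (ler_normD _ _))//; move: gr kr; clear; lra.
    have := prod _ _ _ _ yA gk; have := prod _ _ _ _ y'A gk'.
    have := prod _ _ _ _ (lexx `|18 * et|) gk2; rewrite (gtr0_norm (_ : 0 < 18 * et)) ?mulr_gt0//.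
    have := prod _ _ _ _ (lexx `|2 * kap|) wd; rewrite (gtr0_norm (_ : 0 < 2 * kap)) ?mulr_gt0//.
    have : A * r <= A * et by rewrite ler_pM2l.
    have : et * r <= et by rewrite ger_pMr//; move: r100 deta eta1; clear; lra.
    have : kap * d <= d / 16.
      rewrite [leRHS]mulrC ler_pM2r//; move: kapE eta1; clear; lra.
    by move: sq q0le etE etd d0 deta; rewrite !ler_norml; clear; lra.
  have [yy1' yy2'] : `|y11| <= 2 * A /\ `|y22| <= 2 * A.
    by move: yy1 yy2 A0; clear=> *; split; lra.
  split.
  + rewrite (_ : _ - _ = y11 * (h1 - k1) + y12 * (h2 - k2) + 18 * et * (h1 + k1) + s1 + 2 * kap * (e1 + k1 - z1)); last by ring.
    exact: pq.
  + rewrite (_ : _ - _ = y22 * (h2 - k2) + y12 * (h1 - k1) + 18 * et * (h2 + k2) + s2 + 2 * kap * (e2 + k2 - z2)); last by ring.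
    exact: pq.
  + have lin (q x : R) : `|x| <= d / 4 -> - (`|q| * d) <= q * x.
      by move=> xd; rewrite lerNl (le_trans (ler_norm _))// normrN normrM ler_wpM2l// (le_trans xd)//; move: d0; clear; lra.
    have sq (x : R) : `|x| <= d / 4 -> K * x ^+ 2 <= K * d / 2.
      rewrite -mulrA ler_norml => xd; rewrite ler_pM2l//; move: xd deta d0 eta1; clear; nra.
    have := P (e1 + h1) (e2 + h2); have := Q (e1 + k1) (e2 + k2).
    have := lin P1 _ u1z; have := lin P2 _ u2z; have := lin Q1 _ w1z; have := lin Q2 _ w2z.
    have := sq _ u1z; have := sq _ u2z; have := sq _ w1z; have := sq _ w2z.
    by rewrite -dL /L; move: K0 d0 (mulr_gt0 K0 d0); clear; lra.
- by move=> g1 g2; rewrite -BE -AE.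
Qed.
End jets.

(** * The test function *)

Section oblique.
Variable R : realType.
Implicit Types k : R -> R.

Definition oblique (al : R) k :=
  k 0 = 0 /\ forall s t, s <= t -> 0 <= k t - k s <= al * (t - s).

Definition l1cost k1 k2 (M z1 z2 y1 y2 : R) := (`|y1| + `|y2|) ^+ 2 / 2
  + k1 y2 * (z1 - y1) + k2 y1 * (z2 - y2) + M / 2 * ((z1 - y1) ^+ 2 + (z2 - y2) ^+ 2).

Definition l1argmin k1 k2 M z1 z2 y1 y2 :=
  forall x1 x2, l1cost k1 k2 M z1 z2 y1 y2 <= l1cost k1 k2 M z1 z2 x1 x2.

(** The derivative of [l1cost] in [z1] for fixed [y]. At a minimizer [y] it is a slope of the value
    function from above. *)
Definition l1slope (k : R -> R) (M z1 y1 y2 : R) := k y2 + M * (z1 - y1).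

(** The cost is unchanged when [z] and [y] change sign and both nonlinearities are reflected, so one
    sign of each coordinate suffices. *)
Definition reflect k := fun t => - k (- t).

Lemma oblique_lip al k s t : oblique al k -> `|k t - k s| <= al * `|t - s|.
Proof.
move=> [_ ok]; have [st|ts] := leP s t.
  by have /andP[h1 h2] := ok _ _ st; rewrite (ger0_norm h1) ger0_norm// subr_ge0.
have /andP[h1 h2] := ok _ _ (ltW ts).
by rewrite distrC (distrC t) (ger0_norm h1) ger0_norm// subr_ge0 ltW.
Qed.

Lemma oblique_bound al k t : oblique al k -> `|k t| <= al * `|t|.
Proof. by move=> ok; have := oblique_lip 0 t ok; case: ok => -> _; rewrite !subr0. Qed.

Lemma oblique_reflect al k : oblique al k -> oblique al (reflect k).
Proof.
move=> [k0 ok]; split; first by rewrite /reflect oppr0 k0 oppr0.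
by move=> s t st; have := ok (- t) (- s); rewrite lerN2 /reflect => /(_ st); lra.
Qed.

Lemma l1argmin_reflect k1 k2 M z1 z2 y1 y2 : l1argmin k1 k2 M z1 z2 y1 y2 ->
  l1argmin (reflect k1) (reflect k2) M (- z1) (- z2) (- y1) (- y2).
Proof.
have E k1' k2' z1' z2' x1 x2 : l1cost (reflect k1') (reflect k2') M (- z1') (- z2') x1 x2 =
    l1cost k1' k2' M z1' z2' (- x1) (- x2).
  by rewrite /l1cost /reflect !normrN; ring.
by move=> H x1 x2; rewrite !E !opprK; exact: H.
Qed.

Lemma l1argmin_swap k1 k2 M z1 z2 y1 y2 : l1argmin k1 k2 M z1 z2 y1 y2 ->
  l1argmin k2 k1 M z2 z1 y2 y1.
Proof.
have E k1' k2' z1' z2' x1 x2 : l1cost k2' k1' M z2' z1' x2 x1 = l1cost k1' k2' M z1' z2' x1 x2.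
  by rewrite /l1cost; ring.
by move=> H x1 x2; rewrite E [leRHS]E; exact: H.
Qed.

Lemma l1slope_reflect k M z1 y1 y2 : l1slope (reflect k) M (- z1) (- y1) (- y2) = - l1slope k M z1 y1 y2.
Proof. by rewrite /l1slope /reflect opprK; ring. Qed.

Lemma le_of_small (a b c t0 : R) : 0 < t0 -> (forall t, 0 < t -> t <= t0 -> a <= b + c * t) -> a <= b.
Proof.
move=> t00 H; rewrite leNgt; apply/negP => ba.
pose t := Num.min t0 ((a - b) / (2 * (`|c| + 1))).
have c1 : 0 < 2 * (`|c| + 1) by rewrite mulr_gt0// ltr_wpDl.
have tp : 0 < t by rewrite lt_min t00 divr_gt0// subr_gt0.
have tt0 : t <= t0 by rewrite ge_min lexx.
have : t <= (a - b) / (2 * (`|c| + 1)) by rewrite ge_min lexx orbT.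
rewrite ler_pdivlMr// => tab.
have := H t tp tt0; have := ler_wpM2r (ltW tp) (ler_norm c); have := mulr_ge0 (ltW tp) (normr_ge0 c); lra.
Qed.

Section argmin.
Variables (k1 k2 : R -> R) (al M z1 z2 y1 y2 : R).
Hypotheses (al0 : 0 <= al) (al1 : al < 1) (M0 : 0 <= M).
Hypotheses (ok1 : oblique al k1) (ok2 : oblique al k2).
Hypothesis ymin : l1argmin k1 k2 M z1 z2 y1 y2.
Let g1 := l1slope k1 M z1 y1 y2.
Let N := `|y1| + `|y2|.

(** The first order condition in [y1], kept as a finite difference because neither [k2] nor the l1
    norm need be differentiable. *)
Lemma l1argmin_step t : g1 * t <= ((`|y1 + t| + `|y2|) ^+ 2 - N ^+ 2) / 2
  + al * `|t| * `|z2 - y2| + M / 2 * t ^+ 2.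
Proof.
have : (k2 (y1 + t) - k2 y1) * (z2 - y2) <= al * `|t| * `|z2 - y2|.
  apply: (le_trans (ler_norm _)); rewrite normrM ler_wpM2r//.
  by have := oblique_lip y1 (y1 + t) ok2; rewrite addrAC subrr add0r.
by have := ymin (y1 + t) y2; rewrite /l1cost /g1 /l1slope /N; lra.
Qed.

Lemma l1slope_le : 0 <= y1 -> g1 <= N + al * `|z2 - y2|.
Proof.
move=> y10; apply: (@le_of_small _ _ ((M + 1) / 2) 1) => // t t0 _.
have := l1argmin_step t; rewrite (gtr0_norm t0) (ger0_norm (_ : 0 <= y1 + t)); last by rewrite addr_ge0// ltW.
rewrite /N (ger0_norm y10) => h; rewrite -(ler_pM2r t0); lra.
Qed.

Lemma l1slope_ge : 0 < y1 -> N - al * `|z2 - y2| <= g1.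
Proof.
move=> y10; apply: (@le_of_small _ _ ((M + 1) / 2) y1) => // t t0 ty.
have := l1argmin_step (- t); rewrite normrN (gtr0_norm t0) (ger0_norm (_ : 0 <= y1 - t)) ?subr_ge0//.
rewrite /N (gtr0_norm y10) => h; rewrite -(ler_pM2r t0); lra.
Qed.
End argmin.

Section slopes.
Variables (al : R).
Hypotheses (al0 : 0 <= al) (al1 : al < 1).
(** [M] keeps minimizers within [th * N] of [z] in each coordinate, and [th] is small enough that
    errors [2 * th * N] leave most of the margin [(1 - al) * N]. *)
Let M : R := 1 + 16 / (1 - al).
Let th : R := (1 - al) / 8.

Lemma M_ge : 17 <= M.
Proof.
have [al0' al1'] := (al0, al1).
have : 16 <= 16 / (1 - al) by rewrite ler_pdivlMr ?subr_gt0//; lra.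
by rewrite /M; lra.
Qed.

Lemma M_th : (M - 1) * th = 2.
Proof. by rewrite /M /th; field; rewrite gt_eqF// subr_gt0. Qed.

Lemma l1slope_norm k1 k2 z1 z2 y1 y2 : oblique al k1 -> oblique al k2 ->
  l1argmin k1 k2 M z1 z2 y1 y2 -> `|l1slope k1 M z1 y1 y2| <= `|y1| + `|y2| + al * `|z2 - y2|.
Proof.
have [al0' al1'] := (al0, al1).
have M0 : 0 <= M by have := M_ge; lra.
have gt0 (k k' : R -> R) x1 x2 u1 u2 : oblique al k -> oblique al k' -> l1argmin k k' M x1 x2 u1 u2 ->
    0 <= u1 -> `|l1slope k M x1 u1 u2| <= `|u1| + `|u2| + al * `|x2 - u2|.
  move=> ok ok' umin u0; rewrite ler_norml (l1slope_le ok' umin u0) andbT.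
  have := u0; rewrite le_eqVlt => /predU1P[u00|u1_gt0].
    have := l1slope_le (oblique_reflect ok') (l1argmin_reflect umin).
    rewrite l1slope_reflect !normrN -u00 oppr0 -opprD normrN => /(_ (lexx _)); lra.
  have := l1slope_ge ok' umin u1_gt0.
  by have := normr_ge0 u1; have := normr_ge0 u2; lra.
move=> ok1 ok2 ymin; have [y10|y10] := leP 0 y1; first exact: gt0 ymin y10.
have := gt0 _ _ _ _ _ _ (oblique_reflect ok1) (oblique_reflect ok2) (l1argmin_reflect ymin).
by rewrite l1slope_reflect !normrN -opprD normrN; apply; lra.
Qed.

(** The displacements [a], [b] satisfy M a <= 2 N + b and M b <= 2 N + a, so the larger one is at
    most 2 N / (M - 1) = th N. *)
Lemma l1argmin_dist k1 k2 z1 z2 y1 y2 : oblique al k1 -> oblique al k2 ->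
  l1argmin k1 k2 M z1 z2 y1 y2 ->
  `|z1 - y1| <= th * (`|y1| + `|y2|) /\ `|z2 - y2| <= th * (`|y1| + `|y2|).
Proof.
have [al0' al1'] := (al0, al1).
move=> ok1 ok2 ymin.
have M0 : 0 <= M by have := M_ge; lra.
have bd (k k' : R -> R) x1 x2 u1 u2 : oblique al k -> oblique al k' -> l1argmin k k' M x1 x2 u1 u2 ->
    M * `|x1 - u1| <= 2 * (`|u1| + `|u2|) + `|x2 - u2|.
  move=> ok ok' umin; have := l1slope_norm ok ok' umin; have := oblique_bound u2 ok.
  have : `|M * (x1 - u1)| <= `|l1slope k M x1 u1 u2| + `|k u2|.
    by rewrite (_ : M * _ = l1slope k M x1 u1 u2 - k u2) ?ler_normB// /l1slope; ring.
  rewrite normrM (ger0_norm M0).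
  have : al * `|u2| <= `|u2| by rewrite ler_piMl// ltW.
  have : al * `|x2 - u2| <= `|x2 - u2| by rewrite ler_piMl// ltW.
  have := normr_ge0 u1; lra.
have h1 := bd _ _ _ _ _ _ ok1 ok2 ymin.
have h2 := bd _ _ _ _ _ _ ok2 ok1 (l1argmin_swap ymin).
have M1 : 0 < M - 1 by have := M_ge; lra.
have key (a b n : R) : 0 <= n -> M * a <= 2 * n + b -> M * b <= 2 * n + a -> a <= th * n.
  move=> n0 ha hb; rewrite -(ler_pM2l M1) mulrA M_th.
  have [ab|ba] := leP b a; first by lra.
  have : (M - 1) * a <= (M - 1) * b by rewrite ler_pM2l// ltW.
  by lra.
by split; [apply: key h1 _|apply: (key _ `|z1 - y1|)] => //; lra.
Qed.

Lemma l1slope_oblique_pos k1 k2 z1 z2 y1 y2 : oblique al k1 -> oblique al k2 ->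
  l1argmin k1 k2 M z1 z2 y1 y2 -> 0 <= z1 ->
  0 <= l1slope k1 M z1 y1 y2 - k1 (l1slope k2 M z2 y2 y1) <= 8 * M / (1 - al) * z1.
Proof.
have [al0' al1'] := (al0, al1).
move=> ok1 ok2 ymin z10.
have M17 := M_ge; have M0 : 0 <= M by lra.
have [d1 d2] := l1argmin_dist ok1 ok2 ymin.
have n1 := l1slope_norm ok1 ok2 ymin.
have n2 := l1slope_norm ok2 ok1 (l1argmin_swap ymin).
set g1 := l1slope k1 M z1 y1 y2 in n1 *; set g2 := l1slope k2 M z2 y2 y1 in n2 *.
set N := `|y1| + `|y2| in d1 d2 n1; rewrite (addrC `|y2|) -/N in n2.
have N0 : 0 <= N by rewrite addr_ge0.
have C0 : M + 1 <= 8 * M / (1 - al).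
  by rewrite ler_pdivlMr; nra.
have thal : al * th <= th by rewrite ler_piMl// ?ltW// /th; lra.
have ad1 : al * `|z1 - y1| <= th * N.
  by apply: le_trans d1; rewrite ler_piMl// ltW.
have ad2 : al * `|z2 - y2| <= th * N.
  by apply: le_trans d2; rewrite ler_piMl// ltW.
have k12 := oblique_bound y2 ok1.
have k1y2 : `|k1 y2| <= al * N.
  by apply: (le_trans k12); rewrite ler_wpM2l// /N lerDr.
have g1E : g1 - k1 y2 = M * (z1 - y1) by rewrite /g1 /l1slope; ring.
have [y10|y10|y10] := ltgtP y1 0.
(* Here the slope would be at most about [- N], whereas [z1 - y1 > 0] makes it exceed [k1 y2], which
   is at least [- al * N]. *)
- exfalso.
  have N_gt0 : 0 < N by rewrite /N (ltr0_norm y10); have := normr_ge0 y2; lra.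
  have := l1slope_ge (oblique_reflect ok2) (l1argmin_reflect ymin) (_ : 0 < - y1).
  rewrite l1slope_reflect oppr_gt0 !normrN -opprD normrN -/g1 -/N => /(_ y10).
  have : 0 < M * (z1 - y1) by rewrite mulr_gt0//; lra.
  rewrite -g1E; move: k1y2; rewrite ler_norml => /andP[+ _].
  have : 0 < (1 - al) * N by rewrite mulr_gt0// subr_gt0.
  by rewrite /th in ad2; lra.
(* Now [g1] is about [N] and beats [k1 g2]. For the upper bound, [M * z1] exceeds [g1 - k1 y2],
   hence a fixed fraction of [N]: the point [z1] cannot be small compared with [N]. *)
- have gN := l1slope_ge ok2 ymin y10; rewrite -/g1 -/N in gN.
  have k1g2 := oblique_bound g2 ok1.
  have : al * `|g2| <= al * (N + th * N) by rewrite ler_wpM2l//; lra.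
  have : al * (N + th * N) <= al * N + th * N.
    by rewrite mulrDr lerD2l mulrA ler_wpM2r.
  have aN : 0 <= (1 - al) * N by rewrite mulr_ge0// subr_ge0 ltW.
  have alN : al * N <= N by rewrite ler_piMl// ltW.
  move: k1g2; rewrite ler_norml => /andP[l1 l2] l3 l4; apply/andP; split.
    by rewrite /th in ad2 l3 l4; lra.
  apply: (@le_trans _ _ (4 * N)).
    by move: n1; rewrite ler_norml /th in ad2 l3 l4 *; lra.
  rewrite mulrAC ler_pdivlMr ?subr_gt0//.
  have : (1 - al) * N / 2 <= M * z1.
    have : M * (z1 - y1) <= M * z1 by rewrite ler_wpM2l//; lra.
    by rewrite -g1E; move: k1y2; rewrite ler_norml /th in ad2 l3 l4 *; lra.
  lra.
(* [g1 - k1 y2] is exactly [M * z1]; since [g2] is within [al * z1] of [y2], replacing [k1 y2] by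
   [k1 g2] costs at most [z1]. *)
- rewrite y10 subr0 in g1E.
  have g2y2 : `|g2 - y2| <= al * z1.
    have E : N = `|y2| by rewrite /N y10 normr0 add0r.
    rewrite y10 subr0 (ger0_norm z10) in n2 ad1.
    have [y20|y20|y20] := ltgtP y2 0.
    + have := l1slope_ge (oblique_reflect ok1) (l1argmin_reflect (l1argmin_swap ymin)) (_ : 0 < - y2).
      rewrite l1slope_reflect oppr_gt0 !normrN -opprD normrN -/g2 y10 subr0 normr0 addr0 => /(_ y20).
      move: n2; rewrite E (ltr0_norm y20) (ger0_norm z10) !ler_norml; lra.
    + have := l1slope_ge ok1 (l1argmin_swap ymin) y20.
      rewrite -/g2 y10 subr0 normr0 addr0; move: n2; rewrite E (gtr0_norm y20) (ger0_norm z10) !ler_norml; lra.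
    + by move: n2; rewrite E y20 normr0 add0r subr0.
  have := oblique_lip y2 g2 ok1 => k1g.
  have {}k1g : `|k1 g2 - k1 y2| <= z1.
    apply: (le_trans k1g); apply: (@le_trans _ _ (al * (al * z1))); first by rewrite ler_wpM2l.
    by rewrite mulrA ler_piMl// mulr_ile1// ltW.
  have Mz : 1 * z1 <= M * z1 by rewrite ler_wpM2r//; lra.
  have : (M + 1) * z1 <= 8 * M / (1 - al) * z1 by rewrite ler_wpM2r.
  by move: k1g; rewrite ler_norml; lra.
Qed.

Lemma l1slope_oblique_neg k1 k2 z1 z2 y1 y2 : oblique al k1 -> oblique al k2 ->
  l1argmin k1 k2 M z1 z2 y1 y2 -> z1 <= 0 ->
  8 * M / (1 - al) * z1 <= l1slope k1 M z1 y1 y2 - k1 (l1slope k2 M z2 y2 y1) <= 0.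
Proof.
have [al0' al1'] := (al0, al1).
move=> ok1 ok2 ymin z10.
have := l1slope_oblique_pos (oblique_reflect ok1) (oblique_reflect ok2) (l1argmin_reflect ymin).
by rewrite oppr_ge0 !l1slope_reflect /reflect !opprK => /(_ z10); lra.
Qed.
End slopes.
End oblique.

Section test_function.
Variable R : realType.

Lemma oblique_continuous (al : R) k : oblique al k -> continuous k.
Proof.
move=> ok x; apply/cvgrPdist_lt => e e0.
have al0 : 0 < `|al| + 1 by rewrite ltr_wpDl.
near=> y.
apply: (le_lt_trans (oblique_lip y x ok)); apply: (@le_lt_trans _ _ ((`|al| + 1) * `|x - y|)).
  by rewrite ler_wpM2r//; have := ler_norm al; lra.
rewrite mulrC -ltr_pdivlMr//.
near: y; apply: cvgr_dist_lt; [exact: cvg_id|exact: divr_gt0].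
Unshelve. all: by end_near. Qed.

Lemma l1cost_continuous (al : R) k1 k2 (M z1 z2 : R) : oblique al k1 -> oblique al k2 ->
  continuous (fun y : R * R => l1cost k1 k2 M z1 z2 y.1 y.2).
Proof.
move=> /oblique_continuous c1 /oblique_continuous c2 y.
have f1 : {for y, continuous (fun y : R * R => y.1)} by exact: cvg_fst.
have f2 : {for y, continuous (fun y : R * R => y.2)} by exact: cvg_snd.
have n1 : {for y, continuous (fun y : R * R => `|y.1|)} by exact: (continuous_comp f1 (@norm_continuous _ _ _)).
have n2 : {for y, continuous (fun y : R * R => `|y.2|)} by exact: (continuous_comp f2 (@norm_continuous _ _ _)).
have h1 : {for y, continuous (fun y : R * R => k1 y.2)} by exact: (continuous_comp f2 (c1 _)).
have h2 : {for y, continuous (fun y : R * R => k2 y.1)} by exact: (continuous_comp f1 (c2 _)).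
have d1 : {for y, continuous (fun y : R * R => z1 - y.1)} by apply: cvgB => //; exact: cvg_cst.
have d2 : {for y, continuous (fun y : R * R => z2 - y.2)} by apply: cvgB => //; exact: cvg_cst.
have s1 : {for y, continuous (fun y : R * R => (`|y.1| + `|y.2|) * (`|y.1| + `|y.2|))}.
  by apply: cvgM; apply: cvgD.
rewrite /l1cost; apply: cvgD; [apply: cvgD; [apply: cvgD|]|].
- by apply: cvgM; [exact: s1|exact: cvg_cst].
- exact: cvgM.
- exact: cvgM.
- by apply: cvgM; [exact: cvg_cst|apply: cvgD; exact: cvgM].
Qed.

Lemma l1argmin_exists (al : R) k1 k2 (M z1 z2 : R) : 0 <= al -> al < 1 -> 17 <= M ->
  oblique al k1 -> oblique al k2 -> exists y : R * R, l1argmin k1 k2 M z1 z2 y.1 y.2.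
Proof.
move=> al0 al1 M17 ok1 ok2.
pose Z : R := `|z1| + `|z2|.
have Z0 : 0 <= Z by rewrite addr_ge0.
(* The competitor [y = z] costs [Z ^+ 2 / 2]. Outside this box the first term alone is at least
   [2 * Z ^+ 2]; half of it, with the term in [M], absorbs the cross terms. *)
pose rho : R := 2 * Z.
have rho0 : - rho <= rho by rewrite /rho; lra.
pose B := `[(- rho), rho] `*` `[(- rho), rho].
have cB : compact B by apply: compact_setX; exact: segment_compact.
have BE (x : R * R) : B x <-> `|x.1| <= rho /\ `|x.2| <= rho by rewrite /B/= !in_itv/= !ler_norml.
have Bz : B (z1, z2).
  by apply/BE; rewrite /rho /Z/=; have := normr_ge0 z1; have := normr_ge0 z2; lra.
have [|y By ymin] := compact_EVT_min (ex_intro _ _ Bz) cB (f := fun y : R * R => l1cost k1 k2 M z1 z2 y.1 y.2).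
  by apply: continuous_subspaceT; exact: (l1cost_continuous ok1 ok2).
exists y => x1 x2; have [xB|xB] := pselect (B (x1, x2)).
  by apply: (ymin (x1, x2)); rewrite inE.
apply: (le_trans (ymin (z1, z2) _)); first by rewrite inE.
rewrite /= {1}/l1cost !subrr expr0n/= !mulr0 !addr0 -/Z /l1cost.
have N2 : rho <= `|x1| + `|x2|.
  rewrite leNgt; apply/negP => h; apply: xB; apply/BE => /=.
  by have := normr_ge0 x1; have := normr_ge0 x2; lra.
have b (k : R -> R) (u d : R) : oblique al k -> - (`|u| * `|d|) <= k u * d.
  move=> ok; rewrite lerNl (le_trans (ler_norm _))// normrN normrM ler_wpM2r//.
  by apply: (le_trans (oblique_bound u ok)); rewrite ler_piMl// ltW.
have := b _ x2 (z1 - x1) ok1; have := b _ x1 (z2 - x2) ok2.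
rewrite -(real_normK (num_real (z1 - x1))) -(real_normK (num_real (z2 - x2))).
move: N2; rewrite /rho; move: `|z1 - x1| `|z2 - x2| `|x1| `|x2| (normr_ge0 x1) (normr_ge0 x2).
move=> p q a b' a0 b0 N2 h1 h2.
have : 17 * (p ^+ 2 + q ^+ 2) <= M * (p ^+ 2 + q ^+ 2) by rewrite ler_wpM2r ?addr_ge0 ?sqr_ge0.
have : (2 * Z) ^+ 2 <= (a + b') ^+ 2 by rewrite ler_pXn2r ?nnegrE ?addr_ge0 ?mulr_ge0.
have := sqr_ge0 (b' - 2 * p); have := sqr_ge0 (a - 2 * q).
have := sqr_ge0 p; have := sqr_ge0 q; have := mulr_ge0 a0 b0.
have := sqr_ge0 Z; lra.
Qed.

(** A minimum of quadratics in [z] with a common leading part lies below the one selected at each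
    point, which gives the paraboloid bound. Growth follows since each coordinate of the minimizer
    is within N / 8 of that of [z]. *)
Lemma test_function (al : R) k1 k2 : 0 <= al -> al < 1 -> oblique al k1 -> oblique al k2 ->
  exists (psi g1 g2 : R -> R -> R) (M C : R), [/\ 0 < M, 0 < C & forall z1 z2,
  [/\ forall x1 x2, psi x1 x2 <= psi z1 z2 + g1 z1 z2 * (x1 - z1) + g2 z1 z2 * (x2 - z2)
        + M / 2 * ((x1 - z1) ^+ 2 + (x2 - z2) ^+ 2),
      psi 0 0 <= 0 /\ (`|z1| + `|z2|) ^+ 2 / 16 <= psi z1 z2,
      `|g1 z1 z2| <= 4 * (`|z1| + `|z2|) /\ `|g2 z1 z2| <= 4 * (`|z1| + `|z2|),
      (0 <= z1 -> 0 <= g1 z1 z2 - k1 (g2 z1 z2) <= C * z1) /\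
      (z1 <= 0 -> C * z1 <= g1 z1 z2 - k1 (g2 z1 z2) <= 0) &
      (0 <= z2 -> 0 <= g2 z1 z2 - k2 (g1 z1 z2) <= C * z2) /\
      (z2 <= 0 -> C * z2 <= g2 z1 z2 - k2 (g1 z1 z2) <= 0)]].
Proof.
move=> al0 al1 ok1 ok2.
pose M := 1 + 16 / (1 - al).
have M17 : 17 <= M := M_ge al0 al1.
have /choice[Y YP] : forall z : R * R, exists y : R * R, l1argmin k1 k2 M z.1 z.2 y.1 y.2.
  by move=> z; exact: l1argmin_exists al0 al1 M17 ok1 ok2.
have [Y1 [Y2 {}YP]] : exists Y1 Y2 : R -> R -> R, forall z1 z2, l1argmin k1 k2 M z1 z2 (Y1 z1 z2) (Y2 z1 z2).
  by exists (fun z1 z2 => (Y (z1, z2)).1), (fun z1 z2 => (Y (z1, z2)).2) => z1 z2; exact: (YP (z1, z2)).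
pose psi z1 z2 := l1cost k1 k2 M z1 z2 (Y1 z1 z2) (Y2 z1 z2).
pose g1 z1 z2 := l1slope k1 M z1 (Y1 z1 z2) (Y2 z1 z2).
pose g2 z1 z2 := l1slope k2 M z2 (Y2 z1 z2) (Y1 z1 z2).
exists psi, g1, g2, M, (8 * M / (1 - al)); split.
- by lra.
- by rewrite divr_gt0 ?subr_gt0// mulr_gt0//; lra.
move=> z1 z2; have ymin := YP z1 z2; have ymin' := l1argmin_swap ymin.
rewrite /psi /g1 /g2; set y1 := Y1 z1 z2 in ymin ymin' *; set y2 := Y2 z1 z2 in ymin ymin' *.
have [d1 d2] := l1argmin_dist al0 al1 ok1 ok2 ymin.
have n1 := l1slope_norm al0 al1 ok1 ok2 ymin; have n2 := l1slope_norm al0 al1 ok2 ok1 ymin'.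
have N0 : 0 <= `|y1| + `|y2| by rewrite addr_ge0.
have dle (d : R) : `|d| <= (1 - al) / 8 * (`|y1| + `|y2|) -> `|d| <= (`|y1| + `|y2|) / 8.
  by move=> /le_trans; apply; rewrite mulrC ler_wpM2l//; lra.
have {}d1 := dle _ d1; have {}d2 := dle _ d2.
have t1 : `|y1| <= `|z1| + `|z1 - y1|.
  by rewrite -{1}(subKr z1 y1) (le_trans (ler_normB _ _))// lerD2l.
have t2 : `|y2| <= `|z2| + `|z2 - y2|.
  by rewrite -{1}(subKr z2 y2) (le_trans (ler_normB _ _))// lerD2l.
have t3 : `|z1| <= `|y1| + `|z1 - y1|.
  by rewrite -{1}(subrK y1 z1) (le_trans (ler_normD _ _))// addrC.
have t4 : `|z2| <= `|y2| + `|z2 - y2|.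
  by rewrite -{1}(subrK y2 z2) (le_trans (ler_normD _ _))// addrC.
have ad1 : al * `|z1 - y1| <= `|z1 - y1| by rewrite ler_piMl// ltW.
have ad2 : al * `|z2 - y2| <= `|z2 - y2| by rewrite ler_piMl// ltW.
split.
- move=> x1 x2; apply: (le_trans (YP x1 x2 y1 y2)).
  by rewrite /l1cost /l1slope le_eqVlt; apply/orP; left; apply/eqP; field.
- split.
    by apply: (le_trans (YP 0 0 0 0)); rewrite /l1cost !subrr normr0 addr0 !mulr0 expr0n/=; clear; lra.
  rewrite /l1cost.
  have b (k : R -> R) (u d : R) : oblique al k -> - (`|u| * `|d|) <= k u * d.
    move=> ok; rewrite lerNl (le_trans (ler_norm _))// normrN normrM ler_wpM2r//.
    by apply: (le_trans (oblique_bound u ok)); rewrite ler_piMl// ltW.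
  have := b _ y2 (z1 - y1) ok1; have := b _ y1 (z2 - y2) ok2.
  have : 0 <= M / 2 * ((z1 - y1) ^+ 2 + (z2 - y2) ^+ 2).
    by rewrite mulr_ge0 ?addr_ge0 ?sqr_ge0//; move: M17; clear; lra.
  have : `|y1| * `|z2 - y2| <= `|y1| * ((`|y1| + `|y2|) / 8) by rewrite ler_wpM2l.
  have : `|y2| * `|z1 - y1| <= `|y2| * ((`|y1| + `|y2|) / 8) by rewrite ler_wpM2l.
  have : (`|z1| + `|z2|) ^+ 2 <= (5 / 4 * (`|y1| + `|y2|)) ^+ 2.
    by rewrite ler_pXn2r ?nnegrE ?addr_ge0 ?mulr_ge0//; move: t3 t4 d1 d2; clear; lra.
  have := sqr_ge0 (`|y1| + `|y2|).
  by clear; lra.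
- by split; [move: n1|move: n2]; move: d1 d2 t1 t2 t3 t4 ad1 ad2; clear; lra.
- by split; [exact: l1slope_oblique_pos|exact: l1slope_oblique_neg].
- by split; [exact: l1slope_oblique_pos|exact: l1slope_oblique_neg].
Qed.
End test_function.

(** * Convex boundary nonlinearities *)

Section convex.
Variable R : realType.
Implicit Types h : R -> R.

Lemma convex_chord h x y z : convex_function [set: R^o] h -> x < y -> y < z ->
  (h y - h x) * (z - y) <= (h z - h y) * (y - x).
Proof.
move=> hc xy yz.
have xz : 0 < z - x by rewrite subr_gt0 (lt_trans xy).
pose t := (y - x) / (z - x).
have t0 : 0 <= t by rewrite divr_ge0 ?subr_ge0 ?ltW// (lt_trans xy).
have t1 : t <= 1 by rewrite ler_pdivrMr// mul1r lerD2r ltW.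
have := hc (Itv01 t0 t1) z x (mem_set I) (mem_set I); rewrite !convRE /= /unstable.onem.
rewrite [X in h X](_ : _ = y); last first.
  by rewrite -[LHS]/(t * z + (1 - t) * x) /t; field; rewrite gt_eqF.
rewrite -(ler_pM2r xz) mulrDl mulrAC {1}/t divfK ?gt_eqF//.
have -> : (1 - t) * h x * (z - x) = (z - y) * h x by rewrite /t; field; rewrite gt_eqF.
by lra.
Qed.

Definition chord h x y := (h y - h x) / (y - x).

Lemma chord_le h x y z : convex_function [set: R^o] h -> x < y -> y < z -> chord h x y <= chord h y z.
Proof.
move=> hc xy yz; rewrite /chord ler_pdivrMr ?subr_gt0// mulrAC ler_pdivlMr ?subr_gt0//.
exact: convex_chord.
Qed.

Lemma chord_mono h x y z : convex_function [set: R^o] h -> x < y -> y < z -> chord h x y <= chord h x z <= chord h y z.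
Proof.
move=> hc xy yz; have := convex_chord hc xy yz; have xz := lt_trans xy yz.
move=> H; rewrite /chord; apply/andP; split.
  by rewrite ler_pdivrMr ?subr_gt0// mulrAC ler_pdivlMr ?subr_gt0//; lra.
by rewrite ler_pdivrMr ?subr_gt0// mulrAC ler_pdivlMr ?subr_gt0//; lra.
Qed.

Definition kink h (u : R) := exists a b : R, [/\ a < b, forall x, x < u -> chord h x u <= a &
  forall y, u < y -> b <= chord h u y].

(* Distinct kinks are separated by rationals: the slope jumps are disjoint intervals. *)
Lemma countable_kink h : countable [set u | kink h u].
Proof.
have /choice[q qP] : forall u, exists q : rat, kink h u ->
    (forall x, x < u -> chord h x u < ratr q) /\ (forall y, u < y -> ratr q < chord h u y).
  move=> u; have [[a [b [ab xa yb]]]|nk] := pselect (kink h u); last by exists 0.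
  have [q] := rat_in_itvoo ab; rewrite inE/= => /andP[aq qb]; exists q => _; split.
  - by move=> x /xa /le_lt_trans; exact.
  - by move=> y /yb; exact: lt_le_trans.
apply/countable_injP; exists (pickle \o q) => u w; rewrite !inE => ku kw /= /(pcan_inj pickleK) quw.
have [ul ur] := qP _ ku; have [wl wr] := qP _ kw.
have [uw|wu|//] := ltgtP u w.
- by have := ur _ uw; have := wl _ uw; rewrite quw => /lt_trans h1 /h1; rewrite ltxx.
- by have := wr _ wu; have := ul _ wu; rewrite quw => /lt_trans h1 /h1; rewrite ltxx.
Qed.

(** The derivative is the supremum [m] of the left chord slopes. Right chord slopes come arbitrarily
    close to [m], since a gap above [m] would be a kink. *)
Lemma derive1_chord h u : convex_function [set: R^o] h -> ~ kink h u ->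
  (forall x, x < u -> chord h x u <= derive1 h u) /\ (forall y, u < y -> derive1 h u <= chord h u y).
Proof.
move=> hc nk.
pose Q := [set chord h x u | x in [set x | x < u]].
have hQ : has_sup Q.
  split; first by exists (chord h (u - 1) u), (u - 1) => //=; rewrite ltrBlDr ltrDl.
  by exists (chord h u (u + 1)) => _ [x /= xu <-]; apply: chord_le => //; rewrite ltrDl.
pose m := sup Q.
have ml x : x < u -> chord h x u <= m by move=> xu; apply: ub_le_sup; [exact: hQ.2|exists x].
have mr y : u < y -> m <= chord h u y.
  by move=> uy; apply: ge_sup; [exact: hQ.1|move=> _ [x /= xu <-]; exact: chord_le].
suff -> : derive1 h u = m by [].
have key (e : R) : 0 < e -> exists2 d, 0 < d & forall t, t != 0 -> `|t| < d -> `|m - t^-1 * (h (t + u) - h u)| <= e.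
  move=> e0.
  have [x0 x0u x0e] : exists2 x, x < u & m - e < chord h x u.
    by have [_ [x /= xu <-] ?] := sup_adherent e0 hQ; exists x.
  have [y0 uy0 y0e] : exists2 y, u < y & chord h u y < m + e.
    apply: contrapT => ny; apply: nk; exists m, (m + e); split=> //; first by rewrite ltrDl.
    by move=> y uy; rewrite leNgt; apply/negP => hy; apply: ny; exists y.
  exists (Num.min (u - x0) (y0 - u)) => [|t t0]; first by rewrite lt_min !subr_gt0 x0u.
  rewrite lt_min ltr_norml => /andP[/andP[t1 _]]; rewrite ltr_norml => /andP[_ t2].
  have [tn|tp|tE] := ltgtP t 0; last by rewrite tE eqxx in t0.
    have -> : t^-1 * (h (t + u) - h u) = chord h (t + u) u.
      by rewrite /chord opprD addrCA subrr addr0 -mulrNN -invrN opprB mulrC.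
    have tu : t + u < u by rewrite gtrDr.
    have xtu : x0 < t + u by lra.
    have := ml _ tu; have /andP[_] := chord_mono hc xtu tu.
    by rewrite ler_norml; lra.
  have -> : t^-1 * (h (t + u) - h u) = chord h u (t + u).
    by rewrite /chord addrK mulrC.
  have ut : u < t + u by rewrite ltrDr.
  have tuy : t + u < y0 by lra.
  have := mr _ ut; have /andP[+ _] := chord_mono hc ut tuy.
  by rewrite ler_norml; lra.
rewrite /derive1; apply: cvg_lim => //; apply/cvgrPdist_le => e e0.
have [d d0 dP] := key _ e0; near=> t; apply: dP.
  by near: t; exact: nbhs_dnbhs_neq.
by near: t; exact: dnbhs0_lt.
Unshelve. all: by end_near. Qed.

Lemma ae_inhabited (P : R -> Prop) h (a b : R) : a < b -> (\forall t \ae (@lebesgue_measure R), P t) ->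
  exists u, [/\ a < u, u < b, P u & ~ kink h u].
Proof.
move=> ab [A [mA A0 sA]]; apply: contrapT => nu.
have mK : measurable [set u | kink h u] by apply: countable_measurable (countable_kink h).
have K0 := countable_lebesgue_measure0 (countable_kink h).
have sub : `]a, b[ `<=` A `|` [set u | kink h u].
  move=> u /=; rewrite in_itv/= => /andP[au ub].
  have [ku|ku] := pselect (kink h u); [by right|left].
  by apply: sA => Pu; apply: nu; exists u.
have := @le_measure _ _ _ (@lebesgue_measure R) `]a, b[%classic (A `|` [set u | kink h u]).
rewrite !inE => /(_ (measurable_itv _) (measurableU _ _ mA mK) sub).
apply/negP; rewrite -ltNge.
apply: (@le_lt_trans _ _ 0%E).
  apply: (le_trans (measureU2 _ mA mK)).
  by rewrite -[leLHS]/(lebesgue_measure A + lebesgue_measure [set u | kink h u])%E A0 K0 adde0.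
by rewrite -[ltRHS]/(lebesgue_measure `]a, b[%classic) lebesgue_measure_itv/= lte_fin ab -EFinD lte_fin subr_gt0.
Qed.

(** Chord slopes are monotone, so a chord is compared with the derivative at one good point to its
    left, for the lower bound, and at one far to its right, for the upper bound. *)
Lemma convex_oblique h (alpha : R) : convex_function [set: R^o] h ->
  (\forall t \ae (@lebesgue_measure R), 0 <= derive1 h t) ->
  ess_lim_pinfty (derive1 h) alpha ->
  forall s t, s <= t -> 0 <= h t - h s <= alpha * (t - s).
Proof.
move=> hc h0 hlim s t; rewrite le_eqVlt => /predU1P[->|st].
  by rewrite !subrr mulr0 lexx.
have ts : 0 < t - s by rewrite subr_gt0.
apply/andP; split.
  have [u [_ us u0 nk]] := @ae_inhabited _ h (s - 1) s (ltac:(lra)) h0.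
  have [_ dr] := derive1_chord hc nk.
  have : 0 <= chord h s t by apply: (le_trans u0); apply: (le_trans (dr _ us)); exact: chord_le.
  by rewrite /chord ler_pdivlMr// mul0r.
suff : chord h s t <= alpha by rewrite /chord ler_pdivrMr.
apply/ler_addgt0Pr => e e0.
have [T0 [_ HT]] := hlim e e0.
pose T := Num.max (T0 + 1) t.
have {}HT := HT T ltac:(rewrite /T lt_max ltrDl ltr01//).
have [u [Tu _ ua nk]] := @ae_inhabited _ h T (T + 1) ltac:(rewrite ltrDl ltr01//) HT.
have tu : t < u by apply: le_lt_trans Tu; rewrite le_max lexx orbT.
have [dl _] := derive1_chord hc nk.
have := ua Tu; rewrite ltr_norml => /andP[_ h1].
have := dl _ tu; have := chord_le hc st tu; lra.
Qed.
End convex.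

(** * Quadratic test functions *)

Section coordinates.
Variable R : realType.
Implicit Types (x : 'rV[R]_2) (S : set 'rV[R]_2).

Lemma sum_ord2 (F : 'I_2 -> R) : \sum_(i < 2) F i = F 0 + F 1.
Proof. by rewrite !big_ord_recl big_ord0 addr0; congr (F _ + F _); exact/val_inj. Qed.

Lemma vec2E0 (a b : R) : vec2 a b 0 0 = a.
Proof. by rewrite /vec2 mxE eqxx. Qed.

Lemma vec2E1 (a b : R) : vec2 a b 0 1 = b.
Proof. by rewrite /vec2 mxE. Qed.

Lemma vec2_eta x : x = vec2 (x 0 0) (x 0 1).
Proof.
by apply/rowP => i; rewrite mxE; case: i => -[|[|//]] i; rewrite /=; congr (x 0 _); exact/val_inj.
Qed.

Lemma nbhs_vec2 (a b : R) S : nbhs (vec2 a b) S <->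
  exists2 r : R, 0 < r & forall c d, `|c - a| < r -> `|d - b| < r -> S (vec2 c d).
Proof.
split.
  move=> /nbhs_ballP[r /= r0 H]; exists r => // c d ca db; apply: H.
  split=> // i j; rewrite ord1 /ball/= !mxE; case: ifP => _; by rewrite distrC.
move=> [r r0 H]; apply/nbhs_ballP; exists r => //= y [_ ry].
rewrite (vec2_eta y); apply: H.
  by have := ry 0 0; rewrite /ball/= vec2E0 distrC.
by have := ry 0 1; rewrite /ball/= vec2E1 distrC.
Qed.

Lemma closure_Omega (a b : R) : closure (Omega R) (vec2 a b) <-> 0 <= a /\ 0 <= b.
Proof.
split.
  move=> cl; split; rewrite leNgt; apply/negP => h.
    have [|x [[x0 _] /= xa]] := cl [set x | x 0 0 < 0]; last by have := lt_trans x0 xa; rewrite ltxx.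
    apply/nbhs_vec2; exists (- a) => [|c d]; first by rewrite oppr_gt0.
    by rewrite /= vec2E0 ltr_norml; lra.
  have [|x [[_ x0] /= xa]] := cl [set x | x 0 1 < 0]; last by have := lt_trans x0 xa; rewrite ltxx.
  apply/nbhs_vec2; exists (- b) => [|c d]; first by rewrite oppr_gt0.
  by rewrite /= vec2E1 => _; rewrite ltr_norml; lra.
move=> [a0 b0] S /nbhs_vec2[r r0 H]; exists (vec2 (a + r / 2) (b + r / 2)); split.
  by rewrite /Omega/= vec2E0 vec2E1; split; lra.
by apply: H; rewrite addrAC subrr add0r ger0_norm; lra.
Qed.

Lemma usc_on_vec2 v (a b m : R) : usc_on (closure (Omega R)) v -> 0 <= a -> 0 <= b ->
  v (vec2 a b) < m -> exists2 r : R, 0 < r & forall c d, 0 <= c -> 0 <= d ->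
    `|c - a| < r -> `|d - b| < r -> v (vec2 c d) < m.
Proof.
move=> vu a0 b0 vm.
have /nbhs_vec2[r r0 H] := vu _ ((closure_Omega a b).2 (conj a0 b0)) _ vm.
by exists r => // c d c0 d0 ca db; apply: H => //; exact/closure_Omega.
Qed.

Definition symmx (y11 y12 y22 : R) : 'M[R]_2 :=
  \matrix_(i, j) (if i == j then (if i == 0 then y11 else y22) else y12).

Lemma symmx_sym y11 y12 y22 : symmx y11 y12 y22 \is symmetricmx.
Proof.
apply/is_hermitianmxP; rewrite expr0 scale1r; apply/matrixP => i j; rewrite !mxE eq_sym.
by case: eqP => // ->.
Qed.

Lemma symmxB a b c a' b' c' : symmx a b c - symmx a' b' c' = symmx (a - a') (b - b') (c - c').
Proof. by apply/matrixP => i j; rewrite !mxE; case: ifP => // _; case: ifP. Qed.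

Lemma symmx_form a b c x : (x *m symmx a b c *m x^T) 0 0 =
  a * x 0 0 ^+ 2 + 2 * b * x 0 0 * x 0 1 + c * x 0 1 ^+ 2.
Proof.
by rewrite !mxE sum_ord2 !mxE !sum_ord2 !mxE /=; ring.
Qed.

Lemma enorm_le (p q : R) : enorm (vec2 p q) <= `|p| + `|q|.
Proof.
rewrite /enorm /dot sum_ord2 !vec2E0 !vec2E1.
rewrite -(@ger0_norm _ (`|p| + `|q|)) ?addr_ge0// -sqrtr_sqr ler_wsqrtr//.
rewrite -!expr2 -(real_normK (num_real p)) -(real_normK (num_real q)).
by have := mulr_ge0 (normr_ge0 p) (normr_ge0 q); lra.
Qed.

Lemma enorm_sqr x : enorm x ^+ 2 = x 0 0 ^+ 2 + x 0 1 ^+ 2.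
Proof.
by rewrite /enorm /dot sum_ord2 -!expr2 sqr_sqrtr// addr_ge0 ?sqr_ge0.
Qed.

Lemma opnorm_le (a b c : R) : opnorm (symmx a b c) <= `|a| + 2 * `|b| + `|c|.
Proof.
apply: ge_sup.
  exists (enorm (vec2 1 0 *m (symmx a b c)^T)), (vec2 1 0) => //=.
  have : enorm (vec2 1 0 : 'rV[R]_2) ^+ 2 = 1.
    by rewrite enorm_sqr vec2E0 vec2E1 expr1n expr0n addr0.
  by move/eqP; rewrite sqrp_eq1 ?sqrtr_ge0// => /eqP.
move=> _ [x /= x1 <-].
have := enorm_sqr x; rewrite x1 expr1n => x2.
have le1 (u w : R) : 1 = u ^+ 2 + w ^+ 2 -> `|u| <= 1.
  move=> h; rewrite -(ler_pXn2r (_ : 0 < 2)%N) ?nnegrE// expr1n real_normK ?num_real// h.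
  by rewrite lerDl sqr_ge0.
have h1 := le1 _ _ x2; have h2 := le1 _ _ (etrans x2 (addrC _ _)).
have -> : x *m (symmx a b c)^T = vec2 (a * x 0 0 + b * x 0 1) (b * x 0 0 + c * x 0 1).
  apply/rowP => i; rewrite !mxE sum_ord2 !mxE.
  by case: i => -[|[|//]] i /=; ring.
apply: (le_trans (enorm_le _ _)).
have ml (p u : R) : `|u| <= 1 -> `|p * u| <= `|p| by move=> h; rewrite normrM ler_piMr.
have := ler_normD (a * x 0 0) (b * x 0 1); have := ler_normD (b * x 0 0) (c * x 0 1).
have := ml a _ h1; have := ml b _ h1; have := ml b _ h2; have := ml c _ h2; lra.
Qed.

Lemma loewner_block (X Y : 'M[R]_2) (A11 A12 A22 : R) :
  (forall x y : 'rV[R]_2, 0 <= A11 * (x *m x^T) 0 0 + A12 * (x *m y^T) 0 0 + A12 * (y *m x^T) 0 0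
     + A22 * (y *m y^T) 0 0 - (x *m X *m x^T) 0 0 + (y *m Y *m y^T) 0 0) ->
  loewner_le (block_mx X 0 0 (- Y)) (block_mx A11%:M A12%:M A12%:M A22%:M).
Proof.
move=> H xi; rewrite -(hsubmxK xi); set x := lsubmx xi; set y := rsubmx xi.
have := H x y.
rewrite opp_block_mx add_block_mx mul_row_block tr_row_mx mul_row_col.
rewrite !oppr0 !addr0 opprK !mulmxDl !mulmxDr !mulmxDl !mulmxN !mulNmx !mul_mx_scalar -!scalemxAl !mxE.
by move=> h; apply: le_trans h _; lra.
Qed.
End coordinates.

Section quadratic_tests.
Variable R : realType.
Implicit Types (x : 'rV[R]_2).

Lemma derive_polynomial (f : 'rV[R]_2 -> R) (x d : 'rV[R]_2) (b c : R) :
  (forall h : R, f (h *: d + x) = f x + h * b + h ^+ 2 * c) -> derivable f x d /\ 'D_d f x = b.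
Proof.
move=> H.
have : (fun h : R => h^-1 *: ((f \o shift x) (h *: d) - f x)) @ 0^' --> b.
  apply/cvgrPdist_le => e e0.
  have c1 : 0 < `|c| + 1 by rewrite ltr_wpDl.
  near=> h.
  have h0 : h != 0 by near: h; exact: nbhs_dnbhs_neq.
  rewrite /= H (_ : _ *: _ = b + h * c); last by rewrite /GRing.scale/=; field.
  rewrite opprD addrA subrr add0r normrN normrM.
  have : `|h| < e / (`|c| + 1) by near: h; apply: dnbhs0_lt; exact: divr_gt0.
  by rewrite ltr_pdivlMr//; have := normr_ge0 h; nra.
move=> cv; split; first by apply/cvg_ex; exists b.
exact: cvg_lim.
Unshelve. all: by end_near. Qed.

Definition qform (a b p1 p2 y11 y12 y22 : R) (x : 'rV[R]_2) : R :=
  p1 * (x 0 0 - a) + p2 * (x 0 1 - b)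
  + (y11 * (x 0 0 - a) ^+ 2 + 2 * y12 * (x 0 0 - a) * (x 0 1 - b) + y22 * (x 0 1 - b) ^+ 2) / 2.

Lemma shift_coord (h : R) (i j : 'I_2) x : (h *: delta_mx 0 i + x) 0 j = h * (j == i)%:R + x 0 j.
Proof. by rewrite !mxE eqxx. Qed.

Lemma ord2 (P : 'I_2 -> Prop) : P 0 -> P 1 -> forall i, P i.
Proof.
move=> P0 P1; case=> -[|[|//]] i.
  by rewrite (_ : Ordinal i = 0) //; exact/val_inj.
by rewrite (_ : Ordinal i = 1) //; exact/val_inj.
Qed.

Lemma qform_partial0 a b p1 p2 y11 y12 y22 x : let f := qform a b p1 p2 y11 y12 y22 in
  derivable f x (delta_mx 0 0) /\ partial 0 f x = p1 + y11 * (x 0 0 - a) + y12 * (x 0 1 - b).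
Proof.
by apply: (@derive_polynomial _ _ _ _ (y11 / 2)) => h; rewrite /qform !shift_coord/=; field.
Qed.

Lemma qform_partial1 a b p1 p2 y11 y12 y22 x : let f := qform a b p1 p2 y11 y12 y22 in
  derivable f x (delta_mx 0 1) /\ partial 1 f x = p2 + y12 * (x 0 0 - a) + y22 * (x 0 1 - b).
Proof.
by apply: (@derive_polynomial _ _ _ _ (y22 / 2)) => h; rewrite /qform !shift_coord/=; field.
Qed.

Definition affine (c u w : R) (x : 'rV[R]_2) : R := c + u * x 0 0 + w * x 0 1.

Lemma affine_partial c u w (i : 'I_2) x : derivable (affine c u w) x (delta_mx 0 i) /\
  partial i (affine c u w) x = if i == 0 then u else w.
Proof.
apply: (@derive_polynomial _ _ _ _ 0) => h; rewrite /affine !shift_coord.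
by move: i; apply: ord2 => /=; ring.
Qed.

Lemma affine_continuous c u w : continuous (affine c u w).
Proof.
move=> x; pose f (i : 'I_2) (m : R) (y : 'rV[R]_2) := m * y 0 i.
have cf i m : f i m @ x --> f i m x.
  have ci : (fun y : 'rV[R]_2 => y 0 i) @ x --> x 0 i := @coord_continuous R 1 2 0 i x.
  exact: (cvgMl_tmp ci).
rewrite (_ : affine c u w = cst c \+ f 0 u \+ f 1 w)//.
exact: (cvgD (cvgD (cvg_cst c) (cf 0 u)) (cf 1 w)).
Qed.

Lemma qform_partialE a b p1 p2 y11 y12 y22 (i : 'I_2) : partial i (qform a b p1 p2 y11 y12 y22) =
  if i == 0 then affine (p1 - y11 * a - y12 * b) y11 y12 else affine (p2 - y12 * a - y22 * b) y12 y22.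
Proof.
apply/funext => x; move: i; apply: ord2 => /=.
  by rewrite (qform_partial0 _ _ _ _ _ _ _ x).2 /affine; ring.
by rewrite (qform_partial1 _ _ _ _ _ _ _ x).2 /affine; ring.
Qed.

Lemma qform_C2 a b p1 p2 y11 y12 y22 (A : set 'rV[R]_2) : C2_closed A (qform a b p1 p2 y11 y12 y22).
Proof.
exists setT; split; [exact: openT|by []|split].
  move=> i x _; split.
    move: i; apply: ord2.
      by have [] := qform_partial0 a b p1 p2 y11 y12 y22 x.
    by have [] := qform_partial1 a b p1 p2 y11 y12 y22 x.
  by rewrite qform_partialE; case: ifP => _; exact: affine_continuous.
move=> i j x _; rewrite qform_partialE.
have aff c u w : derivable (affine c u w) x (delta_mx 0 j) /\ {for x, continuous (partial j (affine c u w))}.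
  split; first exact: (affine_partial _ _ _ _ x).1.
  rewrite (_ : partial j _ = fun=> if j == 0 then u else w); first exact: cst_continuous.
  by apply/funext => z; rewrite (affine_partial _ _ _ _ z).2.
by case: ifP => _; exact: aff.
Qed.

Lemma qform_grad a b p1 p2 y11 y12 y22 : grad (qform a b p1 p2 y11 y12 y22) (vec2 a b) = vec2 p1 p2.
Proof.
by apply/rowP; apply: ord2; rewrite ?vec2E0 ?vec2E1 mxE qform_partialE /= /affine ?vec2E0 ?vec2E1; ring.
Qed.

Lemma qform_hessian a b p1 p2 y11 y12 y22 : hessian (qform a b p1 p2 y11 y12 y22) (vec2 a b) = symmx y11 y12 y22.
Proof.
apply/matrixP => i j; rewrite !mxE qform_partialE.
move: i; apply: ord2; move: j; apply: ord2; rewrite /= (affine_partial _ _ _ _ _).2 //.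
Qed.

Variables (F : 'M[R]_2 -> 'rV[R]_2 -> R -> 'rV[R]_2 -> R) (H1 H2 : 'rV[R]_2 -> R).

(** Strict positivity of the boundary operators excludes their alternative in the minimum, so the
    interior inequality persists on the boundary and at the corner. *)
Lemma subsolution_quadratic v (a b p1 p2 y11 y12 y22 r : R) : viscosity_subsolution F H1 H2 v ->
  0 <= a -> 0 <= b -> 0 < r ->
  (forall h1 h2, 0 <= a + h1 -> 0 <= b + h2 -> `|h1| <= r -> `|h2| <= r ->
    v (vec2 (a + h1) (b + h2)) <= v (vec2 a b) + p1 * h1 + p2 * h2
      + (y11 * h1 ^+ 2 + 2 * y12 * h1 * h2 + y22 * h2 ^+ 2) / 2) ->
  (a = 0 -> 0 < H1 (vec2 p1 p2)) -> (b = 0 -> 0 < H2 (vec2 p1 p2)) ->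
  F (symmx y11 y12 y22) (vec2 p1 p2) (v (vec2 a b)) (vec2 a b) <= 0.
Proof.
move=> [_ vs] a0 b0 r0 tst h1 h2.
have := vs _ (vec2 a b) (qform_C2 a b p1 p2 y11 y12 y22 _).
rewrite qform_grad qform_hessian /=; case.
  split; first exact/closure_Omega.
  apply/nbhs_vec2; exists r => // c d ca db /closure_Omega[c0 d0].
  have := tst (c - a) (d - b); rewrite ![_ + (_ - _)]addrC !subrK => /(_ c0 d0 (ltW ca) (ltW db)).
  by rewrite /qform !vec2E0 !vec2E1 !subrr; lra.
set Fh := F _ _ _ _; move=> c0 c1 c2.
have [a_eq|a_neq] := eqVneq a 0.
  have := c1; rewrite /bdry1/= vec2E0 vec2E1 => /(_ (conj a_eq b0)).
  by rewrite ge_min leNgt h1.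
have [b_eq|b_neq] := eqVneq b 0.
  have := c2; rewrite /bdry2/= vec2E0 vec2E1 => /(_ (conj a0 b_eq)).
  by rewrite ge_min leNgt h2.
by apply: c0; rewrite /Omega/= vec2E0 vec2E1 !lt_neqAle ![0 == _]eq_sym a_neq b_neq.
Qed.

Lemma supersolution_quadratic w (a b p1 p2 y11 y12 y22 r : R) : viscosity_supersolution F H1 H2 w ->
  0 <= a -> 0 <= b -> 0 < r ->
  (forall h1 h2, 0 <= a + h1 -> 0 <= b + h2 -> `|h1| <= r -> `|h2| <= r ->
    w (vec2 a b) + p1 * h1 + p2 * h2
      + (y11 * h1 ^+ 2 + 2 * y12 * h1 * h2 + y22 * h2 ^+ 2) / 2 <= w (vec2 (a + h1) (b + h2))) ->
  (a = 0 -> H1 (vec2 p1 p2) < 0) -> (b = 0 -> H2 (vec2 p1 p2) < 0) ->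
  0 <= F (symmx y11 y12 y22) (vec2 p1 p2) (w (vec2 a b)) (vec2 a b).
Proof.
move=> [_ ws] a0 b0 r0 tst h1 h2.
have := ws _ (vec2 a b) (qform_C2 a b p1 p2 y11 y12 y22 _).
rewrite qform_grad qform_hessian /=; case.
  split; first exact/closure_Omega.
  apply/nbhs_vec2; exists r => // c d ca db /closure_Omega[c0 d0].
  have := tst (c - a) (d - b); rewrite ![_ + (_ - _)]addrC !subrK => /(_ c0 d0 (ltW ca) (ltW db)).
  by rewrite /qform !vec2E0 !vec2E1 !subrr; lra.
set Fh := F _ _ _ _; move=> c0 c1 c2.
have [a_eq|a_neq] := eqVneq a 0.
  have := c1; rewrite /bdry1/= vec2E0 vec2E1 => /(_ (conj a_eq b0)).
  by rewrite le_max leNgt h1.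
have [b_eq|b_neq] := eqVneq b 0.
  have := c2; rewrite /bdry2/= vec2E0 vec2E1 => /(_ (conj a0 b_eq)).
  by rewrite le_max leNgt h2.
by apply: c0; rewrite /Omega/= vec2E0 vec2E1 !lt_neqAle ![0 == _]eq_sym a_neq b_neq.
Qed.

Hypothesis F_cont : {within [set z : 'M[R]_2 * 'rV[R]_2 * R * 'rV[R]_2 |
                       z.1.1.1 \is symmetricmx /\ closure (Omega R) z.2],
              continuous (fun z => F z.1.1.1 z.1.1.2 z.1.2 z.2)}.

Lemma F_inward X p u (a b : R) : X \is symmetricmx -> 0 <= a -> 0 <= b ->
  (fun t : R => F X p u (vec2 (a + t) (b + t))) @ 0^'+ --> F X p u (vec2 a b).
Proof.
move=> Xs a0 b0.
have /subspace_continuousP cF := F_cont.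
have Sz : [set z : 'M[R]_2 * 'rV[R]_2 * R * 'rV[R]_2 |
    z.1.1.1 \is symmetricmx /\ closure (Omega R) z.2] (X, p, u, vec2 a b).
  by split=> //=; exact/closure_Omega.
apply: (cvg_comp (fun t : R => (X, p, u, vec2 (a + t) (b + t))) _ _ (cF _ Sz)) => S.
rewrite /within/= => -[[U1 U2] [/= h1 h2] sub].
have /nbhs_vec2[r r0 H] := h2.
near=> t.
apply: (sub ((X, p, u), vec2 (a + t) (b + t))) => /=.
- split; first exact: nbhs_singleton h1.
  have t0 : 0 < t by near: t; exact: nbhs_right_gt.
  have tr : t < r by near: t; exact: nbhs_right_lt.
  by apply: H; rewrite addrAC subrr add0r gtr0_norm.
- by split=> //; apply/closure_Omega; have t0 : 0 < t by [near: t; exact: nbhs_right_gt]; split; lra.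
Unshelve. all: by end_near. Qed.

(** The structure conditions are given in the open quadrant. A common diagonal shift moves both
    points inside without changing their difference, and continuity removes it. *)
Lemma F_inward_le X Y p q s u (a b c d e : R) : X \is symmetricmx -> Y \is symmetricmx ->
  0 <= a -> 0 <= b -> 0 <= c -> 0 <= d ->
  (forall h : R, 0 < h -> F X p s (vec2 (a + h) (b + h)) - F Y q u (vec2 (c + h) (d + h)) <= e) ->
  F X p s (vec2 a b) - F Y q u (vec2 c d) <= e.
Proof.
move=> Xs Ys a0 b0 c0 d0 H.
have cv : (fun h : R => F X p s (vec2 (a + h) (b + h)) - F Y q u (vec2 (c + h) (d + h))) @ 0^'+ -->
   F X p s (vec2 a b) - F Y q u (vec2 c d).
  by apply: cvgB; exact: F_inward.
apply: (cvgr_to_le cv); near=> h; apply: H.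
by near: h; exact: nbhs_right_gt.
Unshelve. all: by end_near. Qed.
End quadratic_tests.

(** * Structure conditions up to the boundary *)

Section structure.
Variable R : realType.
Variable F : 'M[R]_2 -> 'rV[R]_2 -> R -> 'rV[R]_2 -> R.
Hypothesis F_cont : {within [set z : 'M[R]_2 * 'rV[R]_2 * R * 'rV[R]_2 |
                       z.1.1.1 \is symmetricmx /\ closure (Omega R) z.2],
              continuous (fun z => F z.1.1.1 z.1.1.2 z.1.2 z.2)}.
Variables (mu L : R) (omega : R -> R).
Hypothesis F_i : forall (X : 'M[R]_2) (p x : 'rV[R]_2), X \is symmetricmx -> Omega R x ->
       {homo (fun u : R => F X p u x - mu * u) : s t / s <= t}.
Hypothesis F_ii : forall (X Y : 'M[R]_2) (p q : 'rV[R]_2) (u : R) (x : 'rV[R]_2),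
       X \is symmetricmx -> Y \is symmetricmx -> Omega R x ->
       `|F X p u x - F Y q u x| <= L * (opnorm (X - Y) + enorm (p - q)).
Hypothesis F_iii : forall (X Y : 'M[R]_2) (x y p : 'rV[R]_2) (u alpha : R),
       X \is symmetricmx -> Y \is symmetricmx ->
       Omega R x -> Omega R y -> 0 < alpha ->
       loewner_le (- (alpha *: block_mx 1%:M 0 0 1%:M)) (block_mx X 0 0 (- Y)) ->
       loewner_le (block_mx X 0 0 (- Y))
         (alpha *: block_mx 1%:M (- 1%:M) (- 1%:M) 1%:M) ->
       - omega (alpha * enorm (x - y) ^+ 2 + enorm (x - y) * (enorm p + 1))
         <= F X p u x - F Y p u y.

Lemma Omega_inward (a b h : R) : 0 <= a -> 0 <= b -> 0 < h -> Omega R (vec2 (a + h) (b + h)).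
Proof. by move=> a0 b0 h0; rewrite /Omega/= vec2E0 vec2E1; split; lra. Qed.

Lemma F_increasing X p s t (a b : R) : X \is symmetricmx -> 0 <= a -> 0 <= b -> s <= t ->
  F X p s (vec2 a b) - F X p t (vec2 a b) <= - (mu * (t - s)).
Proof.
move=> Xs a0 b0 st; apply: (F_inward_le F_cont) => // h h0.
by have := F_i p Xs (Omega_inward a0 b0 h0) st; lra.
Qed.

Lemma F_lipschitz X Y p q u (a b : R) : X \is symmetricmx -> Y \is symmetricmx -> 0 <= a -> 0 <= b ->
  F X p u (vec2 a b) - F Y q u (vec2 a b) <= L * (opnorm (X - Y) + enorm (p - q)).
Proof.
move=> Xs Ys a0 b0; apply: (F_inward_le F_cont) => // h h0.
exact: (le_trans (ler_norm _) (F_ii _ _ _ Xs Ys (Omega_inward a0 b0 h0))).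
Qed.

Lemma vec2B (a b c d : R) : vec2 a b - vec2 c d = vec2 (a - c) (b - d).
Proof. by apply/rowP => i; rewrite !mxE; case: ifP. Qed.

Lemma F_modulus X Y p u (a b c d alpha : R) : X \is symmetricmx -> Y \is symmetricmx ->
  0 <= a -> 0 <= b -> 0 <= c -> 0 <= d -> 0 < alpha ->
  loewner_le (- (alpha *: block_mx 1%:M 0 0 1%:M)) (block_mx X 0 0 (- Y)) ->
  loewner_le (block_mx X 0 0 (- Y)) (alpha *: block_mx 1%:M (- 1%:M) (- 1%:M) 1%:M) ->
  F Y p u (vec2 c d) - F X p u (vec2 a b) <=
    omega (alpha * enorm (vec2 (a - c) (b - d)) ^+ 2 + enorm (vec2 (a - c) (b - d)) * (enorm p + 1)).
Proof.
move=> Xs Ys a0 b0 c0 d0 al0 h1 h2; apply: (F_inward_le F_cont) => // h h0.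
have := F_iii p u Xs Ys (Omega_inward a0 b0 h0) (Omega_inward c0 d0 h0) al0 h1 h2.
rewrite vec2B (_ : a + h - (c + h) = a - c); last by ring.
by rewrite (_ : b + h - (d + h) = b - d); [lra|ring].
Qed.

Lemma row_dot (x y : 'rV[R]_2) : (x *m y^T) 0 0 = x 0 0 * y 0 0 + x 0 1 * y 0 1.
Proof. by rewrite !mxE sum_ord2 !mxE. Qed.

(** Lower case matrices and the slope [p] satisfy the matrix inequality exactly, upper case ones are
    the perturbed jets at which the equation is tested. Monotonicity in [u], the Lipschitz condition
    at each point and the modulus form one chain between them. *)
Lemma structure_gap (A a1 b1 a2 b2 u w x11 x12 x22 z11 z12 z22 X11 X12 X22 Z11 Z12 Z22
    p1 p2 P1 P2 Q1 Q2 : R) : 0 <= L -> 0 < A ->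
  0 <= a1 -> 0 <= b1 -> 0 <= a2 -> 0 <= b2 -> w <= u ->
  F (symmx X11 X12 X22) (vec2 P1 P2) u (vec2 a1 b1) <= 0 ->
  0 <= F (symmx Z11 Z12 Z22) (vec2 Q1 Q2) w (vec2 a2 b2) ->
  (forall s t, - (A * (s ^+ 2 + t ^+ 2)) <= x11 * s ^+ 2 + 2 * x12 * s * t + x22 * t ^+ 2) ->
  (forall s t, z11 * s ^+ 2 + 2 * z12 * s * t + z22 * t ^+ 2 <= A * (s ^+ 2 + t ^+ 2)) ->
  (forall s t s' t', x11 * s ^+ 2 + 2 * x12 * s * t + x22 * t ^+ 2
    - (z11 * s' ^+ 2 + 2 * z12 * s' * t' + z22 * t' ^+ 2) <= A * ((s - s') ^+ 2 + (t - t') ^+ 2)) ->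
  mu * (u - w) <= omega (A * enorm (vec2 (a1 - a2) (b1 - b2)) ^+ 2
      + enorm (vec2 (a1 - a2) (b1 - b2)) * (enorm (vec2 p1 p2) + 1))
    + L * (`|x11 - X11| + 2 * `|x12 - X12| + `|x22 - X22| + `|p1 - P1| + `|p2 - P2|)
    + L * (`|Z11 - z11| + 2 * `|Z12 - z12| + `|Z22 - z22| + `|Q1 - p1| + `|Q2 - p2|).
Proof.
move=> L0 A0 a10 b10 a20 b20 wu FX FZ xA zA xz.
have := F_increasing (vec2 p1 p2) (symmx_sym x11 x12 x22) a10 b10 wu.
have lip m11 m12 m22 n11 n12 n22 r1 r2 s1 s2 v (a b : R) : 0 <= a -> 0 <= b ->
    F (symmx m11 m12 m22) (vec2 r1 r2) v (vec2 a b) - F (symmx n11 n12 n22) (vec2 s1 s2) v (vec2 a b) <=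
    L * (`|m11 - n11| + 2 * `|m12 - n12| + `|m22 - n22| + `|r1 - s1| + `|r2 - s2|).
  move=> a0 b0; apply: (le_trans (F_lipschitz _ _ _ (symmx_sym _ _ _) (symmx_sym _ _ _) a0 b0)).
  apply: ler_wpM2l => //; rewrite symmxB vec2B.
  by have := opnorm_le (m11 - n11) (m12 - n12) (m22 - n22); have := enorm_le (r1 - s1) (r2 - s2); lra.
have := lip x11 x12 x22 X11 X12 X22 p1 p2 P1 P2 u _ _ a10 b10.
have := lip Z11 Z12 Z22 z11 z12 z22 Q1 Q2 p1 p2 w _ _ a20 b20.
have E2 : loewner_le (block_mx (symmx x11 x12 x22) 0 0 (- symmx z11 z12 z22))
    (A *: block_mx 1%:M (- 1%:M) (- 1%:M) 1%:M).
  rewrite scale_block_mx !scalerN !scalemx1 -!(raddfN (@scalar_mx _ 2)).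
  apply: loewner_block => x y; rewrite !symmx_form !row_dot.
  by have := xz (x 0 0) (x 0 1) (y 0 0) (y 0 1); lra.
have E1 : loewner_le (- (A *: block_mx 1%:M 0 0 1%:M))
    (block_mx (symmx x11 x12 x22) 0 0 (- symmx z11 z12 z22)).
  have H : loewner_le (block_mx (- symmx x11 x12 x22) 0 0 (- - symmx z11 z12 z22))
      (block_mx A%:M 0%:M 0%:M A%:M).
    apply: loewner_block => x y; rewrite !mulmxN !mulNmx.
    have op (m : 'M[R]_1) : (- m) 0 0 = - m 0 0 by rewrite mxE.
    rewrite !op !symmx_form !row_dot.
    by have := xA (x 0 0) (x 0 1); have := zA (y 0 0) (y 0 1); lra.
  move=> xi; have := H xi; congr (is_true (0 <= (_ *m _ *m _) 0 0)).
  rewrite opprK scale_block_mx !scaler0 scalemx1 (raddf0 (@scalar_mx _ 2)) addrC.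
  by rewrite opp_block_mx !opprK oppr0.
have := F_modulus (vec2 p1 p2) w (symmx_sym x11 x12 x22) (symmx_sym z11 z12 z22) a10 b10 a20 b20 A0 E1 E2.
lra.
Qed.
End structure.

(** * Doubling of variables *)

Section cubic.
Variables (R : realType) (a b c : R).
Hypothesis T1 : forall s t, `|a * s ^+ 2 + 2 * b * s * t + c * t ^+ 2| <= s ^+ 2 + t ^+ 2.

(** Polarization: the form at h + Th minus the form at h - Th is 4 |Th|^2, and the hypothesis bounds
    it by 2 |h|^2 + 2 |Th|^2. *)
Lemma contraction_sqr s t : (a * s + b * t) ^+ 2 + (b * s + c * t) ^+ 2 <= s ^+ 2 + t ^+ 2.
Proof.
have := T1 (s + (a * s + b * t)) (t + (b * s + c * t)).
have := T1 (s - (a * s + b * t)) (t - (b * s + c * t)).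
by rewrite !ler_norml; lra.
Qed.

(* T - (3/4) T^2 + (1/4) T^3 = T (1 - T/2)^2 + (T/2)^2 *)
Definition cub_lo11 := a - 3 / 4 * (a ^+ 2 + b ^+ 2) + (a * (a ^+ 2 + b ^+ 2) + b * (b * (a + c))) / 4.
Definition cub_lo12 := b - 3 / 4 * (b * (a + c)) + (a * (b * (a + c)) + b * (b ^+ 2 + c ^+ 2)) / 4.
Definition cub_lo22 := c - 3 / 4 * (b ^+ 2 + c ^+ 2) + (b * (b * (a + c)) + c * (b ^+ 2 + c ^+ 2)) / 4.
Definition cub_hi11 := a + 3 / 4 * (a ^+ 2 + b ^+ 2) + (a * (a ^+ 2 + b ^+ 2) + b * (b * (a + c))) / 4.
Definition cub_hi12 := b + 3 / 4 * (b * (a + c)) + (a * (b * (a + c)) + b * (b ^+ 2 + c ^+ 2)) / 4.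
Definition cub_hi22 := c + 3 / 4 * (b ^+ 2 + c ^+ 2) + (b * (b * (a + c)) + c * (b ^+ 2 + c ^+ 2)) / 4.

Definition form (m11 m12 m22 s t : R) := m11 * s ^+ 2 + 2 * m12 * s * t + m22 * t ^+ 2.

Lemma cub_loE s t : form cub_lo11 cub_lo12 cub_lo22 s t =
  form a b c (s - (a * s + b * t) / 2) (t - (b * s + c * t) / 2)
  + (((a * s + b * t) / 2) ^+ 2 + ((b * s + c * t) / 2) ^+ 2).
Proof. by rewrite /form /cub_lo11 /cub_lo12 /cub_lo22; field. Qed.

Lemma cub_hiE s t : form cub_hi11 cub_hi12 cub_hi22 s t =
  form a b c (s + (a * s + b * t) / 2) (t + (b * s + c * t) / 2)
  - (((a * s + b * t) / 2) ^+ 2 + ((b * s + c * t) / 2) ^+ 2).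
Proof. by rewrite /form /cub_hi11 /cub_hi12 /cub_hi22; field. Qed.

Lemma half_step_sqr s t :
  (s - (a * s + b * t) / 2) ^+ 2 + (t - (b * s + c * t) / 2) ^+ 2 <= 9 / 4 * (s ^+ 2 + t ^+ 2) /\
  (s + (a * s + b * t) / 2) ^+ 2 + (t + (b * s + c * t) / 2) ^+ 2 <= 9 / 4 * (s ^+ 2 + t ^+ 2).
Proof.
have := contraction_sqr s t; have := T1 s t; rewrite ler_norml; lra.
Qed.

Lemma cub_lo_ge s t : - (2 * (s ^+ 2 + t ^+ 2)) <= form cub_lo11 cub_lo12 cub_lo22 s t.
Proof.
have c1 := contraction_sqr s t; have := T1 s t; have := T1 (a * s + b * t) (b * s + c * t).
rewrite !ler_norml => /andP[h1 _] /andP[h2 _].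
have -> : form cub_lo11 cub_lo12 cub_lo22 s t = form a b c s t
   - 3 / 4 * ((a * s + b * t) ^+ 2 + (b * s + c * t) ^+ 2) + form a b c (a * s + b * t) (b * s + c * t) / 4.
  by rewrite /form /cub_lo11 /cub_lo12 /cub_lo22; field.
by rewrite /form; lra.
Qed.

Lemma cub_hi_le s t : form cub_hi11 cub_hi12 cub_hi22 s t <= 2 * (s ^+ 2 + t ^+ 2).
Proof.
have c1 := contraction_sqr s t; have := T1 s t; have := T1 (a * s + b * t) (b * s + c * t).
rewrite !ler_norml => /andP[_ h1] /andP[_ h2].
have -> : form cub_hi11 cub_hi12 cub_hi22 s t = form a b c s t
   + 3 / 4 * ((a * s + b * t) ^+ 2 + (b * s + c * t) ^+ 2) + form a b c (a * s + b * t) (b * s + c * t) / 4.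
  by rewrite /form /cub_hi11 /cub_hi12 /cub_hi22; field.
by rewrite /form; lra.
Qed.

(** In terms of the mean m and half difference d of the two vectors, the odd parts leave the mixed
    products 4 Tm.d + Tm.T^2 d, and the term - 3/2 |Tm|^2 from the quadratic parts absorbs their
    share in Tm. This fixes the coefficient 3/4. *)
Lemma cub_lo_hi s t s' t' : form cub_lo11 cub_lo12 cub_lo22 s t - form cub_hi11 cub_hi12 cub_hi22 s' t'
  <= 2 * ((s - s') ^+ 2 + (t - t') ^+ 2).
Proof.
have [m1 [d1 [-> ->]]] : exists m d, s = m + d /\ s' = m - d.
  by exists ((s + s') / 2), ((s - s') / 2); split; field.
have [m2 [d2 [-> ->]]] : exists m d, t = m + d /\ t' = m - d.
  by exists ((t + t') / 2), ((t - t') / 2); split; field.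
pose u1 := a * m1 + b * m2; pose u2 := b * m1 + c * m2.
pose w1 := a * d1 + b * d2; pose w2 := b * d1 + c * d2.
pose e1 := a * w1 + b * w2; pose e2 := b * w1 + c * w2.
have -> : form cub_lo11 cub_lo12 cub_lo22 (m1 + d1) (m2 + d2) - form cub_hi11 cub_hi12 cub_hi22 (m1 - d1) (m2 - d2)
  = 4 * (u1 * d1 + u2 * d2) + (u1 * e1 + u2 * e2) - 3 / 2 * (u1 ^+ 2 + u2 ^+ 2 + w1 ^+ 2 + w2 ^+ 2).
  by rewrite /form /cub_lo11 /cub_lo12 /cub_lo22 /cub_hi11 /cub_hi12 /cub_hi22 /e1 /e2 /u1 /u2 /w1 /w2; field.
have := contraction_sqr d1 d2; have := contraction_sqr w1 w2.
rewrite -/w1 -/w2 -/e1 -/e2.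
have := sqr_ge0 (u1 - 2 * d1); have := sqr_ge0 (u2 - 2 * d2).
have := sqr_ge0 (u1 - e1); have := sqr_ge0 (u2 - e2).
have := sqr_ge0 d1; have := sqr_ge0 d2; have := sqr_ge0 w1; have := sqr_ge0 w2.
rewrite (_ : m1 + d1 - (m1 - d1) = 2 * d1); last by ring.
rewrite (_ : m2 + d2 - (m2 - d2) = 2 * d2); last by ring.
by lra.
Qed.
End cubic.

Section zeta.
Variable R : realType.

Definition zeta (t : R) := t + 2 / (1 + t).
Definition dzeta (t : R) := 1 - 2 / (1 + t) ^+ 2.

Lemma zeta_ge t : 0 <= t -> t <= zeta t.
Proof. by move=> t0; rewrite /zeta lerDl divr_ge0// addr_ge0. Qed.

Lemma dzeta0 : dzeta 0 = -1.
Proof. by rewrite /dzeta addr0 expr1n divr1; ring. Qed.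

Lemma dzeta_bound t : 0 <= t -> -1 <= dzeta t <= 1.
Proof.
move=> t0; have t1 : 1 <= 1 + t by lra.
have t2 : 1 <= (1 + t) ^+ 2 by rewrite exprn_ege1.
have : 0 <= 2 / (1 + t) ^+ 2 <= 2.
  by rewrite divr_ge0 ?sqr_ge0//= ler_pdivrMr; lra.
by rewrite /dzeta; lra.
Qed.

(** The second derivative 4 / (1 + t)^3 is at most 4 on the half line, whence the coefficient 2. *)
Lemma zeta_semiconcave t h : 0 <= t -> 0 <= t + h ->
  zeta (t + h) <= zeta t + dzeta t * h + 2 * h ^+ 2.
Proof.
move=> t0 th0; have t1 : 1 <= 1 + t by lra.
have th1 : 1 <= 1 + (t + h) by lra.
rewrite -subr_ge0.
have -> : zeta t + dzeta t * h + 2 * h ^+ 2 - zeta (t + h) =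
    2 * h ^+ 2 * (1 - ((1 + (t + h)) * (1 + t) ^+ 2)^-1).
  rewrite /zeta /dzeta; field; rewrite !gt_eqF//; lra.
have e1 : 1 <= (1 + (t + h)) * (1 + t) ^+ 2 by rewrite mulr_ege1// exprn_ege1.
apply: mulr_ge0; first by rewrite mulr_ge0 ?sqr_ge0.
by rewrite subr_ge0 invf_le1//; apply: lt_le_trans e1.
Qed.
End zeta.

Section scaled.
Variable R : realType.

(** The function is eps psi(z / eps) + a.z: scaling keeps the size of slopes and divides curvature
    by eps, and the linear term turns the sign conditions for the translated nonlinearities into
    those for [h1] and [h2]. *)
Lemma scaled_test_function (al a1 a2 : R) (h1 h2 : R -> R) : 0 <= al -> al < 1 ->
  (forall s t, s <= t -> 0 <= h1 t - h1 s <= al * (t - s)) ->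
  (forall s t, s <= t -> 0 <= h2 t - h2 s <= al * (t - s)) ->
  h1 a2 = a1 -> h2 a1 = a2 ->
  exists M C : R, [/\ 0 < M, 0 < C & forall eps, 0 < eps ->
  exists Psi G1 G2 : R -> R -> R, forall z1 z2,
  [/\ forall x1 x2, Psi x1 x2 <= Psi z1 z2 + G1 z1 z2 * (x1 - z1) + G2 z1 z2 * (x2 - z2)
        + M / (2 * eps) * ((x1 - z1) ^+ 2 + (x2 - z2) ^+ 2),
      Psi 0 0 <= 0 /\ a1 * z1 + a2 * z2 + (`|z1| + `|z2|) ^+ 2 / (16 * eps) <= Psi z1 z2,
      `|G1 z1 z2| <= `|a1| + 4 * (`|z1| + `|z2|) / eps /\ `|G2 z1 z2| <= `|a2| + 4 * (`|z1| + `|z2|) / eps,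
      (0 <= z1 -> 0 <= G1 z1 z2 - h1 (G2 z1 z2) <= C * z1 / eps) /\
      (z1 <= 0 -> C * z1 / eps <= G1 z1 z2 - h1 (G2 z1 z2) <= 0) &
      (0 <= z2 -> 0 <= G2 z1 z2 - h2 (G1 z1 z2) <= C * z2 / eps) /\
      (z2 <= 0 -> C * z2 / eps <= G2 z1 z2 - h2 (G1 z1 z2) <= 0)]].
Proof.
move=> al0 al1 oh1 oh2 ha1 ha2.
pose k1 t := - a1 + h1 (t + a2); pose k2 t := - a2 + h2 (t + a1).
have ok1 : oblique al k1.
  split; first by rewrite /k1 add0r ha1; ring.
  by move=> s t st; have := oh1 (s + a2) (t + a2); rewrite lerD2r /k1 => /(_ st); lra.
have ok2 : oblique al k2.
  split; first by rewrite /k2 add0r ha2; ring.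
  by move=> s t st; have := oh2 (s + a1) (t + a1); rewrite lerD2r /k2 => /(_ st); lra.
have [psi [g1 [g2 [M [C [M0 C0 H]]]]]] := test_function al0 al1 ok1 ok2.
exists M, C; split=> // eps eps0.
have e_neq0 : eps != 0 by rewrite gt_eqF.
exists (fun z1 z2 => eps * psi (z1 / eps) (z2 / eps) + a1 * z1 + a2 * z2),
  (fun z1 z2 => a1 + g1 (z1 / eps) (z2 / eps)), (fun z1 z2 => a2 + g2 (z1 / eps) (z2 / eps)) => z1 z2.
have [T1 [T2 T3] [T4 T5] T6 T7] := H (z1 / eps) (z2 / eps).
have nrm (u w : R) : `|u / eps| + `|w / eps| = (`|u| + `|w|) / eps.
  by rewrite !normrM normfV (gtr0_norm eps0) mulrDl.
rewrite nrm in T3 T4 T5; split.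
- move=> x1 x2; have := ler_wpM2l (ltW eps0) (T1 (x1 / eps) (x2 / eps)).
  set A := g1 _ _; set B := g2 _ _; set D := psi (z1 / eps) _; set E := psi (x1 / eps) _.
  rewrite (_ : eps * (D + A * (x1 / eps - z1 / eps) + B * (x2 / eps - z2 / eps) +
     M / 2 * ((x1 / eps - z1 / eps) ^+ 2 + (x2 / eps - z2 / eps) ^+ 2)) =
     eps * D + A * (x1 - z1) + B * (x2 - z2) + M / (2 * eps) * ((x1 - z1) ^+ 2 + (x2 - z2) ^+ 2)); last by field.
  clear; lra.
- split; first by rewrite !mul0r !mulr0 !addr0; apply: mulr_ge0_le0 => //; exact: ltW.
  have := ler_wpM2l (ltW eps0) T3.
  rewrite (_ : eps * (((`|z1| + `|z2|) / eps) ^+ 2 / 16) = (`|z1| + `|z2|) ^+ 2 / (16 * eps)); last first.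
    by field.
  clear; lra.
- by split; rewrite (le_trans (ler_normD _ _))// lerD2l -mulrA.
- have [h h'] := T6; split => zz.
    have := h (divr_ge0 zz (ltW eps0)); rewrite /k1 [_ + a2]addrC mulrA; clear; lra.
  have := h' (mulr_le0_ge0 zz _); rewrite invr_ge0 /k1 [_ + a2]addrC mulrA => /(_ (ltW eps0)); clear; lra.
- have [h h'] := T7; split => zz.
    have := h (divr_ge0 zz (ltW eps0)); rewrite /k2 [_ + a1]addrC mulrA; clear; lra.
  have := h' (mulr_le0_ge0 zz _); rewrite invr_ge0 /k2 [_ + a1]addrC mulrA => /(_ (ltW eps0)); clear; lra.
Qed.
End scaled.

(** * Sup-convolutions over the quadrant *)

Section convolution.
Variable R : realType.
Implicit Types f g Psi : R -> R -> R.

Definition quadrant_usc f := forall x1 x2 m, 0 <= x1 -> 0 <= x2 -> f x1 x2 < m ->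
  exists2 r : R, 0 < r & forall y1 y2, 0 <= y1 -> 0 <= y2 -> `|y1 - x1| < r -> `|y2 - x2| < r ->
    f y1 y2 < m.

Lemma quadrant_uscD f g : quadrant_usc f ->
  (forall x1 x2 e, 0 <= x1 -> 0 <= x2 -> 0 < e -> exists2 r : R, 0 < r &
    forall y1 y2, 0 <= y1 -> 0 <= y2 -> `|y1 - x1| < r -> `|y2 - x2| < r -> `|g y1 y2 - g x1 x2| < e) ->
  quadrant_usc (fun x1 x2 => f x1 x2 + g x1 x2).
Proof.
move=> fu gc x1 x2 m x10 x20 fm; pose e := (m - (f x1 x2 + g x1 x2)) / 2.
have e0 : 0 < e by rewrite /e; lra.
have fe : f x1 x2 < f x1 x2 + e by lra.
have [r r0 fr] := fu _ _ _ x10 x20 fe; have [s s0 gs] := gc _ _ _ x10 x20 e0.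
exists (Num.min r s) => [|y1 y2 y10 y20]; first by rewrite lt_min r0.
rewrite !lt_min => /andP[r1 s1] /andP[r2 s2].
have := fr _ _ y10 y20 r1 r2; have := gs _ _ y10 y20 s1 s2; rewrite ltr_norml => /andP[_].
by rewrite /e; lra.
Qed.

Lemma supconv_exists f Psi (K B c : R) : quadrant_usc f ->
  (forall x1 x2, 0 <= x1 -> 0 <= x2 -> f x1 x2 <= B) ->
  0 <= K -> semiconvex K (fun z1 z2 => - Psi z1 z2) ->
  (forall z1 z2, `|z1| + `|z2| - c <= Psi z1 z2) ->
  exists X1 X2 : R -> R -> R, forall y1 y2, [/\ 0 <= X1 y1 y2, 0 <= X2 y1 y2 &
    forall x1 x2, 0 <= x1 -> 0 <= x2 -> f x1 x2 - Psi (x1 - y1) (x2 - y2) <=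
      f (X1 y1 y2) (X2 y1 y2) - Psi (X1 y1 y2 - y1) (X2 y1 y2 - y2)].
Proof.
move=> fu fB K0 PK Pc.
suff /choice[X XP] : forall y : R * R, exists x : R * R, [/\ 0 <= x.1, 0 <= x.2 &
    forall x1 x2, 0 <= x1 -> 0 <= x2 -> f x1 x2 - Psi (x1 - y.1) (x2 - y.2) <=
      f x.1 x.2 - Psi (x.1 - y.1) (x.2 - y.2)].
  by exists (fun y1 y2 => (X (y1, y2)).1), (fun y1 y2 => (X (y1, y2)).2) => y1 y2; exact: (XP (y1, y2)).
move=> [y1 y2] /=.
pose g x1 x2 := f x1 x2 - Psi (x1 - y1) (x2 - y2).
have gu : quadrant_usc g.
  apply: quadrant_uscD => // x1 x2 e _ _ e0.
  have [r r0 Hr] := semiconvex_continuous (x1 - y1) (x2 - y2) K0 PK e0.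
  exists r => // u1 u2 _ _ h1 h2; apply: Hr.
    by rewrite (_ : _ - _ = u1 - x1)//; ring.
  by rewrite (_ : _ - _ = u2 - x2)//; ring.
pose rho := `|B| + `|c| + `|g 0 0| + `|y1| + `|y2|.
have rho0 : 0 <= rho by rewrite !addr_ge0.
have [|x1 [x2 [/andP[x10 _] /andP[x20 _] xm]]] := @box_max _ g 0 rho 0 rho rho0 rho0.
  move=> x1 x2 m /andP[x10 _] /andP[x20 _] /(gu _ _ _ x10 x20)[r r0 H]; exists r => // u1 u2 /andP[u10 _] /andP[u20 _].
  exact: H.
exists (x1, x2); split=> //= u1 u2 u10 u20; rewrite -![_ - Psi _ _]/(g _ _).
have [u1r|u1r] := leP u1 rho; last first.
  apply: le_trans (xm 0 0 _ _); rewrite ?lexx ?rho0//.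
  have := fB _ _ u10 u20; have := Pc (u1 - y1) (u2 - y2); have := normr_ge0 (u2 - y2).
  have := ler_norm (u1 - y1); have := ler_norm y1; have := ler_norm B; have := ler_norm c.
  have := ler_norm (- g 0 0); rewrite normrN; have := normr_ge0 y2.
  have <- : f u1 u2 - Psi (u1 - y1) (u2 - y2) = g u1 u2 by [].
  by move: u1r; rewrite /rho; lra.
have [u2r|u2r] := leP u2 rho; last first.
  apply: le_trans (xm 0 0 _ _); rewrite ?lexx ?rho0//.
  have := fB _ _ u10 u20; have := Pc (u1 - y1) (u2 - y2); have := normr_ge0 (u1 - y1).
  have := ler_norm (u2 - y2); have := ler_norm y2; have := ler_norm B; have := ler_norm c.
  have := ler_norm (- g 0 0); rewrite normrN; have := normr_ge0 y1.
  have <- : f u1 u2 - Psi (u1 - y1) (u2 - y2) = g u1 u2 by [].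
  by move: u2r; rewrite /rho; lra.
by apply: xm; rewrite ?u10 ?u20.
Qed.

Lemma supconv_semiconvex f Psi (K : R) (X1 X2 : R -> R -> R) :
  semiconvex K (fun z1 z2 => - Psi z1 z2) ->
  (forall y1 y2, [/\ 0 <= X1 y1 y2, 0 <= X2 y1 y2 &
    forall x1 x2, 0 <= x1 -> 0 <= x2 -> f x1 x2 - Psi (x1 - y1) (x2 - y2) <=
      f (X1 y1 y2) (X2 y1 y2) - Psi (X1 y1 y2 - y1) (X2 y1 y2 - y2)]) ->
  semiconvex K (fun y1 y2 => f (X1 y1 y2) (X2 y1 y2) - Psi (X1 y1 y2 - y1) (X2 y1 y2 - y2)).
Proof.
move=> PK XP y1 y2; have [X10 X20 _] := XP y1 y2.
have [p1 [p2 Hp]] := PK (X1 y1 y2 - y1) (X2 y1 y2 - y2).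
exists (- p1), (- p2) => u1 u2; have [_ _ /(_ _ _ X10 X20)] := XP u1 u2.
have := Hp (X1 y1 y2 - u1) (X2 y1 y2 - u2).
rewrite (_ : X1 y1 y2 - u1 - (X1 y1 y2 - y1) = - (u1 - y1)); last by ring.
rewrite (_ : X2 y1 y2 - u2 - (X2 y1 y2 - y2) = - (u2 - y2)); last by ring.
by rewrite !sqrrN; lra.
Qed.

Lemma semiconvexD (K L : R) V W : semiconvex K V -> semiconvex L W ->
  semiconvex (K + L) (fun x y => V x y + W x y).
Proof.
move=> VK WL x1 x2; have [p1 [p2 Hp]] := VK x1 x2; have [q1 [q2 Hq]] := WL x1 x2.
exists (p1 + q1), (p2 + q2) => y1 y2; have := Hp y1 y2; have := Hq y1 y2; lra.
Qed.

Lemma coercive_max (K B d : R) D : 0 <= K -> semiconvex K D -> 0 < d ->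
  (forall y1 y2, D y1 y2 <= B - d * (`|y1| + `|y2|)) ->
  exists z1 z2, forall y1 y2, D y1 y2 <= D z1 z2.
Proof.
move=> K0 DK d0 DB; pose rho := (`|B| + `|D 0 0|) / d.
have rho0 : 0 <= rho by rewrite divr_ge0 ?addr_ge0// ltW.
have rr : - rho <= rho by lra.
have rE : d * rho = `|B| + `|D 0 0| by rewrite /rho; field; rewrite gt_eqF.
have [|x1 [x2 [_ _ xm]]] := @box_max _ D (- rho) rho (- rho) rho rr rr.
  move=> x1 x2 m _ _ Dm; have e0 : 0 < m - D x1 x2 by lra.
  have [r r0 Hr] := semiconvex_continuous x1 x2 K0 DK e0.
  by exists r => // y1 y2 _ _ h1 h2; have := Hr _ _ h1 h2; rewrite ltr_norml; lra.
exists x1, x2 => y1 y2.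
have out : rho < `|y1| + `|y2| -> D y1 y2 <= D x1 x2.
  move=> yr; have : D 0 0 <= D x1 x2 by apply: xm; lra.
  have := DB y1 y2; have : d * rho <= d * (`|y1| + `|y2|) by rewrite ler_pM2l// ltW.
  rewrite rE; have := ler_norm B; have := ler_norm (- D 0 0); rewrite normrN.
  lra.
have [yr|yr] := ltP rho `|y1|; first by apply: out; have := normr_ge0 y2; lra.
have [y2r|y2r] := ltP rho `|y2|; first by apply: out; have := normr_ge0 y1; lra.
by apply: xm; rewrite -ler_norml.
Qed.

(** Quantitative form of the usual limit of doubled points: a diagonal bound holds up to [tau] at a
    uniform distance [k] off the diagonal. The decay of [f] confines the argument to a compact
    square. *)
Lemma close_sum_le f g (B d M0 tau : R) : quadrant_usc f -> quadrant_usc g -> 0 < d -> 0 < tau ->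
  (forall x1 x2, 0 <= x1 -> 0 <= x2 -> f x1 x2 <= B - d * (x1 + x2)) ->
  (forall x1 x2, 0 <= x1 -> 0 <= x2 -> g x1 x2 <= B) ->
  (forall x1 x2, 0 <= x1 -> 0 <= x2 -> f x1 x2 + g x1 x2 <= M0) ->
  exists2 k : R, 0 < k & forall x1 x2 z1 z2, 0 <= x1 -> 0 <= x2 -> 0 <= z1 -> 0 <= z2 ->
    `|x1 - z1| <= k -> `|x2 - z2| <= k -> f x1 x2 + g z1 z2 <= M0 + tau.
Proof.
move=> fu gu d0 tau0 fB gB fgM.
pose rho := (2 * `|B| + `|M0|) / d.
have rho0 : 0 <= rho by rewrite divr_ge0 ?addr_ge0 ?mulr_ge0// ltW.
have rE : d * rho = 2 * `|B| + `|M0| by rewrite /rho; field; rewrite gt_eqF.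
pose Q := `[0, rho] `*` `[0, rho].
have cQ : compact Q by apply: compact_setX; exact: segment_compact.
have Q_ (x : R * R) : Q x <-> 0 <= x.1 <= rho /\ 0 <= x.2 <= rho by rewrite /Q/= !in_itv.
pose P (k : R) (x : R * R) := Q x -> forall z1 z2, 0 <= z1 -> 0 <= z2 ->
  `|x.1 - z1| <= k -> `|x.2 - z2| <= k -> f x.1 x.2 + g z1 z2 <= M0 + tau.
have [k [k0 kP]] : exists k, 0 < k /\ forall x, Q x -> P k x.
  have HP : \forall k \near 0^'+, Q `<=` P k.
    apply: ((@compact_near_coveringP _ Q).1 cQ _ (0^'+) P _) => x Qx.
    have /Q_[/andP[x10 _] /andP[x20 _]] := Qx.
    have fx : f x.1 x.2 < f x.1 x.2 + tau / 2 by lra.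
    have gx : g x.1 x.2 < M0 + tau / 2 - f x.1 x.2 by have := fgM _ _ x10 x20; lra.
    have [r r0 Hr] := fu _ _ _ x10 x20 fx; have [s s0 Hs] := gu _ _ _ x10 x20 gx.
    pose t := Num.min r s / 2.
    have t0 : 0 < t by rewrite divr_gt0// lt_min r0.
    exists (ball x t, [set k | k < t]).
      by split => /=; [exact: nbhsx_ballx|exact: nbhs_right_lt].
    move=> [u k] /= [[xu1 xu2] kt] /Q_/=[/andP[u10 _] /andP[u20 _]] z1 z2 z10 z20 uz1 uz2.
    have [tr ts] : 2 * t <= r /\ 2 * t <= s.
      by rewrite /t mulrC divfK//; split; rewrite ge_min lexx ?orbT.
    have fr : f u.1 u.2 < f x.1 x.2 + tau / 2.
      apply: Hr => //; first by rewrite distrC; apply: (lt_le_trans xu1); move: tr t0; clear; lra.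
      by rewrite distrC; apply: (lt_le_trans xu2); move: tr t0; clear; lra.
    have gs : g z1 z2 < M0 + tau / 2 - f x.1 x.2.
      apply: Hs => //; rewrite distrC; apply: lt_le_trans ts.
        apply: (le_lt_trans (ler_distD u.1 _ _)); move: xu1 uz1 kt; rewrite /ball/=; clear; lra.
      by apply: (le_lt_trans (ler_distD u.2 _ _)); move: xu2 uz2 kt; rewrite /ball/=; clear; lra.
    by lra.
  have [k [k0 kP]] := filter_ex (filterI (nbhs_right_gt 0) HP).
  by exists k; split=> // x Qx; exact: kP.
exists k => // x1 x2 z1 z2 x10 x20 z10 z20 xz1 xz2.
have out : rho < x1 + x2 -> f x1 x2 + g z1 z2 <= M0 + tau.
  move=> yr; have := fB _ _ x10 x20; have := gB _ _ z10 z20.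
  have : d * rho <= d * (x1 + x2) by rewrite ler_pM2l// ltW.
  rewrite rE; have := ler_norm B; have := ler_norm (- M0); rewrite normrN; lra.
have [xr|xr] := ltP rho x1; first by apply: out; lra.
have [x2r|x2r] := ltP rho x2; first by apply: out; lra.
have Qx : Q (x1, x2) by apply/Q_ => /=; rewrite x10 x20 xr x2r.
exact: (kP _ Qx Qx).
Qed.
End convolution.

Section jets.
Variable R : realType.
Implicit Types f g Psi G X : R -> R -> R.

Lemma linear_le_sqr (d C r : R) : 0 < r -> (forall t, `|t| <= r -> d * t <= C * t ^+ 2) -> d = 0.
Proof.
wlog suff : d C r / 0 < r -> (forall t, `|t| <= r -> d * t <= C * t ^+ 2) -> d <= 0.
  move=> H r0 h; apply/eqP; rewrite eq_le (H _ _ _ r0 h) -oppr_le0 (H _ C _ r0)// => t tr.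
  by have := h (- t); rewrite normrN sqrrN mulrN mulNr; exact.
move=> r0 h; rewrite leNgt; apply/negP => d0.
pose t := Num.min r (d / (2 * (`|C| + 1))).
have c0 : 0 < `|C| + 1 by have := normr_ge0 C; lra.
have t0 : 0 < t by rewrite lt_min r0 divr_gt0// mulr_gt0.
have tr : `|t| <= r by rewrite gtr0_norm// ge_min lexx.
have td : t * (2 * (`|C| + 1)) <= d by rewrite -ler_pdivlMr ?mulr_gt0// ge_min lexx orbT.
have := h t tr; rewrite expr2 mulrA ler_pM2r//.
have : C * t <= (`|C| + 1) * t by rewrite ler_pM2r//; have := ler_norm C; lra.
by move: td d0; clear; lra.
Qed.

(** Shifting [x] by [h] and the convolution variable by an independent [k] gives the bound on [f];
    the freedom in [k] is what later shapes the Hessian. The slope is that of [Psi], because keeping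
    [x] fixed bounds [V] below by a paraboloid with that slope. *)
Lemma supconv_jet f Psi G1 G2 X1 X2 (K u1 u2 p1 p2 y11 y12 y22 eta rho : R) :
  (forall z1 z2 x1 x2, Psi x1 x2 <= Psi z1 z2 + G1 z1 z2 * (x1 - z1) + G2 z1 z2 * (x2 - z2)
    + K * ((x1 - z1) ^+ 2 + (x2 - z2) ^+ 2)) ->
  (forall y1 y2, [/\ 0 <= X1 y1 y2, 0 <= X2 y1 y2 &
    forall x1 x2, 0 <= x1 -> 0 <= x2 -> f x1 x2 - Psi (x1 - y1) (x2 - y2) <=
      f (X1 y1 y2) (X2 y1 y2) - Psi (X1 y1 y2 - y1) (X2 y1 y2 - y2)]) ->
  let V y1 y2 := f (X1 y1 y2) (X2 y1 y2) - Psi (X1 y1 y2 - y1) (X2 y1 y2 - y2) in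
  0 < rho ->
  (forall h1 h2, `|h1| <= rho -> `|h2| <= rho -> V (u1 + h1) (u2 + h2) <= V u1 u2
        + p1 * h1 + p2 * h2 + (y11 * h1 ^+ 2 + 2 * y12 * h1 * h2 + y22 * h2 ^+ 2) / 2
        + eta * (h1 ^+ 2 + h2 ^+ 2)) ->
  let x1 := X1 u1 u2 in let x2 := X2 u1 u2 in
  [/\ p1 = G1 (x1 - u1) (x2 - u2), p2 = G2 (x1 - u1) (x2 - u2) &
    forall h1 h2 k1 k2, `|k1| <= rho -> `|k2| <= rho -> 0 <= x1 + h1 -> 0 <= x2 + h2 ->
      f (x1 + h1) (x2 + h2) <= f x1 x2 + p1 * h1 + p2 * h2
        + (y11 * k1 ^+ 2 + 2 * y12 * k1 * k2 + y22 * k2 ^+ 2) / 2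
        + eta * (k1 ^+ 2 + k2 ^+ 2) + K * ((h1 - k1) ^+ 2 + (h2 - k2) ^+ 2)].
Proof.
move=> HP XP V rho0 HV x1 x2.
have [x10 x20 _] := XP u1 u2; rewrite -/x1 -/x2 in x10 x20.
have VE : V u1 u2 = f x1 x2 - Psi (x1 - u1) (x2 - u2) by [].
have low (h1 h2 : R) : V u1 u2 + G1 (x1 - u1) (x2 - u2) * h1 + G2 (x1 - u1) (x2 - u2) * h2
    - K * (h1 ^+ 2 + h2 ^+ 2) <= V (u1 + h1) (u2 + h2).
  have [_ _ /(_ _ _ x10 x20)] := XP (u1 + h1) (u2 + h2).
  rewrite -[X in _ <= X -> _]/(V (u1 + h1) (u2 + h2)) VE.
  have := HP (x1 - u1) (x2 - u2) (x1 - (u1 + h1)) (x2 - (u2 + h2)).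
  rewrite (_ : x1 - (u1 + h1) - (x1 - u1) = - h1); last by ring.
  rewrite (_ : x2 - (u2 + h2) - (x2 - u2) = - h2); last by ring.
  by rewrite !sqrrN; clear; lra.
have p1E : p1 = G1 (x1 - u1) (x2 - u2).
  apply/eqP; rewrite eq_sym -subr_eq0; apply/eqP.
  apply: (@linear_le_sqr _ (K + y11 / 2 + eta) _ rho0) => t tr.
  have := low t 0; have := HV t 0 tr; rewrite normr0 => /(_ (ltW rho0)); clear; lra.
have p2E : p2 = G2 (x1 - u1) (x2 - u2).
  apply/eqP; rewrite eq_sym -subr_eq0; apply/eqP.
  apply: (@linear_le_sqr _ (K + y22 / 2 + eta) _ rho0) => t tr.
  have := low 0 t; have := HV 0 t _ tr; rewrite normr0 => /(_ (ltW rho0)); clear; lra.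
split=> // h1 h2 k1 k2 k1r k2r xh1 xh2.
have := HV _ _ k1r k2r; have [_ _ /(_ _ _ xh1 xh2)] := XP (u1 + k1) (u2 + k2).
rewrite -[X in _ <= X -> _]/(V (u1 + k1) (u2 + k2)) VE.
have := HP (x1 - u1) (x2 - u2) (x1 + h1 - (u1 + k1)) (x2 + h2 - (u2 + k2)).
rewrite -p1E -p2E.
rewrite (_ : x1 + h1 - (u1 + k1) - (x1 - u1) = h1 - k1); last by ring.
rewrite (_ : x2 + h2 - (u2 + k2) - (x2 - u2) = h2 - k2); last by ring.
by clear; lra.
Qed.

(* With L = 1 - T / 2 the increment y = L h gives the quadratic form
   A (T(L h) + |h - L h|^2) = A (T - 3/4 T^2 + 1/4 T^3)(h). *)
Lemma doubled_jets f g Psi G1 G2 (K B c d eta : R) : quadrant_usc f -> quadrant_usc g ->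
  0 < d -> d <= 1 -> 0 < K -> 0 < eta -> eta <= 1 ->
  (forall x1 x2, 0 <= x1 -> 0 <= x2 -> f x1 x2 <= B - d * (x1 + x2)) ->
  (forall x1 x2, 0 <= x1 -> 0 <= x2 -> g x1 x2 <= B) ->
  (forall z1 z2 x1 x2, Psi x1 x2 <= Psi z1 z2 + G1 z1 z2 * (x1 - z1) + G2 z1 z2 * (x2 - z2)
    + K * ((x1 - z1) ^+ 2 + (x2 - z2) ^+ 2)) ->
  (forall z1 z2, `|z1| + `|z2| - c <= Psi z1 z2) -> Psi 0 0 <= 0 ->
  let A := 2 * K + 1 in
  exists x1 x2 z1 z2 u1 u2 w1 w2 p1 p2 q1 q2 t11 t12 t22 r : R, [/\ 0 < r,
    [/\ 0 <= x1, 0 <= x2, 0 <= z1 & 0 <= z2],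
    [/\ `|u1 - w1| <= 2 * eta, `|u2 - w2| <= 2 * eta, `|p1 - q1| <= eta & `|p2 - q2| <= eta],
    [/\ p1 = G1 (x1 - u1) (x2 - u2), p2 = G2 (x1 - u1) (x2 - u2),
        q1 = G1 (w1 - z1) (w2 - z2) & q2 = G2 (w1 - z1) (w2 - z2)] &
    [/\ forall y1 y2, 0 <= y1 -> 0 <= y2 ->
          f y1 y2 + g y1 y2 <= f x1 x2 + g z1 z2 - Psi (x1 - u1) (x2 - u2) - Psi (w1 - z1) (w2 - z2) + eta,
        forall s t, `|t11 * s ^+ 2 + 2 * t12 * s * t + t22 * t ^+ 2| <= s ^+ 2 + t ^+ 2,
        forall h1 h2, `|h1| <= r -> `|h2| <= r -> 0 <= x1 + h1 -> 0 <= x2 + h2 ->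
          f (x1 + h1) (x2 + h2) <= f x1 x2 + p1 * h1 + p2 * h2
            + A * form (cub_lo11 t11 t12 t22) (cub_lo12 t11 t12 t22) (cub_lo22 t11 t12 t22) h1 h2 / 2
            + 3 * eta * (h1 ^+ 2 + h2 ^+ 2) &
        forall h1 h2, `|h1| <= r -> `|h2| <= r -> 0 <= z1 + h1 -> 0 <= z2 + h2 ->
          g (z1 + h1) (z2 + h2) <= g z1 z2 - q1 * h1 - q2 * h2
            - A * form (cub_hi11 t11 t12 t22) (cub_hi12 t11 t12 t22) (cub_hi22 t11 t12 t22) h1 h2 / 2
            + 3 * eta * (h1 ^+ 2 + h2 ^+ 2)]].
Proof.
move=> fu gu d0 d1 K0 eta0 eta1 fB gB HP Pc P0 A.
have fB' x1 x2 : 0 <= x1 -> 0 <= x2 -> f x1 x2 <= B.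
  move=> x10 x20; have := fB _ _ x10 x20; have : 0 <= d * (x1 + x2) by rewrite mulr_ge0 ?addr_ge0// ltW.
  by clear; lra.
(* The penalty for [g] is taken at [w - z], whereas a sup-convolution has it at [z - w]. With this
   reflection both jets carry slopes of the same [Psi], and these nearly agree. *)
pose Psi' z1 z2 := Psi (- z1) (- z2).
pose G1' z1 z2 := - G1 (- z1) (- z2); pose G2' z1 z2 := - G2 (- z1) (- z2).
have HP' z1 z2 x1 x2 : Psi' x1 x2 <= Psi' z1 z2 + G1' z1 z2 * (x1 - z1) + G2' z1 z2 * (x2 - z2)
    + K * ((x1 - z1) ^+ 2 + (x2 - z2) ^+ 2).
  have := HP (- z1) (- z2) (- x1) (- x2); rewrite /Psi' /G1' /G2'.
  rewrite (_ : - x1 - - z1 = - (x1 - z1)); last by ring.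
  by rewrite (_ : - x2 - - z2 = - (x2 - z2)) ?sqrrN; [clear; lra|ring].
have semi (Q D1 D2 : R -> R -> R) : (forall z1 z2 x1 x2, Q x1 x2 <= Q z1 z2 + D1 z1 z2 * (x1 - z1) + D2 z1 z2 * (x2 - z2)
    + K * ((x1 - z1) ^+ 2 + (x2 - z2) ^+ 2)) -> semiconvex K (fun z1 z2 => - Q z1 z2).
  move=> H z1 z2; exists (- D1 z1 z2), (- D2 z1 z2) => x1 x2; have := H z1 z2 x1 x2; clear; lra.
have Pc' z1 z2 : `|z1| + `|z2| - c <= Psi' z1 z2.
  by have := Pc (- z1) (- z2); rewrite !normrN.
have [X1 [X2 XP]] := supconv_exists fu fB' (ltW K0) (semi _ _ _ HP) Pc.
have [Z1 [Z2 ZP]] := supconv_exists gu gB (ltW K0) (semi _ _ _ HP') Pc'.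
have VK := supconv_semiconvex (semi _ _ _ HP) XP.
have WK := supconv_semiconvex (semi _ _ _ HP') ZP.
have [V VE] : exists V : R -> R -> R, V = fun y1 y2 => f (X1 y1 y2) (X2 y1 y2) - Psi (X1 y1 y2 - y1) (X2 y1 y2 - y2).
  by eexists.
have [W WE] : exists W : R -> R -> R, W = fun y1 y2 => g (Z1 y1 y2) (Z2 y1 y2) - Psi' (Z1 y1 y2 - y1) (Z2 y1 y2 - y2).
  by eexists.
have KK0 : 0 <= K + K by rewrite addr_ge0// ltW.
have [||m1 [m2 mP]] := @coercive_max _ (K + K) (2 * B + 2 * c) d (fun y1 y2 => V y1 y2 + W y1 y2) KK0 _ d0.
- by apply: semiconvexD; [rewrite VE|rewrite WE].
- move=> y1 y2; have [x10 x20 _] := XP y1 y2; have [z10 z20 _] := ZP y1 y2; rewrite VE WE.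
  have := fB _ _ x10 x20; have := gB _ _ z10 z20.
  have := Pc (X1 y1 y2 - y1) (X2 y1 y2 - y2); have := Pc' (Z1 y1 y2 - y1) (Z2 y1 y2 - y2).
  have e1 (a b : R) : `|b| <= `|a| + `|a - b|.
    by rewrite -{1}(subKr a b); exact: ler_normB.
  have := e1 (X1 y1 y2) y1; have := e1 (X2 y1 y2) y2; rewrite !(ger0_norm x10) !(ger0_norm x20).
  have := normr_ge0 (Z1 y1 y2 - y1); have := normr_ge0 (Z2 y1 y2 - y2).
  have := normr_ge0 (X1 y1 y2 - y1); have := normr_ge0 (X2 y1 y2 - y2).
  move: d0 d1 x10 x20; clear.
  set a1 := `|X1 _ _ - _|; set a2 := `|X2 _ _ - _| => d0 d1 x10 x20 a10 a20 b10 b20 h1 h2.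
  have : d * (a1 + a2) <= a1 + a2 by rewrite ler_piMl// addr_ge0.
  have : d * (`|y1| + `|y2|) <= d * (X1 y1 y2 + a1 + (X2 y1 y2 + a2)) by rewrite ler_pM2l//; lra.
  by lra.
have WK' : semiconvex K (fun y1 y2 => - - W y1 y2).
  by move=> s t; have [a1 [a2 h]] := WK s t; exists a1, a2 => y1 y2; rewrite !opprK WE; exact: h.
rewrite -VE in VK.
have mP' y1 y2 : V y1 y2 - (- W y1 y2) <= V m1 m2 - (- W m1 m2) by rewrite !opprK.
have [u1 [u2 [w1 [w2 [p1 [p2 [q1 [q2 [y11 [y12 [y22 [rho [rho0 [[um1 um2 wm1 wm2] HV HW [pq1 pq2 Dm] yA]]]]]]]]]]]]]] :=
  @approx_jets _ V (fun y1 y2 => - W y1 y2) K m1 m2 eta K0 VK WK' mP' eta0 eta1.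
have A0 : 0 < A by rewrite /A; move: K0; clear; lra.
have AE : A = 2 * K + 1 by [].
rewrite -AE in yA; clearbody A.
have [t11 [t12 [t22 [yE1 yE2 yE3]]]] : exists t11 t12 t22, [/\ y11 = A * t11, y12 = A * t12 & y22 = A * t22].
  by exists (y11 / A), (y12 / A), (y22 / A); rewrite ![A * _]mulrC !divfK// gt_eqF.
rewrite {}yE1 {}yE2 {}yE3 in HV HW yA.
have t1 s t : `|t11 * s ^+ 2 + 2 * t12 * s * t + t22 * t ^+ 2| <= s ^+ 2 + t ^+ 2.
  rewrite -(ler_pM2l A0) -{1}(gtr0_norm A0) -normrM.
  by rewrite (_ : A * (_ + _) = A * t11 * s ^+ 2 + 2 * (A * t12) * s * t + A * t22 * t ^+ 2); [exact: yA|ring].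
rewrite VE in HV.
have [p1E p2E Hf] := supconv_jet HP XP rho0 HV.
have HW' h1 h2 : `|h1| <= rho -> `|h2| <= rho ->
    g (Z1 (w1 + h1) (w2 + h2)) (Z2 (w1 + h1) (w2 + h2))
      - Psi' (Z1 (w1 + h1) (w2 + h2) - (w1 + h1)) (Z2 (w1 + h1) (w2 + h2) - (w2 + h2))
    <= g (Z1 w1 w2) (Z2 w1 w2) - Psi' (Z1 w1 w2 - w1) (Z2 w1 w2 - w2) + - q1 * h1 + - q2 * h2
      + (- (A * t11) * h1 ^+ 2 + 2 * - (A * t12) * h1 * h2 + - (A * t22) * h2 ^+ 2) / 2
      + eta * (h1 ^+ 2 + h2 ^+ 2).
  by move=> r1 r2; have := HW _ _ r1 r2; rewrite WE; clear; lra.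
have [q1E q2E Hg] := supconv_jet HP' ZP rho0 HW'.
have [x10 x20 _] := XP u1 u2; have [z10 z20 _] := ZP w1 w2.
have zE1 : - (Z1 w1 w2 - w1) = w1 - Z1 w1 w2 by rewrite opprB.
have zE2 : - (Z2 w1 w2 - w2) = w2 - Z2 w1 w2 by rewrite opprB.
have small (h1 h2 k1 k2 : R) : `|h1| <= rho / 3 -> `|h2| <= rho / 3 ->
    k1 ^+ 2 + k2 ^+ 2 <= 9 / 4 * (h1 ^+ 2 + h2 ^+ 2) -> `|k1| <= rho /\ `|k2| <= rho.
  move=> h1r h2r kh; have r3 : 0 <= rho / 3 by rewrite divr_ge0// ltW.
  have sq (h : R) : `|h| <= rho / 3 -> h ^+ 2 <= (rho / 3) ^+ 2.
    by move=> hr; rewrite -(real_normK (num_real h)) ler_pXn2r.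
  have k0 (k : R) : k ^+ 2 <= rho ^+ 2 -> `|k| <= rho.
    by move=> kr; rewrite -(@ler_pXn2r _ 2)// ?nnegrE ?(ltW rho0)// real_normK// num_real.
  have k1p := sqr_ge0 k1; have k2p := sqr_ge0 k2; have rp := sqr_ge0 rho.
  by split; apply: k0; move: (sq _ h1r) (sq _ h2r) k1p k2p rp kh; clear; lra.
exists (X1 u1 u2), (X2 u1 u2), (Z1 w1 w2), (Z2 w1 w2), u1, u2, w1, w2, p1, p2, q1, q2, t11, t12, t22, (rho / 3).
split=> //.
- by rewrite divr_gt0.
- split=> //.
    by move: um1 wm1; rewrite !ler_norml; clear; lra.
  by move: um2 wm2; rewrite !ler_norml; clear; lra.
- split=> //; first by apply: oppr_inj; rewrite q1E /G1' zE1 zE2.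
  by apply: oppr_inj; rewrite q2E /G2' zE1 zE2.
split=> //.
- move=> y1 y2 y10 y20; have := mP y1 y2; move: Dm; rewrite VE WE.
  have [_ _ /(_ _ _ y10 y20)] := XP y1 y2; have [_ _ /(_ _ _ y10 y20)] := ZP y1 y2.
  have PE (a b : R) : Psi' a b = Psi (- a) (- b) by [].
  rewrite !PE zE1 zE2 !subrr oppr0; move: P0; clear; lra.
- move=> h1 h2 h1r h2r xh1 xh2; have [lo _] := half_step_sqr t1 h1 h2.
  have [k1r k2r] := small _ _ _ _ h1r h2r lo.
  apply: (le_trans (Hf _ _ _ _ k1r k2r xh1 xh2)).
  rewrite cub_loE !subKr /form; move: lo AE K0 eta0; clear.
  set k1 := h1 - _; set k2 := h2 - _; set d1 := (t11 * h1 + t12 * h2) / 2; set d2 := (t12 * h1 + t22 * h2) / 2 => lo -> K0 eta0.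
  have : eta * (k1 ^+ 2 + k2 ^+ 2) <= 3 * eta * (h1 ^+ 2 + h2 ^+ 2).
    rewrite (mulrC 3) -mulrA ler_pM2l//; have := sqr_ge0 h1; have := sqr_ge0 h2; lra.
  by have := sqr_ge0 d1; have := sqr_ge0 d2; lra.
move=> h1 h2 h1r h2r xh1 xh2; have [_ lo] := half_step_sqr t1 h1 h2.
have [k1r k2r] := small _ _ _ _ h1r h2r lo.
apply: (le_trans (Hg _ _ _ _ k1r k2r xh1 xh2)).
rewrite cub_hiE /form; move: lo AE K0 eta0; clear.
have sub (a b : R) : a - (a + b) = - b by ring.
rewrite !sub !sqrrN.
set k1 := h1 + _; set k2 := h2 + _; set d1 := (t11 * h1 + t12 * h2) / 2; set d2 := (t12 * h1 + t22 * h2) / 2 => lo -> K0 eta0.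
have : eta * (k1 ^+ 2 + k2 ^+ 2) <= 3 * eta * (h1 ^+ 2 + h2 ^+ 2).
  rewrite (mulrC 3) -mulrA ler_pM2l//; have := sqr_ge0 h1; have := sqr_ge0 h2; lra.
by have := sqr_ge0 d1; have := sqr_ge0 d2; lra.
Qed.
End jets.

Section doubling.
Variable R : realType.
Implicit Types f g : R -> R -> R.

Lemma exists_below (s : seq R) : all (fun c => 0 < c) s -> exists2 e, 0 < e & all (fun c => e <= c) s.
Proof.
elim: s => [|c s IH] /=; first by exists 1.
move=> /andP[c0 /IH[e e0 es]]; exists (Num.min c e); first by rewrite lt_min c0.
rewrite ge_min lexx /=; apply: sub_all es => b eb; by rewrite ge_min eb orbT.
Qed.

(** If [x = 0] and [u >= 0], the first penalty has the right sign. If [u < 0], then [w - z] is at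
    most [2 * eta], as [z >= 0], so the second penalty has it up to C (2 eta) / eps, and the slopes
    differ by at most [eta]. The case [z = 0] is symmetric. *)
Lemma boundary_jet (h : R -> R) (C eps eta e x u w z p1 p2 q1 q2 : R) :
  0 < C -> 0 < eps -> 0 <= eta -> (2 * C / eps + 2) * eta <= e ->
  (forall s t, s <= t -> 0 <= h t - h s <= t - s) ->
  (0 <= x - u -> 0 <= p1 - h p2 <= C * (x - u) / eps) /\
    (x - u <= 0 -> C * (x - u) / eps <= p1 - h p2 <= 0) ->
  (0 <= w - z -> 0 <= q1 - h q2 <= C * (w - z) / eps) /\
    (w - z <= 0 -> C * (w - z) / eps <= q1 - h q2 <= 0) ->
  0 <= x -> 0 <= z -> `|u - w| <= 2 * eta -> `|p1 - q1| <= eta -> `|p2 - q2| <= eta ->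
  (x = 0 -> - e <= h p2 - p1) /\ (z = 0 -> h q2 - q1 <= e).
Proof.
move=> C0 eps0 eta0 ee hlip [xu ux] [wz zw] x0 z0.
rewrite !ler_norml => /andP[uw1 uw2] /andP[p11 p12] /andP[p21 p22].
have hq : - eta <= h p2 - h q2 <= eta.
  by have [/hlip|/ltW/hlip] := leP p2 q2; move: p21 p22; clear; lra.
have k0 : 0 < C / eps by rewrite divr_gt0.
have kE (s : R) : C * s / eps = C / eps * s by rewrite mulrAC.
have eE : (2 * C / eps + 2) * eta = C / eps * (2 * eta) + 2 * eta by ring.
have k1 : 0 <= C / eps * (2 * eta) by rewrite mulr_ge0 ?(ltW k0)// mulr_ge0.
rewrite !kE in xu ux wz zw; rewrite eE in ee.
split=> [xE|zE].
  rewrite {}xE {x x0} in xu ux.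
  have [uge|ult] := leP 0 u.
    have /ux : 0 - u <= 0 by move: uge; clear; lra.
    by move: ee k1 eta0; clear; lra.
  have [/wz|/ltW/zw] := leP 0 (w - z).
    have : C / eps * (w - z) <= C / eps * (2 * eta) by rewrite ler_pM2l//; move: ult uw1 z0; clear; lra.
    by move: hq p12 ee; clear; lra.
  by move: hq p12 ee k1; clear; lra.
rewrite {}zE {z z0} in wz zw.
have [wge|wlt] := leP 0 w.
  have /wz : 0 <= w - 0 by rewrite subr0.
  by move: ee k1 eta0; clear; lra.
have [/xu|/ltW/ux] := leP 0 (x - u).
  by move: hq p12 p11 ee k1; clear; lra.
have : C / eps * (- (2 * eta)) <= C / eps * (x - u) by rewrite ler_pM2l//; move: wlt uw2 x0; clear; lra.
by rewrite mulrN; move: hq p12 p11 ee; clear; lra.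
Qed.

Lemma penalty_bound (n1 n2 X M0 B eta eps AA : R) : 0 < eps -> eps <= 1 -> eta <= 1 -> 
  0 <= AA -> X <= 2 * B ->
  n1 ^+ 2 + n2 ^+ 2 <= 16 * eps * (X - M0 + eta + AA * (n1 + n2)) ->
  n1 ^+ 2 + n2 ^+ 2 <= eps * (32 * (2 * `|B| + `|M0| + 1 + 16 * AA ^+ 2)).
Proof.
move=> eps0 eps1 eta1 AA0 XB h.
have : 16 * eps * (X - M0 + eta + AA * (n1 + n2)) <= 16 * eps * (2 * `|B| + `|M0| + 1 + AA * (n1 + n2)).
  rewrite ler_pM2l ?mulr_gt0//; have := ler_norm B; have := ler_norm (- M0); rewrite normrN.
  by move: eta1 XB; clear; lra.
have := sqr_ge0 (n1 - 16 * eps * AA); have := sqr_ge0 (n2 - 16 * eps * AA).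
have : eps * (eps * AA ^+ 2) <= eps * AA ^+ 2 by rewrite ler_pM2l// ler_piMl// sqr_ge0.
by move: h; clear; lra.
Qed.

Lemma doubling (al a1 a2 : R) (h1 h2 : R -> R) : 0 <= al -> al < 1 ->
  (forall s t, s <= t -> 0 <= h1 t - h1 s <= al * (t - s)) ->
  (forall s t, s <= t -> 0 <= h2 t - h2 s <= al * (t - s)) ->
  h1 a2 = a1 -> h2 a1 = a2 ->
  exists C : R, 0 < C /\ forall f g (B d M0 tau e : R), quadrant_usc f -> quadrant_usc g ->
  0 < d -> d <= 1 -> 0 < tau -> 0 < e -> e <= 1 ->
  (forall x1 x2, 0 <= x1 -> 0 <= x2 -> f x1 x2 <= B - d * (x1 + x2)) ->
  (forall x1 x2, 0 <= x1 -> 0 <= x2 -> g x1 x2 <= B) ->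
  (forall x1 x2, 0 <= x1 -> 0 <= x2 -> f x1 x2 + g x1 x2 <= M0) ->
  (forall m, (forall x1 x2, 0 <= x1 -> 0 <= x2 -> f x1 x2 + g x1 x2 <= m) -> M0 <= m) ->
  exists x1 x2 z1 z2 p1 p2 q1 q2 l11 l12 l22 m11 m12 m22 A r : R, [/\ 0 < r, 0 < A,
    [/\ 0 <= x1, 0 <= x2, 0 <= z1, 0 <= z2 & M0 - 2 * tau <= f x1 x2 + g z1 z2],
    [/\ `|p1 - q1| <= e, `|p2 - q2| <= e &
        A * (`|x1 - z1| + `|x2 - z2|) ^+ 2 + (`|x1 - z1| + `|x2 - z2|) * (`|p1| + `|p2| + 1) <= C * tau] &
    [/\ [/\ x1 = 0 -> - e <= h1 p2 - p1, z1 = 0 -> h1 q2 - q1 <= e,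
            x2 = 0 -> - e <= h2 p1 - p2 & z2 = 0 -> h2 q1 - q2 <= e],
        [/\ forall s t, - (A * (s ^+ 2 + t ^+ 2)) <= form l11 l12 l22 s t,
            forall s t, form m11 m12 m22 s t <= A * (s ^+ 2 + t ^+ 2) &
            forall s t s' t', form l11 l12 l22 s t - form m11 m12 m22 s' t' <=
              A * ((s - s') ^+ 2 + (t - t') ^+ 2)],
        forall k1 k2, `|k1| <= r -> `|k2| <= r -> 0 <= x1 + k1 -> 0 <= x2 + k2 ->
          f (x1 + k1) (x2 + k2) <= f x1 x2 + p1 * k1 + p2 * k2
            + form l11 l12 l22 k1 k2 / 2 + 3 * e * (k1 ^+ 2 + k2 ^+ 2) &
        forall k1 k2, `|k1| <= r -> `|k2| <= r -> 0 <= z1 + k1 -> 0 <= z2 + k2 ->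
          g (z1 + k1) (z2 + k2) <= g z1 z2 - q1 * k1 - q2 * k2
            - form m11 m12 m22 k1 k2 / 2 + 3 * e * (k1 ^+ 2 + k2 ^+ 2)]].
Proof.
move=> al0 al1 H1 H2 ha1 ha2.
have [M [C [M0 C0 test]]] := scaled_test_function al0 al1 H1 H2 ha1 ha2.
have lip (h : R -> R) : (forall s t, s <= t -> 0 <= h t - h s <= al * (t - s)) ->
    forall s t, s <= t -> 0 <= h t - h s <= t - s.
  move=> hh s t st; have /andP[-> hu] := hh s t st; apply: (le_trans hu).
  by rewrite ler_piMl ?subr_ge0// ltW.
(* The doubled points will satisfy |x - z|_1^2 <= 193 eps tau. The matrix bound 2 (M / eps + 1)
   turns this into 386 (M + eps) tau; slopes of order 8 |.| / eps give 8 * 193 = 1544, and their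
   bounded part gives 2. *)
exists (386 * (M + 1) + 1546); split; first by move: M0; clear; lra.
move=> f g B d S tau e fu gu d0 d1 tau0 e0 e1 fB gB fgS SS.
have [kap kap0 close] := close_sum_le fu gu d0 tau0 fB gB fgS.
pose AA := `|a1| + `|a2|.
have AA0 : 0 <= AA by rewrite addr_ge0.
pose C2 := 32 * (2 * `|B| + `|S| + 1 + 16 * AA ^+ 2).
have C20 : 0 < C2.
  by have := normr_ge0 B; have := normr_ge0 S; have := sqr_ge0 AA; rewrite /C2; clear; lra.
have AA1 : 0 < AA + 1 by rewrite ltr_wpDl.
have [kk kk0 /= /and3P[kk1 kk2 _]] : exists2 kk : R, 0 < kk & all (fun c => kk <= c) [:: kap / 2; tau / (AA + 1)].
  by apply: exists_below; rewrite /= !divr_gt0.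
(* [eps] depends on [tau] and on the closeness [kap], and [eta] will depend on [eps], because
   boundary errors are of size [eta / eps]. *)
have [eps eps0 /= /and3P[eps1 eps2 _]] : exists2 eps : R, 0 < eps & all (fun c => eps <= c) [:: 1; kk ^+ 2 / (2 * C2)].
  by apply: exists_below; rewrite /= ltr01 divr_gt0// ?exprn_gt0// mulr_gt0.
have [eta eta0 /= /and5P[eta1 eta2 eta3 eta4 /and3P[eta5 eta6 _]]] : exists2 eta : R, 0 < eta &
    all (fun c => eta <= c) [:: 1; e; eps * tau / 32; kap / 4; e / (2 * C / eps + 2); tau / (4 * (AA + 1))].
  have cc : 0 < 2 * C / eps + 2 by rewrite addr_gt0// divr_gt0// mulr_gt0.
  by apply: exists_below; rewrite /= ltr01 e0 !divr_gt0 ?mulr_gt0.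
have {}eta5 : (2 * C / eps + 2) * eta <= e.
  by rewrite mulrC -ler_pdivlMr// addr_gt0// divr_gt0// mulr_gt0.
have {}eta6 : 4 * eta * (AA + 1) <= tau.
  by move: eta6; rewrite ler_pdivlMr ?mulr_gt0//; clear; lra.
have {}kk2 : kk * (AA + 1) <= tau by rewrite -ler_pdivlMr.
have {}eps2 : 2 * (eps * C2) <= kk ^+ 2.
  by rewrite mulrCA -ler_pdivlMr// mulr_gt0.
have [Psi [G1 [G2 P]]] := test _ eps0.
have K0 : 0 < M / (2 * eps) by rewrite divr_gt0// mulr_gt0.
have Plow z1 z2 : (`|z1| + `|z2|) ^+ 2 / (16 * eps) - AA * (`|z1| + `|z2|) <= Psi z1 z2.
  have [_ [_ +] _ _ _] := P z1 z2.
  have pr (b y : R) : - (`|b| * `|y|) <= b * y by rewrite -normrM lerNl -normrN ler_norm.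
  have := pr a1 z1; have := pr a2 z2; rewrite /AA.
  have := mulr_ge0 (normr_ge0 a1) (normr_ge0 z2); have := mulr_ge0 (normr_ge0 a2) (normr_ge0 z1).
  clear; lra.
have Pc z1 z2 : `|z1| + `|z2| - 4 * eps * (AA + 1) ^+ 2 <= Psi z1 z2.
  apply: le_trans (Plow z1 z2); set n := _ + `|z2|.
  rewrite -subr_ge0 (_ : _ - _ = (n - 8 * eps * (AA + 1)) ^+ 2 / (16 * eps)).
    by rewrite divr_ge0 ?sqr_ge0// mulr_ge0// ltW.
  by field; rewrite gt_eqF.
have P1 z1 z2 : forall x1 x2, Psi x1 x2 <= Psi z1 z2 + G1 z1 z2 * (x1 - z1) + G2 z1 z2 * (x2 - z2)
        + M / (2 * eps) * ((x1 - z1) ^+ 2 + (x2 - z2) ^+ 2) by have [] := P z1 z2.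
have P0 : Psi 0 0 <= 0 by have [_ [] ] := P 0 0.
have [x1 [x2 [z1 [z2 [u1 [u2 [w1 [w2 [p1 [p2 [q1 [q2 [t11 [t12 [t22 [r J]]]]]]]]]]]]]]]] :=
  doubled_jets fu gu d0 d1 K0 eta0 eta1 fB gB P1 Pc P0.
case: J => r0 [x10 x20 z10 z20] [uw1 uw2 pq1 pq2] [p1E p2E q1E q2E] [Jmax Jt Jf Jg].
have [K KE] : exists K, K = M / (2 * eps) by eexists.
rewrite -KE in K0 Jf Jg.
have A0 : 0 < 2 * K + 1 by move: K0; clear; lra.
have s1E : (x1 - u1) + (w1 - z1) = (x1 - z1) - (u1 - w1) by ring.
have s2E : (x2 - u2) + (w2 - z2) = (x2 - z2) - (u2 - w2) by ring.
have [_ [_ _] [G1a G2a] E1a E2a] := P (x1 - u1) (x2 - u2).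
have [_ [_ _] _ E1b E2b] := P (w1 - z1) (w2 - z2).
rewrite -p1E in G1a; rewrite -p2E in G2a.
rewrite -p1E -p2E in E1a E2a; rewrite -q1E -q2E in E1b E2b.
have tri (s t k m : R) : s + t = k - m -> `|k| <= `|s| + `|t| + `|m|.
  move=> h; rewrite (_ : k = s + t + m); last by rewrite h subrK.
  by apply: (le_trans (ler_normD _ _)); rewrite lerD2r ler_normD.
have xz1 := tri _ _ _ _ s1E; have xz2 := tri _ _ _ _ s2E.
have low1 := Plow (x1 - u1) (x2 - u2); have low2 := Plow (w1 - z1) (w2 - z2).
have [n1 [n1E n10]] : exists n1, n1 = `|x1 - u1| + `|x2 - u2| /\ 0 <= n1.
  by exists (`|x1 - u1| + `|x2 - u2|); split=> //; exact: addr_ge0.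
have [n2 [n2E n20]] : exists n2, n2 = `|w1 - z1| + `|w2 - z2| /\ 0 <= n2.
  by exists (`|w1 - z1| + `|w2 - z2|); split=> //; exact: addr_ge0.
rewrite -n1E in low1 G1a G2a; rewrite -n2E in low2.
have [X XE] : exists X, X = f x1 x2 + g z1 z2 by eexists.
have SX : S <= X - Psi (x1 - u1) (x2 - u2) - Psi (w1 - z1) (w2 - z2) + eta.
  by apply: SS => y1 y2 y10 y20; rewrite XE; exact: Jmax.
have XB : X <= 2 * B.
  rewrite XE; have := fB _ _ x10 x20; have := gB _ _ z10 z20.
  have : 0 <= d * (x1 + x2) by rewrite mulr_ge0 ?addr_ge0// ltW.
  by clear; lra.
(* Used twice: with the crude bound [X <= 2 * B] it brings the points close enough for
   [close_sum_le], and the resulting [X <= S + tau] improves it to [48 * (eps * tau)]. *)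
have nn : n1 ^+ 2 + n2 ^+ 2 <= 16 * eps * (X - S + eta + AA * (n1 + n2)).
  rewrite mulrC -ler_pdivrMr ?mulr_gt0//; move: SX low1 low2; clear; lra.
have nC : 2 * (n1 ^+ 2 + n2 ^+ 2) <= kk ^+ 2.
  by apply: le_trans eps2; rewrite ler_pM2l//; exact: penalty_bound XB nn.
have nk : n1 + n2 <= kk.
  rewrite -(@ler_pXn2r _ 2) ?nnegrE ?addr_ge0 ?(ltW kk0)//; apply: le_trans nC.
  by have := sqr_ge0 (n1 - n2); clear; lra.
have An : AA * (n1 + n2) <= tau.
  have : (AA + 1) * (n1 + n2) <= (AA + 1) * kk by rewrite ler_pM2l.
  by move: kk2 n10 n20; clear; lra.
have eta_tau : eta <= tau.
  have : eps * tau <= tau by rewrite ler_piMl// ltW.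
  by move: eta3 tau0; clear; lra.
have XS : X <= S + tau.
  rewrite XE; apply: close => //.
    have := normr_ge0 (x2 - u2); have := normr_ge0 (w2 - z2).
    by move: xz1 uw1 eta4 nk kk1 n1E n2E; clear; lra.
  have := normr_ge0 (x1 - u1); have := normr_ge0 (w1 - z1).
  by move: xz2 uw2 eta4 nk kk1 n1E n2E; clear; lra.
have SX' : S - 2 * tau <= X.
  have h1' : 0 <= n1 ^+ 2 / (16 * eps) by rewrite divr_ge0 ?sqr_ge0 ?mulr_ge0// ltW.
  have h2' : 0 <= n2 ^+ 2 / (16 * eps) by rewrite divr_ge0 ?sqr_ge0 ?mulr_ge0// ltW.
  by move: SX low1 low2 An eta_tau h1' h2'; clear; lra.
have et0 : 0 < eps * tau by rewrite mulr_gt0.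
have n48 : n1 ^+ 2 + n2 ^+ 2 <= 48 * (eps * tau).
  apply: (le_trans nn); rewrite (_ : 48 * (eps * tau) = 16 * eps * (3 * tau)); last by ring.
  by rewrite ler_pM2l ?mulr_gt0//; move: XS An eta_tau; clear; lra.
have [q [qE q0]] : exists q, q = n1 + n2 + 4 * eta /\ 0 <= q.
  by exists (n1 + n2 + 4 * eta); split=> //; rewrite !addr_ge0// mulr_ge0// ltW.
have q193 : q ^+ 2 <= 193 * (eps * tau).
  have : 32 * eta ^+ 2 <= eps * tau.
    have : eta * eta <= eta * 1 by rewrite ler_pM2l.
    by move: eta3; clear; lra.
  have := sqr_ge0 (n1 - n2); have := sqr_ge0 (n1 + n2 - 4 * eta).
  by rewrite qE; move: n48; clear; lra.
have xzq : `|x1 - z1| + `|x2 - z2| <= q.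
  by rewrite qE n1E n2E; move: xz1 xz2 uw1 uw2; clear; lra.
have xz0 : 0 <= `|x1 - z1| + `|x2 - z2| by rewrite addr_ge0.
have bnd1 := boundary_jet C0 eps0 (ltW eta0) eta5 (lip _ H1) E1a E1b x10 z10 uw1 pq1 pq2.
have bnd2 := boundary_jet C0 eps0 (ltW eta0) eta5 (lip _ H2) E2a E2b x20 z20 uw2 pq2 pq1.
have A20 : 0 < 2 * (2 * K + 1) by rewrite mulr_gt0.
have scale (c b1 b2 b3 s t : R) : form (c * b1) (c * b2) (c * b3) s t = c * form b1 b2 b3 s t.
  by rewrite /form; ring.
exists x1, x2, z1, z2, p1, p2, q1, q2,
  ((2 * K + 1) * cub_lo11 t11 t12 t22), ((2 * K + 1) * cub_lo12 t11 t12 t22), ((2 * K + 1) * cub_lo22 t11 t12 t22),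
  ((2 * K + 1) * cub_hi11 t11 t12 t22), ((2 * K + 1) * cub_hi12 t11 t12 t22), ((2 * K + 1) * cub_hi22 t11 t12 t22),
  (2 * (2 * K + 1)), r; split=> //.
- by rewrite -XE.
- split; [exact: le_trans eta2|exact: le_trans eta2|].
  set D := `|x1 - z1| + _ in xzq xz0 *.
  have h1' : 2 * (2 * K + 1) * D ^+ 2 <= 386 * (M + 1) * tau.
    apply: (@le_trans _ _ (2 * (2 * K + 1) * (193 * (eps * tau)))).
      by rewrite ler_pM2l//; apply: le_trans q193; rewrite ler_pXn2r.
    have -> : 2 * (2 * K + 1) * (193 * (eps * tau)) = 386 * (M + eps) * tau.
      by rewrite KE; field; rewrite gt_eqF.
    by rewrite ler_pM2r// ler_pM2l ?ltr0n// lerD2l.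
  have h2' : D * (`|p1| + `|p2| + 1) <= q * (AA + 1 + 8 * q / eps).
    apply: (ler_pM xz0 _ xzq); first by rewrite addr_ge0// addr_ge0.
    have : 8 * n1 / eps <= 8 * q / eps.
      by rewrite ler_pM2r ?invr_gt0// ler_pM2l// qE; move: n20 eta0; clear; lra.
    have -> : 8 * n1 / eps = 4 * n1 / eps + 4 * n1 / eps by ring.
    by move: G1a G2a; rewrite /AA; clear; lra.
  have h3 : q * (8 * q / eps) <= 1544 * tau.
    rewrite (_ : _ * _ = 8 * q ^+ 2 / eps); last by ring.
    by rewrite ler_pdivrMr//; move: q193; clear; lra.
  have h4 : q * (AA + 1) <= 2 * tau.
    have := ler_wpM2l (ltW AA1) nk; move: kk2 eta6; rewrite qE; clear; lra.
  by move: h1' h2' h3 h4; clear; lra.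
split.
- by have [? ?] := bnd1; have [? ?] := bnd2.
- split=> [s t|s t|s t s' t'].
  + rewrite scale; have := ler_wpM2l (ltW A0) (cub_lo_ge Jt s t); clear; lra.
  + rewrite scale; have := ler_wpM2l (ltW A0) (cub_hi_le Jt s t); clear; lra.
  rewrite !scale; have := ler_wpM2l (ltW A0) (cub_lo_hi Jt s t s' t'); clear; lra.
- move=> k1 k2 k1r k2r xk1 xk2; apply: (le_trans (Jf _ _ k1r k2r xk1 xk2)); rewrite scale.
  have : 3 * eta * (k1 ^+ 2 + k2 ^+ 2) <= 3 * e * (k1 ^+ 2 + k2 ^+ 2).
    by rewrite ler_wpM2r ?addr_ge0 ?sqr_ge0// ler_pM2l.
  by clear; lra.
move=> k1 k2 k1r k2r xk1 xk2; apply: (le_trans (Jg _ _ k1r k2r xk1 xk2)); rewrite scale.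
have : 3 * eta * (k1 ^+ 2 + k2 ^+ 2) <= 3 * e * (k1 ^+ 2 + k2 ^+ 2).
  by rewrite ler_wpM2r ?addr_ge0 ?sqr_ge0// ler_pM2l.
by clear; lra.
Qed.
End doubling.

(** * Comparison *)

Section comparison.
Variable R : realType.
Implicit Types (f g : R -> R -> R) (v : 'rV[R]_2 -> R).

Lemma zeta_lipschitz (s t : R) : 0 <= s -> 0 <= t -> `|zeta s - zeta t| <= `|s - t|.
Proof.
move=> s0 t0; have s1 : 0 < 1 + s by lra.
have t1 : 0 < 1 + t by lra.
have n1 : 1 + s != 0 by rewrite gt_eqF.
have n2 : 1 + t != 0 by rewrite gt_eqF.
have -> : zeta s - zeta t = (1 - 2 / ((1 + s) * (1 + t))) * (s - t).
  by rewrite /zeta; field; apply/andP; split.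
rewrite normrM ler_piMl// ler_norml.
have st : 1 <= (1 + s) * (1 + t) by rewrite mulr_ege1//; lra.
have : 0 <= 2 / ((1 + s) * (1 + t)) <= 2.
  by rewrite divr_ge0 ?mulr_ge0 ?(ltW s1) ?(ltW t1)//= ler_pdivrMr ?mulr_gt0//; lra.
by lra.
Qed.

Lemma usc_on_penalized v (d : R) : usc_on (closure (Omega R)) v -> 0 < d -> d <= 1 ->
  quadrant_usc (fun y1 y2 => v (vec2 y1 y2) - d * (zeta y1 + zeta y2)).
Proof.
move=> vu d0 d1; apply: (@quadrant_uscD _ (fun y1 y2 => v (vec2 y1 y2)) (fun y1 y2 => - (d * (zeta y1 + zeta y2)))).
  by move=> x1 x2 m x10 x20 vm; exact: (usc_on_vec2 vu x10 x20 vm).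
move=> x1 x2 e x10 x20 e0; exists (e / 2) => [|y1 y2 y10 y20 h1 h2]; first exact: divr_gt0.
have -> : - (d * (zeta y1 + zeta y2)) - - (d * (zeta x1 + zeta x2)) =
    - (d * ((zeta y1 - zeta x1) + (zeta y2 - zeta x2))) by ring.
rewrite normrN normrM gtr0_norm//.
have z1 := zeta_lipschitz y10 x10; have z2 := zeta_lipschitz y20 x20.
apply: (@le_lt_trans _ _ (`|(zeta y1 - zeta x1) + (zeta y2 - zeta x2)|)); first by rewrite ler_piMl.
by apply: (le_lt_trans (ler_normD _ _)); move: z1 z2 h1 h2; clear; lra.
Qed.

Lemma modulus_small (omega : R -> R) (c : R) : modulus omega -> 0 < c ->
  exists2 t : R, 0 < t & forall s, 0 <= s <= t -> omega s <= c.
Proof.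
move=> [/continuous_within_itvcyP[_ oc] omono _ o0] c0; rewrite o0 in oc.
have oc' : \forall t \near 0^'+, `|0 - omega t| <= c by move/cvgrPdist_le : oc; exact.
have [t [t0]] := filter_ex (filterI (nbhs_right_gt 0) oc').
rewrite sub0r normrN => ot; exists t => // s /andP[s0 st].
apply: le_trans ot; apply: le_trans (ler_norm _); apply: omono => //; rewrite in_itv/= ?s0//.
by rewrite ltW.
Qed.

Lemma sum_sup f g (B : R) : (forall x1 x2, 0 <= x1 -> 0 <= x2 -> f x1 x2 + g x1 x2 <= B) ->
  exists S : R, (forall x1 x2, 0 <= x1 -> 0 <= x2 -> f x1 x2 + g x1 x2 <= S) /\
    forall m, (forall x1 x2, 0 <= x1 -> 0 <= x2 -> f x1 x2 + g x1 x2 <= m) -> S <= m.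
Proof.
move=> fgB; pose E := [set s | exists x1 x2, [/\ 0 <= x1, 0 <= x2 & s = f x1 x2 + g x1 x2]].
have E0 : E !=set0 by exists (f 0 0 + g 0 0), 0, 0.
have Eub m : (forall x1 x2, 0 <= x1 -> 0 <= x2 -> f x1 x2 + g x1 x2 <= m) -> ubound E m.
  by move=> H _ [x1 [x2 [x10 x20 ->]]]; exact: H.
exists (sup E); split=> [x1 x2 x10 x20|m /Eub Em]; last exact: ge_sup.
by apply: sup_upper_bound; [split=> //; exists B; exact: Eub|exists x1, x2].
Qed.

End comparison.

Theorem theorem6p2 (R : realType)
  (F : 'M[R]_2 -> 'rV[R]_2 -> R -> 'rV[R]_2 -> R)
  (* F is continuous on S^2 x R^2 x R x closure Omega *)
  (F_cont : {within [set z : 'M[R]_2 * 'rV[R]_2 * R * 'rV[R]_2 |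
                       z.1.1.1 \is symmetricmx /\ closure (Omega R) z.2],
              continuous (fun z => F z.1.1.1 z.1.1.2 z.1.2 z.2)})
  (F_i : exists2 mu : R, 0 < mu &
     forall (X : 'M[R]_2) (p x : 'rV[R]_2), X \is symmetricmx -> Omega R x ->
       {homo (fun u : R => F X p u x - mu * u) : s t / s <= t})
  (F_ii : exists2 L : R, 0 < L &
     forall (X Y : 'M[R]_2) (p q : 'rV[R]_2) (u : R) (x : 'rV[R]_2),
       X \is symmetricmx -> Y \is symmetricmx -> Omega R x ->
       `|F X p u x - F Y q u x| <= L * (opnorm (X - Y) + enorm (p - q)))
  (F_iii : exists2 omega : R -> R, modulus omega &
     forall (X Y : 'M[R]_2) (x y p : 'rV[R]_2) (u alpha : R),
       X \is symmetricmx -> Y \is symmetricmx ->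
       Omega R x -> Omega R y -> 0 < alpha ->
       loewner_le (- (alpha *: block_mx 1%:M 0 0 1%:M)) (block_mx X 0 0 (- Y)) ->
       loewner_le (block_mx X 0 0 (- Y))
         (alpha *: block_mx 1%:M (- 1%:M) (- 1%:M) 1%:M) ->
       - omega (alpha * enorm (x - y) ^+ 2 + enorm (x - y) * (enorm p + 1))
         <= F X p u x - F Y p u y)
  (h1 h2 : R -> R) (alpha1 alpha2 : R)
  (h1_convex : convex_function [set: R^o] h1)
  (h2_convex : convex_function [set: R^o] h2)
  (dh1_ge0 : \forall t \ae (@lebesgue_measure R), 0 <= derive1 h1 t)
  (dh2_ge0 : \forall t \ae (@lebesgue_measure R), 0 <= derive1 h2 t)
  (dh1_lim : ess_lim_pinfty (derive1 h1) alpha1)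
  (dh2_lim : ess_lim_pinfty (derive1 h2) alpha2)
  (alpha1_itv : alpha1 \in `[0, 1[)
  (alpha2_itv : alpha2 \in `[0, 1[)
  (a : 'rV[R]_2)
  (a1 : h1 (a 0 1) = a 0 0)
  (a2 : h2 (a 0 0) = a 0 1)
  (slope : exists v0 v1 v2 : 'rV[R]_2,
     let th1 := fun t : R => - a 0 0 + h1 (t + a 0 1) in
     let th2 := fun t : R => - a 0 1 + h2 (t + a 0 0) in
     admissible th1 th2 v0 v1 v2 /\ slope_condition th1 th2 v0 v1 v2)
  (v w : 'rV[R]_2 -> R)
  (v_bounded : [bounded v x | x in closure (Omega R)])
  (w_bounded : [bounded w x | x in closure (Omega R)])
  (v_sub : viscosity_subsolution F
     (fun p => - p 0 0 + h1 (p 0 1)) (fun p => - p 0 1 + h2 (p 0 0)) v)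
  (w_super : viscosity_supersolution F
     (fun p => - p 0 0 + h1 (p 0 1)) (fun p => - p 0 1 + h2 (p 0 0)) w) :
  forall x : 'rV[R]_2, closure (Omega R) x -> v x <= w x.
Proof.
have [{F_i}mu mu0 F_i] := F_i; have [{F_ii}L L0 F_ii] := F_ii; have [{F_iii}omega omod F_iii] := F_iii.
move: alpha1_itv alpha2_itv; rewrite !in_itv/= => /andP[al10 al11] /andP[al20 al21].
have [al [al0 al1 al1E al2E]] : exists al : R, [/\ 0 <= al, al < 1, alpha1 <= al & alpha2 <= al].
  by exists (Num.max alpha1 alpha2); rewrite le_max al10 gt_max al11 !le_max !lexx orbT.
have lip (h : R -> R) (b : R) : b <= al -> (forall s t, s <= t -> 0 <= h t - h s <= b * (t - s)) ->
    forall s t, s <= t -> 0 <= h t - h s <= al * (t - s).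
  move=> bal hh s t st; have /andP[-> hu] := hh s t st.
  by apply: (le_trans hu); rewrite ler_wpM2r// subr_ge0.
have {}lip1 := lip _ _ al1E (convex_oblique h1_convex dh1_ge0 dh1_lim).
have {}lip2 := lip _ _ al2E (convex_oblique h2_convex dh2_ge0 dh2_lim).
have [C [C0 dbl]] := doubling al0 al1 lip1 lip2 a1 a2.
have [B [B0 vB wB]] : exists B : R, [/\ 0 <= B, forall x, closure (Omega R) x -> `|v x| <= B &
    forall x, closure (Omega R) x -> `|w x| <= B].
  have vb : \forall B \near +oo, forall x, closure (Omega R) x -> `|v x| <= B := v_bounded.
  have wb : \forall B \near +oo, forall x, closure (Omega R) x -> `|w x| <= B := w_bounded.
  have [B [B0 [vB wB]]] := filter_ex (filterI (nbhs_pinfty_ge (num_real 0)) (filterI vb wb)).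
  by exists B; split.
move=> x clx; rewrite leNgt; apply/negP => wv.
have [x1 [x2 [xE x10 x20]]] : exists x1 x2, [/\ x = vec2 x1 x2, 0 <= x1 & 0 <= x2].
  exists (x 0 0), (x 0 1); rewrite -vec2_eta; split=> //.
    by move: clx; rewrite {1}(vec2_eta x) => /closure_Omega[].
  by move: clx; rewrite {1}(vec2_eta x) => /closure_Omega[].
rewrite {}xE in clx wv.
have [th thE] : exists th, th = v (vec2 x1 x2) - w (vec2 x1 x2) by eexists.
have th0 : 0 < th by rewrite thE subr_gt0.
have mt0 : 0 < mu * th by rewrite mulr_gt0.
have z0 : 0 <= zeta x1 + zeta x2 by rewrite addr_ge0// (le_trans _ (zeta_ge _)).
(* The second bound keeps half of the excess [th] after penalization; the third keeps the effect of
   the penalty on the equation below [mu * th / 16]. *)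
have [d d0 /= /and4P[d1 d2 d3 _]] : exists2 d : R, 0 < d &
    all (fun c => d <= c) [:: 1; th / (4 * (zeta x1 + zeta x2 + 1)); mu * th / (320 * L)].
  by apply: exists_below; rewrite /= ltr01 !divr_gt0 ?mulr_gt0// ltr_wpDl.
have {}d2 : 4 * (d * (zeta x1 + zeta x2)) <= th.
  move: d2; rewrite ler_pdivlMr ?mulr_gt0// ?ltr_wpDl//; move: d0; clear; lra.
have {}d3 : 20 * (L * d) * 16 <= mu * th.
  by move: d3; rewrite ler_pdivlMr ?mulr_gt0//; clear; lra.
have mt16 : 0 < mu * th / 16 by rewrite divr_gt0.
have [t t0 ot] := modulus_small omod mt16.
have [tau tau0 /= /and3P[tau1 tau2 _]] : exists2 tau : R, 0 < tau & all (fun c => tau <= c) [:: th / 16; t / C].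
  by apply: exists_below; rewrite /= !divr_gt0.
have {}tau2 : C * tau <= t by rewrite mulrC -ler_pdivlMr.
have al1' : 0 < 1 - al by rewrite subr_gt0.
have [e e0 /= /and4P[e1 e2 e3 _]] : exists2 e : R, 0 < e &
    all (fun c => e <= c) [:: 1; (1 - al) * d / 2; mu * th / (416 * L)].
  by apply: exists_below; rewrite /= ltr01 !divr_gt0 ?mulr_gt0.
have {}e3 : 26 * (L * e) * 16 <= mu * th.
  by move: e3; rewrite ler_pdivlMr ?mulr_gt0//; clear; lra.
have {}e2 : e < (1 - al) * d.
  by have : 0 < (1 - al) * d; [exact: mulr_gt0|move: e2; clear; lra].
pose f y1 y2 := v (vec2 y1 y2) - d * (zeta y1 + zeta y2).
pose g y1 y2 := - w (vec2 y1 y2) - d * (zeta y1 + zeta y2).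
have cl (y1 y2 : R) : 0 <= y1 -> 0 <= y2 -> closure (Omega R) (vec2 y1 y2) by move=> *; exact/closure_Omega.
have fu : quadrant_usc f by apply: usc_on_penalized => //; exact: v_sub.1.
have gu : quadrant_usc g.
  apply: (@usc_on_penalized _ (fun y => - w y)) => // y cly c wc.
  have wc' : - c < w y by rewrite ltrNl.
  apply: (filterS _ (w_super.1 y cly _ wc')) => y' h.
  by rewrite ltrNl.
have fB y1 y2 : 0 <= y1 -> 0 <= y2 -> f y1 y2 <= B - d * (y1 + y2).
  move=> y10 y20; rewrite /f lerB//; first exact: (le_trans (ler_norm _) (vB _ (cl _ _ y10 y20))).
  by rewrite ler_pM2l// lerD// zeta_ge.
have gB y1 y2 : 0 <= y1 -> 0 <= y2 -> g y1 y2 <= B.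
  move=> y10 y20; have := wB _ (cl _ _ y10 y20); rewrite ler_norml => /andP[wb _].
  have : 0 <= d * (zeta y1 + zeta y2).
    by rewrite mulr_ge0// ?(ltW d0)// addr_ge0// (le_trans _ (zeta_ge _)).
  by move: wb; rewrite /g; clear; lra.
have [|S [fgS SS]] := @sum_sup _ f g (B + B).
  move=> y1 y2 y10 y20; rewrite lerD ?gB//; apply: (le_trans (fB _ _ y10 y20)).
  by rewrite gerBl mulr_ge0 ?addr_ge0// ltW.
have Sth : th / 2 <= S.
  by apply: le_trans (fgS _ _ x10 x20); move: d2; rewrite /f /g thE; clear; lra.
have [y1 [y2 [z1 [z2 [p1 [p2 [q1 [q2 [l11 [l12 [l22 [m11 [m12 [m22 [A [r H]]]]]]]]]]]]]]]] :=
  dbl f g B d S tau e fu gu d0 d1 tau0 e0 e1 fB gB fgS SS.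
case: H => r0 A0 [y10 y20 z10 z20 Sfg] [pq1 pq2 gap] [[bd1 bd2 bd3 bd4] [lA mA lm] jf jg].
have z2nd (s h : R) : 0 <= s -> 0 <= s + h -> d * zeta (s + h) <= d * (zeta s + dzeta s * h + 2 * h ^+ 2).
  by move=> s0 sh; rewrite ler_pM2l// zeta_semiconcave.
have dz (s : R) : 0 <= s -> - d <= d * dzeta s <= d.
  move=> s0; have /andP[h h'] := dzeta_bound s0.
  have := ler_wpM2l (ltW d0) h; have := ler_wpM2l (ltW d0) h'; clear; lra.
have hd (h : R -> R) (s k : R) : (forall s t, s <= t -> 0 <= h t - h s <= al * (t - s)) ->
    - d <= k <= d -> `|h (s + k) - h s| <= al * d.
  move=> hh /andP[k1 k2].
  have aa : al * d = al * (d - k) + al * k by ring.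
  have a1' : 0 <= al * (d - k) by rewrite mulr_ge0// subr_ge0.
  have a2' : 0 <= al * (d + k) by rewrite mulr_ge0//; move: k1; clear; lra.
  rewrite ler_norml; have [k0|k0] := leP 0 k.
    have /hh : s <= s + k by rewrite lerDl.
    by move: a1' a2'; clear; lra.
  have /hh : s + k <= s by rewrite gerDl ltW.
  by move: a1' a2'; clear; lra.
(* The Hessian gains [6 * e] from the jet error [3 * e] and [4 * d] from the semiconcavity constant
   2 of [zeta]. *)
have Fv : F (symmx (l11 + (6 * e + 4 * d)) l12 (l22 + (6 * e + 4 * d)))
    (vec2 (p1 + d * dzeta y1) (p2 + d * dzeta y2)) (v (vec2 y1 y2)) (vec2 y1 y2) <= 0.
  apply: (subsolution_quadratic v_sub y10 y20 r0).
  - move=> k1 k2 yk1 yk2 k1r k2r; have := jf _ _ k1r k2r yk1 yk2.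
    have := z2nd _ _ y10 yk1; have := z2nd _ _ y20 yk2; rewrite /f /form; clear; lra.
  (* At [y1 = 0] the penalty raises [H1] by [d] through the normal slope and lowers it by at most
     [al * d] through the tangential one; the gain exceeds the boundary error [e]. *)
  - move=> yE; have := bd1 yE; have := hd _ p2 _ lip1 (dz _ y20); rewrite vec2E0 vec2E1 yE dzeta0.
    by rewrite ler_norml; move: e2; clear; lra.
  move=> yE; have := bd3 yE; have := hd _ p1 _ lip2 (dz _ y10); rewrite vec2E0 vec2E1 yE dzeta0.
  by rewrite ler_norml; move: e2; clear; lra.
have Fw : 0 <= F (symmx (m11 - (6 * e + 4 * d)) m12 (m22 - (6 * e + 4 * d)))
    (vec2 (q1 + - (d * dzeta z1)) (q2 + - (d * dzeta z2))) (w (vec2 z1 z2)) (vec2 z1 z2).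
  have dzN (s : R) : 0 <= s -> - d <= - (d * dzeta s) <= d.
    by move=> /dz/andP[h h']; rewrite lerN2 h' lerNl h.
  apply: (supersolution_quadratic w_super z10 z20 r0).
  - move=> k1 k2 zk1 zk2 k1r k2r; have := jg _ _ k1r k2r zk1 zk2.
    have := z2nd _ _ z10 zk1; have := z2nd _ _ z20 zk2; rewrite /g /form; clear; lra.
  - move=> zE; have := bd2 zE; have := hd _ q2 _ lip1 (dzN _ z20); rewrite vec2E0 vec2E1 zE dzeta0.
    by rewrite ler_norml; move: e2; clear; lra.
  move=> zE; have := bd4 zE; have := hd _ q1 _ lip2 (dzN _ z10); rewrite vec2E0 vec2E1 zE dzeta0.
  by rewrite ler_norml; move: e2; clear; lra.
have vw : th / 4 <= v (vec2 y1 y2) - w (vec2 z1 z2).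
  have zz (s s' : R) : 0 <= s -> 0 <= s' -> 0 <= d * (zeta s + zeta s').
    by move=> s0 s0'; rewrite mulr_ge0// ?(ltW d0)// addr_ge0// (le_trans _ (zeta_ge _)).
  have := zz _ _ y10 y20; have := zz _ _ z10 z20; move: Sfg Sth tau1 th0; rewrite /f /g; clear; lra.
have wv' : w (vec2 z1 z2) <= v (vec2 y1 y2) by move: vw th0; clear; lra.
have := structure_gap F_cont F_i F_ii F_iii p1 p2 (ltW L0) A0 y10 y20 z10 z20 wv' Fv Fw lA mA lm.
set D := enorm (vec2 (y1 - z1) (y2 - z2)); set E := enorm (vec2 p1 p2).
have D0 : 0 <= D by exact: sqrtr_ge0.
have E0 : 0 <= E by exact: sqrtr_ge0.
have small : omega (A * D ^+ 2 + D * (E + 1)) <= mu * th / 16.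
  apply: ot; rewrite addr_ge0 ?mulr_ge0 ?sqr_ge0 ?(ltW A0) ?addr_ge0//=; apply: le_trans tau2.
  apply: le_trans gap; apply: lerD.
    by rewrite ler_pM2l// ler_pXn2r// ?nnegrE ?addr_ge0//; exact: enorm_le.
  by apply: ler_pM => //; [rewrite addr_ge0|exact: enorm_le|rewrite lerD2r; exact: enorm_le].
have n6 : 0 <= 6 * e + 4 * d by rewrite addr_ge0 ?mulr_ge0// ltW.
have gapX : `|l11 - (l11 + (6 * e + 4 * d))| + 2 * `|l12 - l12| + `|l22 - (l22 + (6 * e + 4 * d))|
    + `|p1 - (p1 + d * dzeta y1)| + `|p2 - (p2 + d * dzeta y2)| <= 12 * e + 10 * d.
  have sub (s k : R) : s - (s + k) = - k by ring.
  rewrite !sub subrr normr0 !normrN (ger0_norm n6).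
  by have := dz _ y10; have := dz _ y20; rewrite -!ler_norml; clear; lra.
have gapZ : `|m11 - (6 * e + 4 * d) - m11| + 2 * `|m12 - m12| + `|m22 - (6 * e + 4 * d) - m22|
    + `|q1 + - (d * dzeta z1) - p1| + `|q2 + - (d * dzeta z2) - p2| <= 14 * e + 10 * d.
  have sub (s k : R) : s - k - s = - k by ring.
  have sub' (s k p : R) : s + - k - p = - (p - s) - k by ring.
  rewrite !sub !sub' subrr normr0 !normrN (ger0_norm n6).
  have := ler_normB (- (p1 - q1)) (d * dzeta z1); have := ler_normB (- (p2 - q2)) (d * dzeta z2).
  rewrite !normrN; move: pq1 pq2; have := dz _ z10; have := dz _ z20; rewrite -!ler_norml; clear; lra.
have {gapX} := ler_wpM2l (ltW L0) gapX; have {gapZ} := ler_wpM2l (ltW L0) gapZ.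
have := ler_wpM2l (ltW mu0) vw.
(* The gap in [u] is worth at least [mu * th / 4], while the modulus and the terms [26 * (L * e)]
   and [20 * (L * d)] contribute at most [mu * th / 16] each. *)
by move: small d3 e3 mt0; clear; lra.
Qed.
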